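(* Let $N\ge 1$, let $\Omega\subset\mathbb{R}^N$ be a bounded domain with smooth boundary, let $a,b>0$ be constants, and let $f\in L^{\frac{2^*}{2^*-1}}(\Omega)$ be positive a.e. in $\Omega$. Then there exists $\mu_*>0$ such that the problem $$-\Big(a-b\int_\Omega|\nabla u|^2dx\Big)\Delta u=\mu f(x)\ \text{ in }\Omega,\qquad u=0\ \text{ on }\partial\Omega,$$ has at least three nontrivial (weak) solutions for every $\mu\in(0,\mu_* )$, and at least one nontrivial (weak) solution for every $\mu\in[\mu_*,+\infty)$.
   Context: $2^*=\frac{2N}{N-2}$ if $N\ge 3$ and $2^*=+\infty$ if $N=1,2$ (in which case $\frac{2^*}{2^*-1}$ is read as $1$). Solutions are weak solutions: $u\in H_0^1(\Omega)$ is a solution of the problem if $\big(a-b\int_\Omega|\nabla u|^2dx\big)\int_\Omega\nabla u\cdot\nabla v\,dx=\mu\int_\Omega f v\,dx$ for all $v\in H_0^1(\Omega)$. Nontrivial means $u\not\equiv 0$.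
   Formalization: For N=2 it is additionally assumed that fv is integrable on Ω for every v in H_0^1(Ω); for f merely in L^1(Ω) the statement fails, since ∫fv can be infinite and then no weak solution exists for any μ>0. *)

(* Defs.v *)
From HB Require Import structures.
From mathcomp Require Import all_boot all_order all_algebra.
From mathcomp Require Import all_classical all_reals all_analysis.

Set Implicit Arguments.
Unset Strict Implicit.
Unset Printing Implicit Defensive.
Import Order.TTheory GRing.Theory Num.Theory.
Import numFieldNormedType.Exports.

Local Open Scope classical_set_scope.
Local Open Scope ring_scope.

Definition rV_display : measure_display.
Proof. exact: default_measure_display. Qed.

Section rV_measurable.
Context {R : realType} {n : nat}.

(* The sigma-algebra generated by the coordinates, which for finite n is the
   Borel one; this is the construction of the library for n.-tuple R. *)
Definition rV_coord (i : 'I_n) (x : 'rV[R]_n) : measurableTypeR R := x ord0 i.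

Let rV_set0 : g_sigma_preimage rV_coord set0.
Proof. exact: sigma_algebra0. Qed.

Let rV_setC A : g_sigma_preimage rV_coord A ->
  g_sigma_preimage rV_coord (~` A).
Proof. exact: sigma_algebraC. Qed.

Let rV_bigcup (F : (set _)^nat) : (forall i, g_sigma_preimage rV_coord (F i)) ->
  g_sigma_preimage rV_coord (\bigcup_i (F i)).
Proof. exact: sigma_algebra_bigcup. Qed.

HB.instance Definition _ := @isMeasurable.Build rV_display
  'rV[R]_n (g_sigma_preimage rV_coord) rV_set0 rV_setC rV_bigcup.

End rV_measurable.


Lemma measurable_rV_coord (R : realType) (n : nat) (i : 'I_n) :
  measurable_fun [set: 'rV[R]_n] (rV_coord i).
Proof.
move=> _ Y mY; rewrite setTI; apply: sub_sigma_algebra => /=.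
rewrite -bigcup_seq/=; exists i => /=; first by rewrite mem_index_enum.
by exists Y => //; rewrite setTI.
Qed.

Lemma measurable_rVP d (T : measurableType d) (R : realType) (n : nat)
    (f : T -> 'rV[R]_n) :
  (forall i, measurable_fun [set: T] (rV_coord i \o f)) ->
  measurable_fun [set: T] f.
Proof.
move=> mf; suff sub : measurable `<=` image_set_system [set: T] f measurable.
  by move=> _ A /sub; rewrite /image_set_system/=.
apply: smallest_sub.
  exact/sigma_algebra_image/sigma_algebra_measurable.
case: n f mf => [|n] f mf; first by rewrite big_ord0.
rewrite -bigcup_mkord_ord; apply: bigcup_sub => i Ii A [B mB <-].
rewrite /image_set_system/= !setTI -comp_preimage -[X in measurable X]setTI.
exact: mf.
Qed.

Section lebesgue_rV.
Context {R : realType}.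

Definition rV_cons (n : nat) (p : measurableTypeR R * 'rV[R]_n) : 'rV[R]_n.+1 :=
  row_mx (const_mx p.1 : 'rV_1) p.2.

Lemma measurable_rV_cons (n : nat) : measurable_fun setT (@rV_cons n).
Proof.
apply: measurable_rVP => i.
case: (split_ordP (i : 'I_(1 + n))) => j ->.
- rewrite (_ : _ \o _ = fst); first exact: measurable_fst.
  apply/funext => x; rewrite /= /rV_coord.
  by apply: (etrans (row_mxEl _ _ _ _)); rewrite mxE.
- rewrite (_ : _ \o _ = rV_coord j \o snd).
    by apply: measurableT_comp => //; exact: measurable_rV_coord.
  by apply/funext => x; exact: row_mxEr.
Qed.

HB.instance Definition _ (n : nat) :=
  isMeasurableFun.Build _ _ _ _ (@rV_cons n) (@measurable_rV_cons n).

Lemma rV_consP (n : nat) (x : 'rV[R]_n.+1) :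
  exists p, x = @rV_cons n p.
Proof.
exists (lsubmx (x : 'rV_(1 + n)) 0 0, rsubmx (x : 'rV_(1 + n))).
rewrite -[LHS](hsubmxK (x : 'rV_(1 + n))) /rV_cons/=.
congr (@row_mx R 1 1 n _ _).
by apply/rowP => i; rewrite ord1 [RHS]mxE.
Qed.

Lemma rV_cons_inj (n : nat) : injective (@rV_cons n).
Proof.
move=> [a x] [b y]; rewrite /rV_cons/= => h.
have [/rowP/(_ 0) + ->] := @eq_row_mx R 1 1 n _ _ _ _ h.
by rewrite !mxE => ->.
Qed.

Lemma rV_cons0 (n : nat) (p : measurableTypeR R * 'rV[R]_n) :
  rV_cons p ord0 ord0 = p.1.
Proof.
rewrite (_ : ord0 = lshift n ord0 :> 'I_(1 + n)); last exact: val_inj.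
by apply: (etrans (@row_mxEl R 1 1 n _ _ _ _)); rewrite mxE.
Qed.

Lemma rV_consS (n : nat) (p : measurableTypeR R * 'rV[R]_n) (i : 'I_n) :
  rV_cons p ord0 (lift ord0 i) = p.2 ord0 i.
Proof. by rewrite -rshift1; exact: (@row_mxEr R 1 1 n). Qed.

Lemma measurable_image_rV_cons (n : nat) (A : set (measurableTypeR R * 'rV[R]_n)) :
  measurable A -> measurable (@rV_cons n @` A).
Proof.
pose g (x : 'rV[R]_n.+1) : measurableTypeR R * 'rV[R]_n :=
  (x ord0 ord0, rsubmx (x : 'rV_(1 + n))).
have gK p : g (rV_cons p) = p.
  case: p => a x; rewrite /g; congr pair; last exact: row_mxKr.
  exact: rV_cons0.
have mg : measurable_fun setT g.
  apply/measurable_fun_pairP; split; first exact: (measurable_rV_coord ord0).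
  apply: measurable_rVP => i.
  rewrite (_ : _ \o _ = rV_coord (rshift 1 i)).
    exact: measurable_rV_coord.
  by apply/funext => x; rewrite /= /rV_coord/= mxE.
move=> mA; rewrite (_ : _ @` _ = g @^-1` A).
  by rewrite -[X in measurable X]setTI; exact: mg.
apply/seteqP; split=> [_ [p Ap <-]|x]; first by rewrite /= gK.
by have [p ->] := rV_consP x; rewrite /= gK => Ap; exists p.
Qed.

Section cons_measure.
Variables (n : nat) (mu : {sigma_finite_measure set 'rV[R]_n -> \bar R}).

Definition lebesgue_cons : set 'rV[R]_n.+1 -> \bar R :=
  pushforward (lebesgue_measure \x mu)%E (@rV_cons n).

Let lebesgue_cons0 : lebesgue_cons set0 = 0%E.
Proof. exact: measure0. Qed.

Let lebesgue_cons_ge0 A : (0 <= lebesgue_cons A)%E.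
Proof. exact: measure_ge0. Qed.

Let lebesgue_cons_sigma_additive : semi_sigma_additive lebesgue_cons.
Proof. exact: measure_semi_sigma_additive. Qed.

HB.instance Definition _ := isMeasure.Build _ _ _ lebesgue_cons
  lebesgue_cons0 lebesgue_cons_ge0 lebesgue_cons_sigma_additive.

Let lebesgue_cons_sigma_finite : sigma_finite setT lebesgue_cons.
Proof.
have [F [UF mF]] : exists F : (set (measurableTypeR R * 'rV[R]_n))^nat,
    \bigcup_i F i = setT /\
    forall i, measurable (F i) /\ ((@lebesgue_measure R \x mu) (F i) < +oo)%E.
  have /sigma_finiteP[F [TF ndF Foo]] := sigma_finiteT (@lebesgue_measure R).
  have /sigma_finiteP[G [TG ndG Goo]] := sigma_finiteT mu.
  exists (fun n => F n `*` G n); split.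
    rewrite -setXTT TF TG predeqE => -[x y]; split.
      by move=> [k _ []/= ? ?]; split; exists k.
    move=> [/= [k _ Fkx] [l _ Gly]]; exists (maxn k l) => //; split.
    - by move: x Fkx; exact/subsetPset/ndF/leq_maxl.
    - by move: y Gly; exact/subsetPset/ndG/leq_maxr.
  move=> k; have [? ?] := Foo k; have [? ?] := Goo k.
  split; first exact: measurableX.
  by rewrite product_measure1E// lte_mul_pinfty// ge0_fin_numE.
have UG : \bigcup_i (@rV_cons n @` F i) = setT.
  apply/seteqP; split=> // x _; have [p ->] := rV_consP x.
  have : [set: _] p by []; rewrite -UF => -[i _ Fip].
  by exists i => //; exists p.
have FE i : @rV_cons n @^-1` (@rV_cons n @` F i) = F i.
  apply/seteqP; split=> [p [q Fq /rV_cons_inj <-]//|p Fp].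
  by exists p.
exists (fun i => @rV_cons n @` F i) => // i.
split; first by apply: measurable_image_rV_cons; have [] := mF i.
by rewrite /lebesgue_cons /pushforward FE; have [] := mF i.
Qed.

HB.instance Definition _ := Measure_isSigmaFinite.Build _ _ _ lebesgue_cons
  lebesgue_cons_sigma_finite.

End cons_measure.

(* Lebesgue measure on R^n: the n-fold product of the one on R. *)
Fixpoint lebesgue_rV (n : nat) : {sigma_finite_measure set 'rV[R]_n -> \bar R} :=
  if n is m.+1 then lebesgue_cons (lebesgue_rV m)
  else dirac (0 : 'rV[R]_0).

Lemma lebesgue_rV_box (n : nat) (A : 'I_n -> set (measurableTypeR R)) :
  (forall i, measurable (A i)) ->
  lebesgue_rV n [set x : 'rV[R]_n | forall i, A i (x ord0 i)] =
  (\prod_(i < n) lebesgue_measure (A i))%E.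
Proof.
elim: n A => [|n IHn] A mA.
  rewrite big_ord0 /= diracE mem_set// => -[] //.
rewrite big_ord_recl /= /lebesgue_cons /pushforward.
pose B := [set x : 'rV[R]_n | forall i, A (lift ord0 i) (x ord0 i)].
have mB : measurable B.
  rewrite (_ : B = \bigcap_(i in [set: 'I_n]) (rV_coord i @^-1` A (lift ord0 i))).
    apply: fin_bigcap_measurable; first exact: finite_finset.
    move=> i _; rewrite -[X in measurable X]setTI.
    by apply: measurable_rV_coord.
  by apply/seteqP; split=> x Bx i => [_|]; exact: Bx.
rewrite (_ : _ @^-1` _ = A ord0 `*` B).
  by rewrite product_measure1E// -IHn.
apply/seteqP; split=> p /=.
  by move=> Ap; split=> [|i]; [rewrite -rV_cons0; exact: Ap|rewrite -(rV_consS p); exact: Ap].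
move=> [A0 Bp] i; case: (unliftP ord0 i) => [j ->|->]; last by rewrite rV_cons0.
by rewrite rV_consS; exact: Bp.
Qed.

End lebesgue_rV.

Section sobolev.
Context {R : realType} {N : nat}.
Implicit Types (Omega : set 'rV[R]_N) (f phi u v w : 'rV[R]_N -> R).

Definition partial (i : 'I_N) f : 'rV[R]_N -> R :=
  fun x => 'D_(delta_mx ord0 i) f x.

Definition smooth f : Prop :=
  forall s : seq 'I_N, continuous (foldr partial f s) /\
    forall i x, derivable (foldr partial f s) x (delta_mx ord0 i).

Definition gradient f (x : 'rV[R]_N) : 'rV[R]_N := \row_i partial i f x.

Definition dot (x y : 'rV[R]_N) : R := \sum_i x ord0 i * y ord0 i.

Definition bounded_domain Omega : Prop :=
  [/\ Omega !=set0, open Omega, connected Omega & bounded_set Omega].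

(* Each boundary point has a neighborhood U in which Omega is the sublevel set
   of a smooth function rho without critical point in U, i.e. Omega lies
   locally on one side of the smooth hypersurface rho = 0. *)
Definition smooth_boundary Omega : Prop :=
  forall x0, (closure Omega `\` interior Omega) x0 ->
  exists U rho, [/\ open U, U x0, smooth rho &
    forall x, U x -> gradient rho x != 0 /\ (Omega x <-> rho x < 0)].

(* C_c^oo(Omega) *)
Definition test_function Omega phi : Prop :=
  smooth phi /\
  exists K, [/\ compact K, K `<=` Omega & forall x, ~ K x -> phi x = 0].

(* Representatives of L^p(Omega): functions on R^N, whose values outside Omega
   play no role. *)
Definition Lp (p : \bar R) Omega u : Prop :=
  u \_ Omega \in Lfun (@lebesgue_rV R N) p.

Definition is_weak_gradient Omega u (g : 'rV[R]_N -> 'rV[R]_N) : Prop :=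
  (forall i, Lp 2%:E Omega (fun x => g x ord0 i)) /\
  forall phi i, test_function Omega phi ->
    \int[@lebesgue_rV R N]_(x in Omega) (u x * partial i phi x) =
    - \int[@lebesgue_rV R N]_(x in Omega) (g x ord0 i * phi x).

Definition H1 Omega u : Prop :=
  Lp 2%:E Omega u /\ exists g, is_weak_gradient Omega u g.

(* For u in H1, a choice of representative of the weak gradient, which is
   unique up to a null subset of Omega. *)
Definition weak_gradient Omega u : 'rV[R]_N -> 'rV[R]_N :=
  xget (cst 0) [set g | is_weak_gradient Omega u g].

Definition H1_norm2 Omega u : \bar R :=
  (\int[@lebesgue_rV R N]_(x in Omega)
     ((u x) ^+ 2 + dot (weak_gradient Omega u x) (weak_gradient Omega u x))%R%:E)%E.

(* The closure of C_c^oo(Omega) in H1(Omega). *)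
Definition H01 Omega u : Prop :=
  H1 Omega u /\
  forall e : R, 0 < e ->
    exists2 phi, test_function Omega phi & (H1_norm2 Omega (u \- phi)%R < e%:E)%E.

Definition dirichlet Omega u v : R :=
  \int[@lebesgue_rV R N]_(x in Omega)
    dot (weak_gradient Omega u x) (weak_gradient Omega v x).

(* The right-hand side is an integral in \bar R, so that the equation includes
   the finiteness of the integral of f v. *)
Definition weak_solution Omega (a b mu : R) f u : Prop :=
  H01 Omega u /\
  forall v, H01 Omega v ->
    (((a - b * dirichlet Omega u u) * dirichlet Omega u v)%:E =
     mu%:E * \int[@lebesgue_rV R N]_(x in Omega) (f x * v x)%:E)%E.

Definition nontrivial_weak_solution Omega (a b mu : R) f u : Prop :=
  weak_solution Omega a b mu f u /\
  ~ (u = cst 0 %[ae @lebesgue_rV R N in Omega]).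

End sobolev.

(* The critical Sobolev exponent 2^* *)
Definition sobolev_exponent (R : realType) (N : nat) : \bar R :=
  if (3 <= N)%N then (2 * N%:R / (N%:R - 2))%:E else +oo%E.

(* Main.v *)
(* The Dirichlet form is a scalar product on H_0^1, so the linear problem
   [-Delta w = f] has a solution w by the Riesz representation theorem, and the
   function [t w] solves the Kirchhoff problem as soon as
   [t (a - b D t^2) = mu], where [D > 0] is the Dirichlet energy of w. This
   cubic equation has a negative root for every [mu > 0], and two further,
   positive roots when mu is small.

   The Riesz theorem needs [v |-> \int f v] to be bounded on H_0^1. For N = 1
   this follows from the bound of [sup |v|] by the energy, for N >= 3 from the
   Sobolev inequality. For N = 2 it follows from the mere finiteness of
   [\int |f v|] for all v by a gliding hump argument: were the truncated
   pairings [\int min(|f|, k) |v|] not uniformly bounded on test functions, a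
   convergent sequence of perturbations would produce a v in H_0^1 with
   [\int |f v|] infinite. *)
Require Import Defs.
From HB Require Import structures.
From mathcomp Require Import all_boot all_order all_algebra.
From mathcomp Require Import all_classical all_reals all_analysis.
From mathcomp Require Import measurable_realfun.
From mathcomp Require Import ring lra.
Import Order.TTheory GRing.Theory Num.Theory.
Import numFieldNormedType.Exports.

Set Implicit Arguments.
Unset Strict Implicit.
Unset Printing Implicit Defensive.

Local Open Scope classical_set_scope.
Local Open Scope ring_scope.

(** * Square-integrable functions *)

(** No Hilbert space is built. [H01] and [dirichlet] refer to a weak gradient picked by choice, so
    the arguments run on test functions, whose gradient is classical, and on explicit pairs of a
    function and one of its weak gradients. That any weak gradient may replace the chosen one rests
    on its uniqueness almost everywhere, hence on the fundamental lemma of the calculus of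
    variations; the same lemma gives [D > 0], since [D = 0] would force f to vanish. Sequences are
    made to converge at the rate [4^-n]: Riesz-Fischer then produces a limit function, and an
    identity holds in the limit because its squared defect is at most [B / 4^n] for every n.

    The integrability of [f v] belongs to the notion of weak solution and is not known beforehand.
    Each truncation [min(|f|, k)] is bounded, so its pairing is continuous in L2, and what remains
    to be proved is a bound on test functions that is uniform in k.

    The threshold is the value of the cubic at the s with [b D s^2 = a / 2]. It lies below the
    maximum of the cubic, attained where [b D t^2 = a / 3]; any positive value below that maximum
    would do. *)

Lemma discriminant_le (R : realFieldType) (p q r : R) :
  (forall t, 0 <= p + 2 * t * q + t ^+ 2 * r) -> q ^+ 2 <= p * r.
Proof.
move=> h.
have p0 : 0 <= p by have := h 0; rewrite expr0n/=; lra.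
have r0 : 0 <= r.
  rewrite leNgt; apply/negP => r0.
  (* For [r < 0] take [t = 1 + x] with [x r = - (p + 2 |q| + 1)]: then [t^2 r = t r + t (x r)]
     outweighs [p + 2 t q]. *)
  have := h (1 + (p + 2 * `|q| + 1) / - r); set x := _ / - r => hx.
  have x0 : 0 <= x by rewrite /x divr_ge0// ?oppr_ge0 ?(ltW r0)// !addr_ge0// mulr_ge0.
  have xr : x * r = - (p + 2 * `|q| + 1) by rewrite /x invrN mulrN mulNr divfK ?lt_eqF.
  have q1 := ler_norm q.
  have q2 : - q <= `|q| by rewrite -normrN ler_norm.
  have e : p + 2 * (1 + x) * q + (1 + x) ^+ 2 * r =
    p + 2 * (1 + x) * q + (1+x) * r + (1+x) * (x * r) by ring.
  move: hx; rewrite e xr.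
  have : 0 <= (1 + x) * (`|q| - q) by rewrite mulr_ge0 ?subr_ge0// addr_ge0.
  have : 0 <= x * (p + 1 - r) by rewrite mulr_ge0//; lra.
  nra.
have [rz|rn] := eqVneq r 0.
  suff -> : q = 0 by rewrite expr0n/= mulr_ge0.
  apply/eqP/negPn/negP => q0.
  have := h (- (p + 1) / q); rewrite rz.
  have -> : 2 * (- (p + 1) / q) * q = - 2 * (p + 1) by field.
  lra.
have rp : 0 < r by rewrite lt_def rn.
have := h (- q / r).
have -> : p + 2 * (- q / r) * q + (- q / r) ^+ 2 * r = p - q ^+ 2 / r by field.
by rewrite subr_ge0 ler_pdivrMr.
Qed.

Section square_integrable.
Context d (T : measurableType d) (R : realType).
Variables (mu : {measure set T -> \bar R}) (D : set T).
Hypothesis mD : measurable D.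
Implicit Types f g h u v : T -> R.

(** These are functions, not classes modulo null sets, and both conditions concern D alone; for
    [D = Omega] this is [Lp 2] by [Lp2P]. *)
Definition sqint f := measurable_fun D f /\
  (\int[mu]_(x in D) ((f x) ^+ 2)%:E < +oo)%E.

Definition ip f g := \int[mu]_(x in D) (f x * g x).

Lemma sqint_measurable f : sqint f -> measurable_fun D f.
Proof. by case. Qed.

Lemma sqint_integrable_sqr f : sqint f ->
  mu.-integrable D (EFin \o (fun x => f x ^+ 2)).
Proof.
move=> [mf fi]; apply/integrableP; split.
  by apply/measurable_EFinP; exact: measurable_funX.
by under eq_integral do rewrite /= ger0_norm ?sqr_ge0//.
Qed.

Lemma sqint_mul f g : sqint f -> sqint g ->
  mu.-integrable D (EFin \o (fun x => f x * g x)).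
Proof.
move=> Lf Lg.
apply: (@le_integrable _ _ _ _ _ mD _ (fun x => (f x ^+ 2)%:E + (g x ^+ 2)%:E)%E).
- by apply/measurable_EFinP/measurable_funM; apply: sqint_measurable.
- move=> x _ /=; rewrite lee_fin (ger0_norm (addr_ge0 _ _)) ?sqr_ge0//.
  rewrite normrM -(real_normK (num_real (f x))) -(real_normK (num_real (g x))).
  have := sqr_ge0 (`|f x| - `|g x|).
  by have := mulr_ge0 (normr_ge0 (f x)) (normr_ge0 (g x)); nra.
- by apply: integrableD => //; exact: sqint_integrable_sqr.
Qed.

Lemma sqintP f : measurable_fun D f ->
  mu.-integrable D (EFin \o (fun x => f x ^+ 2)) -> sqint f.
Proof.
move=> mf /integrableP[_ fi]; split=> //.
by move: fi; under eq_integral do rewrite /= ger0_norm ?sqr_ge0//.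
Qed.

Lemma sqint_dominated f g : measurable_fun D f -> sqint g ->
  (forall x, D x -> `|f x| <= `|g x|) -> sqint f.
Proof.
move=> mf Lg fg; apply: sqintP => //.
apply: le_integrable (sqint_integrable_sqr Lg) => //.
  by apply/measurable_EFinP; exact: measurable_funX.
move=> x Dx /=; rewrite lee_fin !normrX lerXn2r ?nnegrE//.
exact: fg.
Qed.

Lemma sqintD f g : sqint f -> sqint g -> sqint (fun x => f x + g x).
Proof.
move=> Lf Lg; apply: sqintP.
  by apply: measurable_funD; apply: sqint_measurable.
rewrite (_ : _ \o _ = (fun x => ((f x ^+ 2)%:E + (g x ^+ 2)%:E) +
    (2%:E * (f x * g x)%:E)))%E.
  apply: integrableD => //.
    by apply: integrableD => //; exact: sqint_integrable_sqr.
  by apply: integrableZl => //; exact: sqint_mul.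
by apply/funext => x /=; rewrite -EFinM -!EFinD; congr (_%:E); ring.
Qed.

Lemma sqintZ c f : sqint f -> sqint (fun x => c * f x).
Proof.
move=> Lf; apply: sqintP.
  by apply: measurable_funM => //; apply: sqint_measurable.
rewrite (_ : _ \o _ = (fun x => (c ^+ 2)%:E * (f x ^+ 2)%:E))%E.
  by apply: integrableZl => //; exact: sqint_integrable_sqr.
by apply/funext => x /=; rewrite -EFinM exprMn.
Qed.

Lemma sqintN f : sqint f -> sqint (fun x => - f x).
Proof. by move=> /(sqintZ (-1)); under eq_fun do rewrite mulN1r. Qed.

Lemma sqintB f g : sqint f -> sqint g -> sqint (fun x => f x - g x).
Proof. by move=> Lf /sqintN; exact: sqintD. Qed.

Lemma ipC f g : ip f g = ip g f.
Proof. by apply: eq_Rintegral => x _; rewrite mulrC. Qed.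

Lemma ipDl f g h : sqint f -> sqint g -> sqint h ->
  ip (fun x => f x + g x) h = ip f h + ip g h.
Proof.
move=> Lf Lg Lh; rewrite /ip -RintegralD//; [|exact: sqint_mul..].
by apply: eq_Rintegral => x _; rewrite mulrDl.
Qed.

Lemma ipZl c f h : sqint f -> sqint h ->
  ip (fun x => c * f x) h = c * ip f h.
Proof.
move=> Lf Lh; rewrite /ip -RintegralZl//; last exact: sqint_mul.
by apply: eq_Rintegral => x _; rewrite mulrA.
Qed.

Lemma ip_ge0 f : 0 <= ip f f.
Proof. by apply: Rintegral_ge0 => x _; rewrite -expr2 sqr_ge0. Qed.

Lemma ip_CS f g : sqint f -> sqint g -> ip f g ^+ 2 <= ip f f * ip g g.
Proof.
move=> Lf Lg; apply: discriminant_le => t.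
have Ltg := sqintZ t Lg; have Lfg := sqintD Lf Ltg.
have := ip_ge0 (fun x => f x + t * g x).
rewrite ipDl// ipZl// (ipC f) (ipC g) !ipDl// !ipZl// (ipC g f).
lra.
Qed.

Lemma EFin_ip f : sqint f ->
  (ip f f)%:E = (\int[mu]_(x in D) ((f x) ^+ 2)%:E)%E.
Proof.
by move=> Lf; rewrite /ip /Rintegral fineK; [|exact/integrable_fin_num/sqint_mul].
Qed.

Lemma ip_ae_eq f f' g g' : sqint f -> sqint f' -> sqint g -> sqint g' ->
  (f = f' %[ae mu in D]) -> (g = g' %[ae mu in D]) -> ip f g = ip f' g'.
Proof.
move=> Lf Lf' Lg Lg' ff' gg'; congr fine; apply: ae_eq_integral => //.
- by have /integrableP[] := sqint_mul Lf Lg.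
- by have /integrableP[] := sqint_mul Lf' Lg'.
by near=> x => Dx; rewrite (near ff' x)// (near gg' x).
Unshelve. all: by end_near. Qed.

(** Expanding [2^n (|d| - 2^-n)^2 >= 0] gives [2 |d| <= 2^n d^2 + 2^-n], so the increments are
    absolutely summable. *)
Let summable_increments_cvg (u : R^nat) :
  (\sum_(n <oo) (2 ^+ n * (u n.+1 - u n) ^+ 2)%:E < +oo)%E -> cvgn u.
Proof.
set w := fun n => 2 ^+ n * (u n.+1 - u n) ^+ 2 => wfin.
have w0 n : 0 <= w n by rewrite /w mulr_ge0 ?sqr_ge0// exprn_ge0.
have cw : cvgn (series w).
  apply: nondecreasing_is_cvgn; first by apply: nondecreasing_series => n _ _.
  exists (fine (\sum_(n <oo) (w n)%:E)%E) => _ [n _ <-].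
  rewrite -lee_fin fineK; last by rewrite ge0_fin_numE ?nneseries_ge0// => k _ _; rewrite lee_fin.
  rewrite /series /= -sumEFin.
  by apply: nneseries_lim_ge => k _ _; rewrite lee_fin.
have cg : cvgn (series (geometric 1 (2^-1 : R))).
  by apply: is_cvg_geometric_series; rewrite ger0_norm; lra.
have cd : cvgn [normed series (fun n => u n.+1 - u n)].
  apply: (@series_le_cvg _ _ (fun n => w n + geometric 1 2^-1 n)) => //.
  - by move=> n /=; rewrite normr_ge0.
  - by move=> n; rewrite addr_ge0//= mul1r exprn_ge0.
  - move=> n; rewrite /w /= mul1r.
    have p2 : (0 : R) < 2 ^+ n by rewrite exprn_gt0.
    rewrite -(real_normK (num_real (u n.+1 - u n))); set a := `|_|.
    have a0 : 0 <= a by exact: normr_ge0.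
    rewrite exprVn; have : 0 <= 2 ^+ n * (a - (2 ^+ n)^-1) ^+ 2.
      by rewrite mulr_ge0 ?sqr_ge0 ?ltW.
    have -> : 2 ^+ n * (a - (2 ^+ n)^-1) ^+ 2 =
      2 ^+ n * a ^+ 2 - 2 * a + (2 ^+ n)^-1 by field; rewrite gt_eqF.
    lra.
  - rewrite (_ : (fun n => _) = w + geometric 1 2^-1)//.
    by rewrite seriesD; exact: is_cvgD.
have /normed_cvg cs := cd.
have -> : u = series (fun n => u n.+1 - u n) + cst (u 0).
  apply/funext => n; rewrite fctE /series /= telescope_sumr// subrK//.
by apply: is_cvgD => //; exact: is_cvg_cst.
Qed.

(* Along a geometrically Cauchy sequence the series of the functions
   [2^n (u_(n+1) - u_n)^2] is integrable, hence finite almost everywhere, which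
   forces pointwise convergence; Fatou's lemma then gives the norm bound. *)
Lemma riesz_fischer (u : nat -> T -> R) (c : R) :
  (forall n, sqint (u n)) ->
  (forall n k, (n <= k)%N ->
    ip (fun x => u n x - u k x) (fun x => u n x - u k x) <= c / 4 ^+ n) ->
  exists2 v, sqint v & forall n,
    ip (fun x => u n x - v x) (fun x => u n x - v x) <= c / 4 ^+ n.
Proof.
move=> Lu cu.
pose w n x := 2 ^+ n * (u n.+1 x - u n x) ^+ 2.
have w0 n x : 0 <= w n x by rewrite /w mulr_ge0 ?sqr_ge0// exprn_ge0.
have mu_ n : measurable_fun D (u n) by exact: sqint_measurable.
have mw n : measurable_fun D (EFin \o w n).
  apply/measurable_EFinP; apply: measurable_funM => //.
  by apply: measurable_funX; exact: measurable_funB.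
pose S x := (\sum_(n <oo) (w n x)%:E)%E.
have mS : measurable_fun D S.
  by apply: ge0_emeasurable_sum => [*|*]; [rewrite lee_fin|exact: mw].
have S0 x : (0 <= S x)%E by apply: nneseries_ge0 => n _ _; rewrite lee_fin.
have Sfin : (\int[mu]_(x in D) S x < +oo)%E.
  rewrite integral_nneseries//; last by move=> n x Dx; rewrite lee_fin.
  (* The n-th term is at most [2^n c / 4^n = c / 2^n], written as [2 c / 2^(n+1)] to match the
     halving series. *)
  apply: (@le_lt_trans _ _ (\sum_(n <oo) ((2 * c) / (2 ^ (n + 1))%:R)%:E)%E).
    apply: lee_nneseries => [n _ _|n _].
      by apply: integral_ge0 => x _; rewrite lee_fin.
    have Ld : sqint (fun x => u n x - u n.+1 x) by exact: sqintB.
    have -> : (\int[mu]_(x in D) (w n x)%:E =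
        (2 ^+ n)%:E * (ip (fun x => u n x - u n.+1 x) (fun x => u n x - u n.+1 x))%:E)%E.
      rewrite EFin_ip// -ge0_integralZl//.
      - by apply: eq_integral => x _; rewrite /w -EFinM; congr (_%:E); ring.
      - by apply/measurable_EFinP/measurable_funX/sqint_measurable.
      - by move=> x _; rewrite lee_fin sqr_ge0.
    rewrite -EFinM lee_fin.
    apply: (@le_trans _ _ (2 ^+ n * (c / 4 ^+ n))).
      by rewrite ler_wpM2l ?exprn_ge0// cu.
    rewrite natrX addn1 exprS (_ : 4 = 2 * 2) ?exprMn; last by ring.
    rewrite le_eqVlt; apply/orP; left; apply/eqP; field.
    by rewrite expf_neq0.
  have /cvg_lim -> // := @cvg_geometric_eseries_half R (2 * c) 0.
  by rewrite ltry.
pose E := D `&` [set x | S x < +oo]%E.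
have mE : measurable E by exact: emeasurable_fun_lt.
have aeE : {ae mu, forall x, D x -> E x}.
  have iS : mu.-integrable D S.
    by apply/integrableP; split=> //; under eq_integral do rewrite gee0_abs//.
  apply: filterS (integrable_ae mD iS) => x + Dx => /(_ Dx) Sx; split=> //=.
  by rewrite -ge0_fin_numE.
(* Cutting off outside [E] makes the sequence converge at every point of [D], which gives the
   measurability of the limit; almost everywhere nothing changes. *)
pose h n x := u n x * \1_E x.
have ch x : D x -> cvgn (h ^~ x).
  move=> Dx; rewrite /h indicE; have [xE|xE] := boolP (x \in E); last first.
    by under eq_fun do rewrite mulr0; exact: is_cvg_cst.
  under eq_fun do rewrite mulr1.
  by apply: summable_increments_cvg; move: xE; rewrite inE => -[].
have mh n : measurable_fun D (h n).
  by apply: measurable_funM => //; exact: measurable_indic.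
pose v x := limn (h ^~ x).
have mv : measurable_fun D v by apply: measurable_fun_cvg mh _ => x Dx; exact: ch.
have hu n : h n = u n %[ae mu in D].
  apply: filterS aeE => x Ex Dx; have := Ex Dx => {}Ex.
  by rewrite /h indicE mem_set// mulr1.
have bound n : (\int[mu]_(x in D) ((h n x - v x) ^+ 2)%:E <= (c / 4 ^+ n)%:E)%E.
  have Lh k : sqint (h k).
    apply: sqint_dominated (Lu k) _ => // x _.
    by rewrite /h indicE; case: (_ \in _); rewrite ?mulr1// mulr0 normr0.
  (* The shift by [n] keeps the second index at least [n], so that the Cauchy bound applies for
     every [k]. *)
  pose F k x := ((h n x - h (k + n)%N x) ^+ 2)%:E.
  have -> : (\int[mu]_(x in D) ((h n x - v x) ^+ 2)%:E =
      \int[mu]_(x in D) limn_einf (F ^~ x))%E.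
    apply: eq_integral => x /[!inE] Dx; symmetry; apply: (@cvg_limn_einf_sup _ _ _ _).1.
    apply: cvg_EFin; first exact: nearW.
    rewrite [X in X @ _ --> _](_ : _ =
      (fun k => (h n x - h k x) * (h n x - h k x)) \o (addn^~ n)); last first.
      by apply/funext => k.
    by apply: cvg_comp; [exact: cvg_addnr|rewrite expr2; apply: cvgM; apply: cvgB;
      [exact: cvg_cst|exact: ch|exact: cvg_cst|exact: ch]].
  apply: le_trans (fatou mu mD _ _) _.
  - move=> k; apply/measurable_EFinP/measurable_funX; exact: measurable_funB.
  - by move=> k x _; rewrite lee_fin sqr_ge0.
  have Fk k : (\int[mu]_(x in D) F k x <= (c / 4 ^+ n)%:E)%E.
    rewrite -EFin_ip; last exact: sqintB.
    rewrite lee_fin (@ip_ae_eq _ (fun x => u n x - u (k + n)%N x) _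
      (fun x => u n x - u (k + n)%N x)) ?cu ?leq_addl//.
    - exact: sqintB.
    - exact: sqintB.
    - exact: sqintB.
    - exact: sqintB.
    - by apply: filterS2 (hu n) (hu (k + n)%N) => x + + Dx => -> // -> //.
    - by apply: filterS2 (hu n) (hu (k + n)%N) => x + + Dx => -> // -> //.
  rewrite limn_einf_lim; apply: lime_le; first exact: is_cvg_einfs.
  apply: nearW => k; apply: (le_trans _ (Fk k)).
  by apply: ereal_inf_lbound; exists k => /=.
have Lh n : sqint (h n).
  apply: sqint_dominated (Lu n) _ => // x _.
  by rewrite /h indicE; case: (_ \in _); rewrite ?mulr1// mulr0 normr0.
have Lhv n : sqint (fun x => h n x - v x).
  split; first exact: measurable_funB.
  by apply: le_lt_trans (bound n) _; rewrite ltry.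
have Lv : sqint v.
  rewrite (_ : v = (fun x => h 0 x - (h 0 x - v x))); first exact: sqintB.
  by apply/funext => x; ring.
exists v => // n; rewrite -lee_fin.
have -> : ip (fun x => u n x - v x) (fun x => u n x - v x) =
    ip (fun x => h n x - v x) (fun x => h n x - v x).
  have Luv : sqint (fun x => u n x - v x) by exact: sqintB.
  by apply: ip_ae_eq => //;
    apply: filterS (hu n) => x + Dx => -> //.
by rewrite EFin_ip.
Qed.

End square_integrable.

(** * Minimization of a quadratic functional, without completeness *)

Section minimization.
Context (T : Type) (R : realType).
Variables (P : (T -> R) -> Prop) (B : (T -> R) -> (T -> R) -> R) (l : (T -> R) -> R).
Hypothesis P0 : P (fun=> 0).
Hypothesis PD : forall c u v, P u -> P v -> P (fun x => u x + c * v x).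
Hypothesis BD : forall c u v w, P u -> P v -> P w ->
  B (fun x => u x + c * v x) w = B u w + c * B v w.
Hypothesis BC : forall u v, B u v = B v u.
Hypothesis B_ge0 : forall u, P u -> 0 <= B u u.
Hypothesis lD : forall c u v, P u -> P v ->
  l (fun x => u x + c * v x) = l u + c * l v.
Variable C : R.
Hypothesis lB : forall u, P u -> l u ^+ 2 <= C * B u u.

Let J u := B u u - 2 * l u.

Let BDD c u v : P u -> P v ->
  B (fun x => u x + c * v x) (fun x => u x + c * v x) =
  B u u + 2 * c * B u v + c ^+ 2 * B v v.
Proof.
move=> Pu Pv; have Puv := PD c Pu Pv.
by rewrite BD// (BC u) (BC v) !BD// (BC v u); ring.
Qed.

(* A minimizing sequence of [B u u - 2 l u] is Cauchy by the parallelogram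
   identity and satisfies the Euler-Lagrange equation in the limit. *)
Lemma riesz_sequence : exists phi : nat -> T -> R, [/\ forall n, P (phi n),
  forall n k, (n <= k)%N ->
    B (fun x => phi n x - phi k x) (fun x => phi n x - phi k x) <= 4 / 4 ^+ n &
  forall n psi, P psi -> (B (phi n) psi - l psi) ^+ 2 <= B psi psi / 4 ^+ n].
Proof.
(* With [b = B u u], [b - 2 l u >= b - 2 sqrt(|C| b) >= - |C|]. The absolute value is there because
   the sign of [C] is unknown. *)
have Jlb u : P u -> - `|C| <= J u.
  move=> Pu; rewrite /J.
  have h : l u ^+ 2 <= `|C| * B u u.
    by apply: le_trans (lB Pu) _; rewrite ler_wpM2r ?B_ge0// ler_norm.
  have b0 := B_ge0 Pu; have c0 := normr_ge0 C.
  move: (B u u) (l u) `|C| h b0 c0 => b z c h b0 c0.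
  have [//|lt] := leP (- c) (b - 2 * z).
  have z0 : 0 <= b + c < 2 * z by apply/andP; split; lra.
  have : (b + c) ^+ 2 < (2 * z) ^+ 2 by rewrite ltrXn2r ?nnegrE//; lra.
  by have := sqr_ge0 (b - c); nra.
pose S := [set J u | u in P].
have hS : has_inf S.
  split; first by exists (J (fun=> 0)); exists (fun=> 0).
  by exists (- `|C|) => _ [u Pu <-]; exact: Jlb.
pose m := inf S.
have mle u : P u -> m <= J u.
  by move=> Pu; apply: ge_inf; [case: hS|exists u].
have p4 n : (0 : R) < 4 ^+ n by rewrite exprn_gt0.
have /choice[phi Pphi] : forall n, exists u, P u /\ J u < m + (4 ^+ n)^-1.
  move=> n; have : m < m + (4 ^+ n)^-1 by rewrite ltrDl invr_gt0.
  by move=> /(inf_lt hS.1)[_ [u Pu <-] uJ]; exists u.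
have Pp n : P (phi n) by case: (Pphi n).
have Jp n : J (phi n) < m + (4 ^+ n)^-1 by case: (Pphi n).
exists phi; split=> //.
  move=> n k nk.
  have Pm := PD 1 (Pp n) (Pp k).
  (* The midpoint of [phi n] and [phi k], produced with the only operation [u + c v] under which [P]
     is closed. Parallelogram identity: [B] of the difference is [2 J (phi n) + 2 J (phi k) - 4 J]
     of the midpoint, at most [2 / 4^n + 2 / 4^k]. *)
  have /mle := PD (- 2^-1) Pm Pm.
  have -> : (fun x => (phi n x + 1 * phi k x) + - 2^-1 * (phi n x + 1 * phi k x)) =
     (fun x => 0 + 2^-1 * (phi n x + 1 * phi k x)) by apply/funext => x; lra.
  rewrite /J BDD// lD//.
  have -> : l (fun=> 0) = 0.
    by have := lD 1 P0 P0; under eq_fun do rewrite mulr0 addr0; lra.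
  have B0 w : P w -> B (fun=> 0) w = 0.
    by move=> Pw; have := BD 1 P0 P0 Pw; under eq_fun do rewrite mulr0 addr0; lra.
  rewrite !B0// BDD// lD// => h.
  have -> : (fun x => phi n x - phi k x) = (fun x => phi n x + (-1) * phi k x).
    by apply/funext => x; rewrite mulN1r.
  rewrite BDD//.
  have := Jp n; have := Jp k; rewrite /J.
  have e : (4 ^+ k)^-1 <= (4 ^+ n : R)^-1.
    by rewrite lef_pV2 ?posrE// ler_weXn2l//; lra.
  lra.
move=> n psi Ppsi.
(* Near-minimality, [m <= J (phi n + t psi)] with [J (phi n) < m + 4^-n], says that a quadratic
   polynomial in t with constant term [4^-n] is nonnegative; its discriminant is the claim. *)
rewrite mulrC; apply: discriminant_le => t.
have := mle _ (PD t (Pp n) Ppsi); rewrite /J BDD// lD//.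
by have := Jp n; rewrite /J; lra.
Qed.

End minimization.

(** * Topology and measurability of row vectors *)

Section rV_topology.
Context {R : realType} {n : nat}.
Implicit Types (x y q : 'rV[R]_n) (U : set 'rV[R]_n).

(** The norm of row vectors is the maximum norm, so balls are open cubes; this ties the topology to
    the product structure of the measure. *)
Lemma ball_rVP q (r : R) x : 0 < r ->
  ball q r x <-> forall i, `|q ord0 i - x ord0 i| < r.
Proof.
move=> r0; split=> [[_ h] i|h]; first exact: h.
by split=> // i j; rewrite ord1; exact: h.
Qed.

Lemma measurable_ball_rV q (r : R) : 0 < r -> measurable (ball q r).
Proof.
move=> r0.
rewrite (_ : ball q r = \bigcap_(i in [set: 'I_n]) (rV_coord i @^-1` (ball (q ord0 i) r))).
  apply: fin_bigcap_measurable; first exact: finite_finset.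
  move=> i _; rewrite -[X in measurable X]setTI.
  by apply: measurable_rV_coord => //; exact: measurable_ball.
by apply/seteqP; split=> x; [move/(ball_rVP _ _ r0) => h i _; exact: h|
  move=> h; apply/ball_rVP => // i; exact: h].
Qed.

Definition rat_center (p : 'rV[rat]_n * nat) : 'rV[R]_n := map_mx ratr p.1.
Definition rat_radius (p : 'rV[rat]_n * nat) : R := p.2.+1%:R^-1.

Lemma rat_radius_gt0 p : 0 < rat_radius p.
Proof. by rewrite invr_gt0. Qed.

(** The doubled radius leaves room around the small cube: in the fundamental lemma, closed boxes
    with corners in its closure must still lie in the open set. *)
Lemma open_rat_ball U x : open U -> U x -> exists p,
  ball (rat_center p) (rat_radius p) x /\
  ball (rat_center p) (2 * rat_radius p) `<=` U.
Proof.
rewrite openE => oU /oU /nbhs_ballP[e /= e0 xeU].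
(* A radius below [e / 3]: a point of the doubled ball is within [2 r] of the center, which is
   within [r] of [x]. *)
have e3 : 0 < e / 3 by rewrite divr_gt0.
have [k ke] := ltr_add_invr e3; rewrite add0r in ke.
have k0 : (0 : R) < k.+1%:R^-1 by rewrite invr_gt0.
have /choice[q hq] : forall i, exists r : rat, `|ratr r - x ord0 i| < k.+1%:R^-1.
  move=> i; have [|r] := @rat_in_itvoo R (x ord0 i) (x ord0 i + k.+1%:R^-1).
    by rewrite ltrDl.
  rewrite in_itv/= => /andP[r1 r2]; exists r.
  move: (ratr r) (k.+1%:R^-1) k0 r1 r2 => s d k0 r1 r2.
  by rewrite ltr_norml; apply/andP; split; lra.
exists (\row_i q i, k); split.
  by apply/ball_rVP => // i; rewrite !mxE.
have k2 : 0 < 2 * k.+1%:R^-1 :> R by rewrite mulr_gt0.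
move=> y /(ball_rVP _ _ k2) hy.
apply: xeU; apply/ball_rVP => // i.
have := hy i; have := hq i; rewrite /rat_radius !mxE/= !ltr_distlC.
move: (ratr _) (x _ _) (y _ _) (k.+1%:R^-1) ke => a b c d ke /andP[? ?] /andP[? ?].
by apply/andP; split; lra.
Qed.

(** The sigma-algebra is the one generated by the coordinates, so an open set has to be exhibited as
    a countable union of cubes with rational data. *)
Lemma open_measurable_rV U : open U -> measurable U.
Proof.
move=> oU.
pose F p := if `[< ball (rat_center p) (2 * rat_radius p) `<=` U >]
  then ball (rat_center p) (rat_radius p) else set0.
rewrite (_ : U = \bigcup_p F p).
  apply: countable_bigcupT_measurable; first exact: countableP.
  move=> p; rewrite /F; case: ifP => // _.
  by apply: measurable_ball_rV; exact: rat_radius_gt0.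
apply/seteqP; split=> [x Ux|x [p _]].
  have [p [px pU]] := open_rat_ball oU Ux.
  by exists p => //; rewrite /F ifT//; exact/asboolP.
rewrite /F; case: ifPn => // /asboolP pU px; apply: pU.
apply: le_ball px; have := rat_radius_gt0 p; lra.
Qed.

Lemma continuous_measurable_rV (f : 'rV[R]_n -> R) :
  continuous f -> measurable_fun setT f.
Proof.
move=> cf; apply: (measurability _ (RGenOInfty.measurableE R)).
move=> _ [_ [a ->] <-]; rewrite setTI; apply: open_measurable_rV.
by move/continuousP : cf; apply; exact: interval_open.
Qed.

Definition box (M : R) : set 'rV[R]_n := [set x | forall i, `|x ord0 i| <= M].

Lemma box_itvE M : box M = [set x | forall i, `[- M, M]%classic (x ord0 i)].
Proof.
by apply/seteqP; split=> x h i; have := h i; rewrite /= in_itv/= ler_norml.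
Qed.

Lemma compact_box M : compact (box M).
Proof.
rewrite box_itvE; apply: (@rV_compact _ _ (fun=> `[- M, M]%classic)) => _.
exact: segment_compact.
Qed.

Lemma measurable_box M : measurable (box M).
Proof.
rewrite (_ : box M = \bigcap_(i in [set: 'I_n]) (rV_coord i @^-1` `[- M, M]%classic)).
  apply: fin_bigcap_measurable; first exact: finite_finset.
  move=> i _; rewrite -[X in measurable X]setTI.
  by apply: measurable_rV_coord => //; exact: measurable_itv.
by rewrite box_itvE; apply/seteqP; split=> x h i => [_|]; exact: h.
Qed.

Lemma lebesgue_box_fin M : (lebesgue_rV n (box M) < +oo)%E.
Proof.
rewrite box_itvE (lebesgue_rV_box (A := fun=> `[- M, M]%classic))//.
suff /andP[] : (0 <= \prod_(i < n) lebesgue_measure `[(- M)%R, M]%classic < +oo)%E by [].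
apply: (big_ind (fun z : \bar R => 0 <= z < +oo)%E).
- by apply/andP; split => //; rewrite ltry.
- move=> y z /andP[y0 yoo] /andP[z0 zoo]; rewrite mule_ge0//=.
  by rewrite lte_mul_pinfty// ge0_fin_numE.
- move=> i _; rewrite measure_ge0/= lebesgue_measure_itv/=.
  by case: ifP => // _; rewrite -EFinB ltry.
Qed.

Lemma bounded_set_box U : bounded_set U -> exists2 M, 0 < M & U `<=` box M.
Proof.
move=> [M [Mr hM]]; exists (`|M| + 1); first by rewrite ltr_wpDl.
move=> x Ux i.
have : `|x| <= `|M| + 1.
  apply: hM Ux; apply: (@le_lt_trans _ _ `|M|); first exact: ler_norm.
  by rewrite ltrDl.
apply: le_trans; rewrite /Num.norm/= mx_normrE.
exact: (le_bigmax _ (fun ij : 'I_1 * 'I_n => `|x ij.1 ij.2|) (ord0, i)).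
Qed.

End rV_topology.

(** * Calculus along a line *)

Section positive_part_power.
Context {R : realType}.
Implicit Types (a y : R).

(** The one-sided power [y_+^a]. As [|y|^a] is [pospow a y + pospow a (- y)], its differentiability
    at 0 for [a > 1] reduces to a one-sided function. At nonpositive [y] the value is 0 only for
    [a != 0], since [powR 0 0 = 1]. *)
Definition pospow a y : R := Num.max y 0 `^ a.

Lemma pospow_pos a y : 0 < y -> pospow a y = y `^ a.
Proof. by move=> y0; rewrite /pospow max_l// ltW. Qed.

Lemma pospow_npos a y : 0 < a -> y <= 0 -> pospow a y = 0.
Proof. by move=> a0 y0; rewrite /pospow max_r// powR0// gt_eqF. Qed.

Lemma pospow_ge0 a y : 0 <= pospow a y.
Proof. exact: powR_ge0. Qed.

Let near_pospow_pos a y : 0 < y -> \near y, y `^ a = pospow a y.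
Proof. by move=> y0; near=> z; rewrite pospow_pos//; near: z; exact: lt_nbhsr. Unshelve. all: by end_near. Qed.

Let near_pospow_neg a y : 0 < a -> y < 0 -> \near y, 0 = pospow a y.
Proof.
by move=> a0 y0; near=> z; rewrite pospow_npos// ltW//; near: z; exact: lt_nbhsl.
Unshelve. all: by end_near. Qed.

Let pospow_continuous0 a : 0 < a -> {for 0, continuous (pospow a)}.
Proof.
move=> a0; apply/cvgrPdist_lt => e e0; rewrite pospow_npos//.
have d0 : 0 < e `^ a^-1 by rewrite powR_gt0.
near=> z; rewrite sub0r normrN ger0_norm ?pospow_ge0//.
have [z0|z0] := leP z 0; first by rewrite pospow_npos.
rewrite pospow_pos//.
have -> : e = (e `^ a^-1) `^ a by rewrite -powRrM mulVf ?gt_eqF// powRr1// ltW.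
rewrite gt0_ltr_powR ?nnegrE ?ltW//.
apply: le_lt_trans (ler_norm _) _.
by near: z; apply: (cvgr0_norm_lt (fun x : R => x)) => //; exact: cvg_id.
Unshelve. all: by end_near. Qed.

Let is_derive_pospow_pos a y : 0 < y ->
  is_derive y 1 (pospow a) (a * pospow (a - 1) y).
Proof.
move=> y0; apply: near_eq_is_derive (near_pospow_pos a y0) _.
have yi : y \in `]0, +oo[ by rewrite in_itv/= y0.
rewrite pospow_pos// -(powR_derive1 a yi) derive1E; apply: DeriveDef => //.
exact: derivable_powR.
Qed.

Lemma pospow_continuous a : 0 < a -> continuous (pospow a).
Proof.
move=> a0 y; have [y0|y0|->] := ltgtP y 0.
- have d : is_derive y 1 (pospow a) 0 by apply: near_eq_is_derive (near_pospow_neg a0 y0) _.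
  by apply: differentiable_continuous; apply/derivable1_diffP; case: d.
- apply: differentiable_continuous; apply/derivable1_diffP.
  by case: (is_derive_pospow_pos a y0).
- exact: pospow_continuous0.
Qed.

Lemma is_derive_pospow a y : 1 < a -> is_derive y 1 (pospow a) (a * pospow (a - 1) y).
Proof.
move=> a1; have a0 : 0 < a by exact: lt_trans a1.
have a10 : 0 < a - 1 by rewrite subr_gt0.
have [y0|y0|->] := ltgtP y 0; last 1 first.
(* At 0 the difference quotient of [pospow a] is [pospow (a - 1)] itself, so its limit is a matter
   of continuity. *)
- have lim0 : (fun h : R => h^-1 *: (pospow a (h *: 1 + 0) - pospow a 0)) @ 0^' --> (0 : R).
    rewrite [X in X @ _ --> _](_ : _ = pospow (a - 1)); last first.
      apply/funext => h; rewrite (pospow_npos a0 (lexx 0)) subr0 addr0 /GRing.scale/= mulr1.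
      have [h0|h0] := leP h 0; first by rewrite !pospow_npos// mulr0.
      by rewrite !pospow_pos// -(mulr_powRB1 (ltW h0) a0) mulKf ?gt_eqF.
    have := pospow_continuous0 a10; rewrite /prop_for /continuous_at pospow_npos//.
    by apply: cvg_trans; apply: cvg_app; exact: nbhs_dnbhs.
  rewrite pospow_npos// mulr0; apply: DeriveDef; first by apply/cvg_ex; exists 0.
  by rewrite /derive; exact/cvg_lim.
- by rewrite pospow_npos ?mulr0 ?ltW//; apply: near_eq_is_derive (near_pospow_neg a0 y0) _.
- exact: is_derive_pospow_pos.
Qed.

Lemma pospowDN a y : 0 < a -> pospow a y + pospow a (- y) = `|y| `^ a.
Proof.
move=> a0; have [y0|y0] := leP 0 y.
  rewrite (pospow_npos _ (_ : - y <= 0)) ?oppr_le0// addr0 ger0_norm// /pospow max_l//.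
by rewrite pospow_npos ?ltW// add0r pospow_pos ?oppr_gt0// ltr0_norm.
Qed.

Lemma pospowBN_norm a y : 0 < a -> `|pospow a y - pospow a (- y)| = `|y| `^ a.
Proof.
move=> a0; rewrite -pospowDN//; have [y0|y0] := leP 0 y.
  by rewrite (pospow_npos _ (_ : - y <= 0)) ?oppr_le0// addr0 subr0 ger0_norm// pospow_ge0.
by rewrite (pospow_npos a0 (ltW y0)) add0r add0r normrN ger0_norm// pospow_ge0.
Qed.

Lemma norm_powR_continuous a : 0 < a -> continuous (fun y => `|y| `^ a).
Proof.
move=> a0; under eq_fun do rewrite -pospowDN//.
move=> y; apply: cvgD; first exact: pospow_continuous.
by apply: (@continuous_comp _ _ _ -%R (pospow a)); [exact: opp_continuous|exact: pospow_continuous].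
Qed.

Lemma is_derive_norm_powR a y : 1 < a -> is_derive y 1 (fun z => `|z| `^ a)
  (a * (pospow (a - 1) y - pospow (a - 1) (- y))).
Proof.
move=> a1; have a0 : 0 < a by exact: lt_trans a1.
have -> : (fun z => `|z| `^ a) = pospow a + (pospow a \o -%R).
  by apply/funext => z; rewrite -pospowDN.
have := is_derive_pospow (- y) a1 => dN.
rewrite mulrBr; apply: is_deriveD; first exact: is_derive_pospow.
rewrite -mulrN1; apply: is_derive1_comp.
Qed.

End positive_part_power.

(** * Compactly supported functions on the real line *)

Section real_line.
Context {R : realType}.
Implicit Types h : R -> R.
Let mu := @lebesgue_measure R.

Lemma FTC_line h h' a b : a < b -> (forall t : R, is_derive t 1 h (h' t)) ->
  continuous h' ->
  (\int[mu]_(t in `[a, b]) (h' t)%:E = (h b)%:E - (h a)%:E)%E.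
Proof.
move=> ab dh ch.
have c t : h @ t --> h t.
  by apply: differentiable_continuous; apply/derivable1_diffP; case: (dh t).
apply: continuous_FTC2 => //.
- by apply: continuous_subspaceT.
- split; first by move=> t _; case: (dh t).
  + exact: cvg_at_right_filter.
  + exact: cvg_at_left_filter.
- by move=> t _; rewrite derive1E; apply: derive_val.
Qed.

Section compact_support.
Variables (h h' : R -> R) (M : R).
Hypotheses (M0 : 0 < M) (dh : forall t : R, is_derive t 1 h (h' t)) (ch : continuous h').
Hypothesis hM : forall t, M <= `|t| -> h t = 0.

Lemma derive_outside t : M < `|t| -> h' t = 0.
Proof.
move=> tM; rewrite -(@derive_val _ _ _ t 1 h (h' t)).
apply: (@derive_val _ _ _ t 1 h 0).
apply: (@near_eq_is_derive _ _ _ (cst 0)); near=> s; rewrite hM// ltW//.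
near: s; have : (fun s : R => `|s|) @ t --> `|t| by exact: norm_continuous.
by move=> /cvgr_gt; exact.
Unshelve. all: by end_near. Qed.

Lemma integral_derive_eq0 : (\int[mu]_t (h' t)%:E = 0)%E.
Proof.
have -> : (\int[mu]_t (h' t)%:E = \int[mu]_(t in `[(- M)%R, M]) (h' t)%:E)%E.
  rewrite [RHS]integral_mkcond; apply: eq_integral => t _.
  rewrite patchE; case: ifPn => //; rewrite notin_setE/= in_itv/= -ler_norml => /negP.
  by rewrite -ltNge => /derive_outside ->.
rewrite (FTC_line _ dh)// ?gtrN//.
by rewrite !hM ?subee// ?normrN ler_norm.
Qed.

Lemma le_integral_derive t :
  (`|h t|%:E <= \int[mu]_(s in `[(- M)%R, M]) `|h' s|%:E)%E.
Proof.
have [tM|tM] := leP M `|t|.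
  by rewrite hM// normr0; apply: integral_ge0 => s _; rewrite lee_fin.
move: tM; rewrite ltr_norml => /andP[Mt tM].
have := FTC_line Mt dh ch; rewrite (@hM (- M)) ?normrN ?ler_norm// sube0 => E.
have mh : measurable_fun setT h' by exact: continuous_measurable_fun.
rewrite -abse_EFin -E; apply: le_trans (le_abse_integral _ _ _) _ => //.
  by apply/measurable_EFinP; exact: measurable_funTS.
apply: ge0_subset_integral => //.
  by apply/measurable_EFinP/measurableT_comp => //; exact: measurable_funTS.
by move=> s /=; rewrite !in_itv/= => /andP[-> /le_trans]; apply; exact: ltW.
Qed.

Lemma le_integralT_derive t : (`|h t|%:E <= \int[mu]_s `|h' s|%:E)%E.
Proof.
apply: le_trans (le_integral_derive t) _; apply: ge0_subset_integral => //.
by apply/measurable_EFinP/measurableT_comp => //; exact: continuous_measurable_fun.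
Qed.

End compact_support.
End real_line.

(** * Coordinate lines, slices and Fubini's theorem *)

Section coordinate_lines.
Context {R : realType}.

(** The line through [x] in direction i, parametrized by the value of the i-th coordinate and not by
    the displacement from [x]: it does not depend on [x ord0 i], and for the first coordinate it is
    a Fubini slice. *)
Definition upd n (x : 'rV[R]_n) (i : 'I_n) (t : R) : 'rV[R]_n :=
  \row_j (if j == i then t else x ord0 j).

Lemma rV_cons_split n (x : 'rV[R]_n.+1) : exists t y, x = rV_cons (t, y).
Proof. by have [[t y] ->] := rV_consP x; exists t, y. Qed.

Lemma rV_ord_ext n (x y : 'rV[R]_n.+1) : x ord0 ord0 = y ord0 ord0 ->
  (forall j, x ord0 (lift ord0 j) = y ord0 (lift ord0 j)) -> x = y.
Proof. by move=> e0 eS; apply/rowP => k; case: (unliftP ord0 k) => [j ->|->]. Qed.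

Lemma upd_cons0 n s t (y : 'rV[R]_n) : upd (rV_cons (s, y)) ord0 t = rV_cons (t, y).
Proof.
apply: rV_ord_ext => [|j]; first by rewrite mxE eqxx rV_cons0.
by rewrite mxE !rV_consS.
Qed.

Lemma upd_consS n s t (y : 'rV[R]_n) j :
  upd (rV_cons (s, y)) (lift ord0 j) t = rV_cons (s, upd y j t).
Proof.
apply: rV_ord_ext => [|k]; first by rewrite mxE !rV_cons0.
by rewrite mxE !rV_consS mxE (inj_eq lift_inj).
Qed.

Lemma upd_id n (x : 'rV[R]_n) i : upd x i (x ord0 i) = x.
Proof. by apply/rowP => j; rewrite mxE; case: eqP => // ->. Qed.

Lemma continuous_to_rV (T : topologicalType) n (g : T -> 'rV[R]_n) :
  (forall i, continuous (fun t => g t ord0 i)) -> continuous g.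
Proof.
move=> cg t A [P hP PA].
have : \forall s \near t, forall i, P ord0 i (g s ord0 i).
  by apply: filter_forall => i; apply: cg; exact: hP.
by apply: filterS => s hs; apply: PA => i j; rewrite ord1; exact: hs.
Qed.

Lemma continuous_upd n (x : 'rV[R]_n) i : continuous (upd x i).
Proof.
apply: continuous_to_rV => j; under eq_fun do rewrite mxE.
by case: eqP => _ t; [exact: cvg_id|exact: cvg_cst].
Qed.

Lemma continuous_rV_cons n (s : R) : continuous (fun y : 'rV[R]_n => rV_cons (s, y)).
Proof.
apply: continuous_to_rV => k; case: (unliftP ord0 k) => [j ->|->].
  by under eq_fun do rewrite rV_consS; exact: coord_continuous.
by under eq_fun do rewrite rV_cons0; exact: cst_continuous.
Qed.

Lemma shift_upd n (x : 'rV[R]_n) i (h t : R) :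
  h *: delta_mx ord0 i + upd x i t = upd x i (h + t).
Proof.
apply/rowP => j; rewrite !mxE eqxx/=; case: eqP => _; first by rewrite mulr1.
by rewrite mulr0 add0r.
Qed.

Lemma is_derive_line n (f : 'rV[R]_n -> R) i :
  (forall x, derivable f x (delta_mx ord0 i)) ->
  forall x (t : R), is_derive t 1 (fun s => f (upd x i s)) (partial i f (upd x i t)).
Proof.
move=> df x t.
have e : (fun h : R => h^-1 *: (f (upd x i (h *: 1 + t)) - f (upd x i t))) =
    (fun h => h^-1 *: (f (h *: delta_mx ord0 i + upd x i t) - f (upd x i t))).
  by apply/funext => h; rewrite shift_upd /GRing.scale/= mulr1.
apply: DeriveDef; first by rewrite /derivable e; exact: df.
by rewrite /partial /derive e.
Qed.

Definition supported n (M : R) (f : 'rV[R]_n -> R) :=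
  forall x, f x != 0 -> box M x.

Lemma supported_cons n M s (f : 'rV[R]_n.+1 -> R) : supported M f ->
  supported M (fun y => f (rV_cons (s, y))).
Proof. by move=> hf y /hf h i; rewrite -(rV_consS (s, y)); exact: h. Qed.

Lemma supported_upd n M (f : 'rV[R]_n -> R) : supported M f ->
  forall x i t, M < `|t| -> f (upd x i t) = 0.
Proof.
move=> hf x i t Mt; apply/eqP/negPn/negP => /hf/(_ i).
by rewrite mxE eqxx leNgt Mt.
Qed.

Lemma continuous_comp_rV n (T : topologicalType) (f : 'rV[R]_n -> R) (g : T -> 'rV[R]_n) :
  continuous f -> continuous g -> continuous (fun t => f (g t)).
Proof. by move=> cf cg t; apply: continuous_comp; [exact: cg|exact: cf]. Qed.

Lemma supported_bounded n M (f : 'rV[R]_n -> R) : continuous f -> supported M f ->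
  exists2 K, 0 <= K & forall x, `|f x| <= K.
Proof.
move=> cf sf.
have /compact_bounded[K [Kr hK]] : compact (f @` box M).
  by apply: continuous_compact; [exact: continuous_subspaceT|exact: compact_box].
exists (`|K| + 1); first by rewrite addr_ge0.
move=> x; have [->|fx0] := eqVneq (f x) 0; first by rewrite normr0 addr_ge0.
apply: (hK (`|K| + 1)); first by rewrite (le_lt_trans (ler_norm _))// ltrDl.
by exists x => //; exact: sf.
Qed.

Lemma supported_integrable n M (f : 'rV[R]_n -> R) : continuous f -> supported M f ->
  (lebesgue_rV n).-integrable setT (EFin \o f).
Proof.
move=> cf sf; have [K K0 fK] := supported_bounded cf sf.
have mf : measurable_fun setT f by exact: continuous_measurable_rV.
have -> : EFin \o f = (EFin \o f) \_ (box M).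
  apply/funext => x; rewrite patchE; case: ifPn => //; rewrite notin_setE => xM /=.
  by congr EFin; apply/eqP/negPn/negP => /sf.
apply/(integrable_mkcond _ (measurable_box M)).
apply: measurable_bounded_integrable; [exact: measurable_box|exact: lebesgue_box_fin|
  exact: measurable_funTS|].
exists K; split; first exact: num_real.
by move=> r Kr x _ /=; apply: le_trans (fK x) (ltW Kr).
Qed.

Lemma tonelli_rV n (F : 'rV[R]_n.+1 -> \bar R) : measurable_fun setT F ->
  (forall x, 0 <= F x)%E ->
  (\int[lebesgue_rV n.+1]_x F x =
   \int[lebesgue_measure]_t \int[lebesgue_rV n]_y F (rV_cons (t, y)))%E.
Proof.
move=> mF F0.
have -> : (\int[lebesgue_rV n.+1]_x F x =
    \int[lebesgue_measure \x lebesgue_rV n]_p F (rV_cons p))%E.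
  by apply: (@ge0_integral_pushforward _ _ _ _ _ (@rV_cons R n)).
rewrite (fubini_tonelli1 (fun p => F (rV_cons p)))//.
by apply: measurableT_comp => //; exact: measurable_rV_cons.
Qed.

Lemma tonelli_rV' n (F : 'rV[R]_n.+1 -> \bar R) : measurable_fun setT F ->
  (forall x, 0 <= F x)%E ->
  (\int[lebesgue_rV n.+1]_x F x =
   \int[lebesgue_rV n]_y \int[lebesgue_measure]_t F (rV_cons (t, y)))%E.
Proof.
move=> mF F0; rewrite tonelli_rV//.
apply: (fubini_tonelli (fun p => F (rV_cons p))) => //.
by apply: measurableT_comp => //; exact: measurable_rV_cons.
Qed.

Lemma integrable_rV_cons n (F : 'rV[R]_n.+1 -> \bar R) :
  (lebesgue_rV n.+1).-integrable setT F ->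
  (lebesgue_measure \x lebesgue_rV n)%E.-integrable setT (F \o @rV_cons R n).
Proof.
move=> /integrableP[mF iF]; apply/integrableP; split.
  by apply: measurableT_comp => //; exact: measurable_rV_cons.
apply: le_lt_trans iF; rewrite le_eqVlt; apply/orP; left; apply/eqP; symmetry.
by apply: (@ge0_integral_pushforward _ _ _ _ _ (@rV_cons R n)) => //; exact: measurableT_comp.
Qed.

Lemma fubini_rV n (F : 'rV[R]_n.+1 -> \bar R) :
  (lebesgue_rV n.+1).-integrable setT F ->
  (\int[lebesgue_rV n.+1]_x F x =
   \int[lebesgue_measure]_t \int[lebesgue_rV n]_y F (rV_cons (t, y)))%E.
Proof.
move=> iF; rewrite (integral12_prod_meas1 (integrable_rV_cons iF)).
apply: (@integral_pushforward _ _ _ _ _ (@rV_cons R n)) => //.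
- by case/integrableP : iF.
- by rewrite preimage_setT; exact: integrable_rV_cons.
Qed.

Lemma fubini_rV' n (F : 'rV[R]_n.+1 -> \bar R) :
  (lebesgue_rV n.+1).-integrable setT F ->
  (\int[lebesgue_rV n.+1]_x F x =
   \int[lebesgue_rV n]_y \int[lebesgue_measure]_t F (rV_cons (t, y)))%E.
Proof.
move=> iF; rewrite fubini_rV//; exact: (Fubini (integrable_rV_cons iF)).
Qed.

(** Fubini's theorem is available for the first coordinate only. If i is the first one, integrate
    along it first; otherwise freeze the first coordinate and use induction on the slice. *)
Lemma integral_lines_eq0 n (i : 'I_n) M (f : 'rV[R]_n -> R) :
  continuous f -> supported M f ->
  (forall x, \int[lebesgue_measure]_t (f (upd x i t))%:E = 0)%E ->
  (\int[lebesgue_rV n]_x (f x)%:E = 0)%E.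
Proof.
elim: n i f => [[]//|n IH] i f cf sf f0.
have if_ := supported_integrable cf sf.
case: (unliftP ord0 i) f0 => [j ->|->] f0.
  rewrite (fubini_rV if_) integral0_eq// => t _.
  apply: (IH j).
  - by apply: continuous_comp_rV; [exact: cf|exact: continuous_rV_cons].
  - exact: supported_cons.
  - by move=> y; have := f0 (rV_cons (t, y)); under eq_integral do rewrite upd_consS.
rewrite (fubini_rV' if_) integral0_eq// => y _.
by have := f0 (rV_cons (0, y)); under eq_integral do rewrite upd_cons0.
Qed.

End coordinate_lines.

(** * Gagliardo-Nirenberg, Poincare and Sobolev inequalities *)

Section gagliardo_nirenberg.
Context {R : realType}.

Lemma line_integrable n M (f : 'rV[R]_n -> R) x i : continuous f -> supported M f ->
  (@lebesgue_measure R).-integrable setT (fun t => (f (upd x i t))%:E).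
Proof.
move=> cf sf; have [K K0 fK] := supported_bounded cf sf.
have cu : continuous (fun t : R => f (upd x i t)).
  by apply: continuous_comp_rV; [exact: cf|exact: continuous_upd].
have mf : measurable_fun setT (fun t : R => f (upd x i t)) by exact: continuous_measurable_fun.
have -> : (fun t => (f (upd x i t))%:E) =
    (fun t => (f (upd x i t))%:E) \_ `[(- M), M]%classic.
  apply/funext => t; rewrite patchE; case: ifPn => //; rewrite notin_setE/= in_itv/=.
  by rewrite -ler_norml => /negP; rewrite -ltNge => /(supported_upd sf) ->.
have mI : measurable (`[(- M), M]%classic : set (measurableTypeR R)) by exact: measurable_itv.
apply/(integrable_mkcond _ mI).
pose F (t : measurableTypeR R) := f (upd x i t).
suff : (@lebesgue_measure R).-integrable `[(- M), M]%classic (EFin \o F) by [].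
apply: measurable_bounded_integrable => //.
- by rewrite /= lebesgue_measure_itv/=; case: ifP => // _; rewrite -EFinB ltry.
- exact: measurable_funTS.
exists K; split; first exact: num_real.
by move=> r Kr t _ /=; apply: le_trans (fK _) (ltW Kr).
Qed.

(** The fundamental theorem of calculus gives this property when g has compact support and G
    dominates every [|partial i g|]; it is all that the Gagliardo-Nirenberg argument retains of
    derivatives. *)
Definition line_dominated n (g G : 'rV[R]_n -> R) := forall x i,
  ((g x)%:E <= \int[lebesgue_measure]_t (G (upd x i t))%:E)%E.

(* Dual form of the Gagliardo-Nirenberg inequality, which also makes sense (and
   is trivial) in dimension one, where the induction starts. *)
Let dual_bound m := forall M (g G H : 'rV[R]_m.+1 -> R),
  continuous g -> supported M g -> (forall x, 0 <= g x) ->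
  continuous G -> supported M G -> (forall x, 0 <= G x) -> line_dominated g G ->
  (forall x, 0 <= H x) -> (lebesgue_rV m.+1).-integrable setT (EFin \o H) ->
  (\int[lebesgue_rV m.+1]_x (g x * H x `^ m.+1%:R^-1)%:E <=
   (\int[lebesgue_rV m.+1]_x G x *
    (\int[lebesgue_rV m.+1]_x H x) `^ m.+1%:R^-1)%:E)%E.

Lemma EFin_Rintegral d (T : measurableType d) (mu : {measure set T -> \bar R})
    (D : set T) (f : T -> R) :
  measurable D -> mu.-integrable D (EFin \o f) ->
  (\int[mu]_(x in D) f x)%:E = (\int[mu]_(x in D) (f x)%:E)%E.
Proof. by move=> mD fi; rewrite /Rintegral fineK//; exact: integrable_fin_num. Qed.

(** In dimension one the line is the whole space, so [g] is bounded by the integral of [G], and the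
    exponent on [H] is 1. *)
Let dual_bound_1 : dual_bound 0.
Proof.
move=> M g G H cg sg g0 cG sG G0 gG H0 iH.
have iG := supported_integrable cG sG.
have gle x : g x <= \int[lebesgue_rV 1]_x G x.
  rewrite -lee_fin EFin_Rintegral// tonelli_rV; last 2 first.
  - by apply/measurable_EFinP; exact: continuous_measurable_rV.
  - by move=> y; rewrite lee_fin.
  apply: le_trans (gG x ord0) _; have [s [y ->]] := rV_cons_split x.
  rewrite le_eqVlt; apply/orP; left; apply/eqP; apply: eq_integral => t _.
  rewrite upd_cons0 /= integral_dirac//; last first.
    apply/measurable_EFinP; apply: continuous_measurable_rV.
    by apply: continuous_comp_rV; [exact: cG|exact: continuous_rV_cons].
  by rewrite diracE mem_set// mul1e (thinmx0 y).
have mH : measurable_fun setT H by case/integrableP : iH => /measurable_EFinP.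
rewrite invr1 powRr1; last by apply: Rintegral_ge0 => x _; exact: H0.
rewrite EFinM (EFin_Rintegral _ iH)// -ge0_integralZl//; first last.
- by rewrite lee_fin; apply: Rintegral_ge0 => x _.
- by move=> x _; rewrite lee_fin.
- exact/measurable_EFinP.
apply: ge0_le_integral => //.
- by move=> x _; rewrite lee_fin mulr_ge0// powR_ge0.
- apply/measurable_EFinP; apply: measurable_funM; first exact: continuous_measurable_rV.
  exact: (measurableT_comp (measurable_powR _) mH).
- by apply: measurable_funeM; exact/measurable_EFinP.
- by move=> x _; rewrite -EFinM lee_fin powRr1// ler_wpM2r.
Qed.

(** Let [B y] be the integral of G along the first coordinate and [a = 1 / (m+1)]. On the slice at
    t, [g^(1+a) <= g B^a], and the dual bound in one dimension less, with [H = B], yields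
    [A t * I^a], where [A t] is the integral of G over the slice. Integrating in t gives
    [I^(1+a)]. *)
Let dual_bound_gagliardo m M (g G : 'rV[R]_m.+2 -> R) : dual_bound m ->
  continuous g -> supported M g -> (forall x, 0 <= g x) ->
  continuous G -> supported M G -> (forall x, 0 <= G x) -> line_dominated g G ->
  (\int[lebesgue_rV m.+2]_x (g x `^ (1 + m.+1%:R^-1))%:E <=
   ((\int[lebesgue_rV m.+2]_x G x) `^ (1 + m.+1%:R^-1))%:E)%E.
Proof.
move=> IH cg sg g0 cG sG G0 gG.
set a := m.+1%:R^-1; have a0 : 0 < a by rewrite invr_gt0.
set I := \int[_]_x _; have I0 : 0 <= I by apply: Rintegral_ge0 => x _; exact: G0.
have mG : measurable_fun setT (EFin \o G).
  by apply/measurable_EFinP; exact: continuous_measurable_rV.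
have mg : measurable_fun setT g by exact: continuous_measurable_rV.
have iG := supported_integrable cG sG.
have mGc : measurable_fun setT (fun p => (G (@rV_cons R m.+1 p))%:E).
  by apply: (measurableT_comp mG); exact: measurable_rV_cons.
pose Be y := (\int[lebesgue_measure]_s (G (rV_cons (s, y)))%:E)%E.
have Be0 y : (0 <= Be y)%E by apply: integral_ge0 => s _; rewrite lee_fin.
have BeE y : Be y = (\int[lebesgue_measure]_s (G (upd (rV_cons (0, y)) ord0 s))%:E)%E.
  by apply: eq_integral => s _; rewrite upd_cons0.
have Bfin y : Be y \is a fin_num.
  by rewrite BeE; apply: integrable_fin_num => //; exact: line_integrable cG sG.
pose B y := fine (Be y).
have BE y : (B y)%:E = Be y by rewrite /B fineK.
have mB : measurable_fun setT Be.
  apply: (measurable_fun_fubini_tonelli_G (fun p => (G (@rV_cons R m.+1 p))%:E)) => //.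
  by move=> p; rewrite lee_fin.
have IBe : (\int[lebesgue_rV m.+1]_y Be y)%E = I%:E.
  by rewrite EFin_Rintegral// [RHS]tonelli_rV'// => x; rewrite lee_fin.
have iB : (lebesgue_rV m.+1).-integrable setT (EFin \o B).
  rewrite (_ : EFin \o B = Be); last by apply/funext => y; exact: BE.
  apply/integrableP; split=> //.
  by under eq_integral do rewrite gee0_abs//; rewrite IBe ltry.
have IB : \int[lebesgue_rV m.+1]_y B y = I.
  by apply: EFin_inj; rewrite EFin_Rintegral// -IBe; apply: eq_integral => y _; rewrite BE.
have mgp : measurable_fun setT (fun x => (g x `^ (1 + a))%:E).
  apply/measurable_EFinP; exact: (measurableT_comp (measurable_powR _) mg).
rewrite tonelli_rV//; last by move=> x; rewrite lee_fin powR_ge0.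
pose A t := (\int[lebesgue_rV m.+1]_y (G (rV_cons (t, y)))%:E)%E.
have cGt t : continuous (fun y => G (rV_cons (t, y))).
  by apply: continuous_comp_rV; [exact: cG|exact: continuous_rV_cons].
have cgt t : continuous (fun y => g (rV_cons (t, y))).
  by apply: continuous_comp_rV; [exact: cg|exact: continuous_rV_cons].
have sGt t : supported M (fun y => G (rV_cons (t, y))) by exact: supported_cons.
have sgt t : supported M (fun y => g (rV_cons (t, y))) by exact: supported_cons.
have mA : measurable_fun setT A.
  apply: (measurable_fun_fubini_tonelli_F (fun p => (G (@rV_cons R m.+1 p))%:E)) => //.
  by move=> p; rewrite lee_fin.
have A0 t : (0 <= A t)%E by apply: integral_ge0 => y _; rewrite lee_fin.
have -> : ((I `^ (1 + a))%:E = \int[lebesgue_measure]_t ((I `^ a)%:E * A t))%E.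
  rewrite ge0_integralZl//; last by rewrite lee_fin powR_ge0.
  rewrite -(tonelli_rV (F := fun x => (G x)%:E))//.
  rewrite -EFin_Rintegral// -/I -EFinM; congr EFin.
  have <- := @mulr_powRB1 _ I (1 + a) I0; last by rewrite addr_gt0.
  by rewrite addrC addKr mulrC.
apply: ge0_le_integral => //.
- by move=> t _; apply: integral_ge0 => y _; rewrite lee_fin powR_ge0.
- apply: (measurable_fun_fubini_tonelli_F (fun p => (g (@rV_cons R m.+1 p) `^ (1 + a))%:E)).
    by apply: (measurableT_comp mgp); exact: measurable_rV_cons.
  by move=> p; rewrite lee_fin powR_ge0.
- exact: measurable_funeM.
move=> t _.
have gB y : g (rV_cons (t, y)) <= B y.
  rewrite -lee_fin BE; apply: le_trans (gG _ ord0) _.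
  by under eq_integral do rewrite upd_cons0.
have B0 y : 0 <= B y by rewrite -lee_fin BE.
have ldt : line_dominated (fun y => g (rV_cons (t, y))) (fun y => G (rV_cons (t, y))).
  by move=> y j; have := gG (rV_cons (t, y)) (lift ord0 j);
    under eq_integral do rewrite upd_consS.
have := IH M _ _ B (cgt t) (sgt t) (fun y => g0 _) (cGt t) (sGt t) (fun y => G0 _) ldt B0 iB.
rewrite IB EFinM EFin_Rintegral//; last exact: supported_integrable (cGt t) (sGt t).
rewrite muleC; apply: le_trans; apply: ge0_le_integral => //.
- by move=> y _; rewrite lee_fin powR_ge0.
- apply/measurable_EFinP; apply: (measurableT_comp (measurable_powR _)).
  exact: continuous_measurable_rV (cgt t).
- apply/measurable_EFinP; apply: measurable_funM.
    exact: continuous_measurable_rV (cgt t).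
  apply: (measurableT_comp (measurable_powR _)).
  by case/integrableP : iB => /measurable_EFinP.
move=> y _; rewrite lee_fin.
have <- := @mulr_powRB1 _ (g (rV_cons (t, y))) (1 + a) (g0 _); last by rewrite addr_gt0.
rewrite [1 + a]addrC addrK ler_wpM2l// ge0_ler_powR ?nnegrE//; exact: ltW.
Qed.

(** Hoelder's inequality with the conjugate exponents [(m+2)/(m+1)] and [m+2]; the first norm is
    bounded by the direct inequality in the same dimension. *)
Let dual_bound_S m : dual_bound m -> dual_bound m.+1.
Proof.
move=> IH M g G H cg sg g0 cG sG G0 gG H0 iH.
have h := dual_bound_gagliardo IH cg sg g0 cG sG G0 gG.
set a : R := 1 + m.+1%:R^-1; rewrite -/a in h.
have a0 : 0 < a by rewrite addr_gt0// invr_gt0.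
set b : R := m.+2%:R; have b0 : 0 < b by [].
have ab : a^-1 + b^-1 = 1.
  rewrite /a /b -natr1; have : (0 : R) < m.+1%:R by [].
  by move: (m.+1%:R) => z z0; field; rewrite !gt_eqF//; lra.
have mH : measurable_fun setT H by case/integrableP : iH => /measurable_EFinP.
have mg : measurable_fun setT g by exact: continuous_measurable_rV.
have mHb : measurable_fun setT (fun x => H x `^ b^-1).
  exact: (measurableT_comp (measurable_powR _)).
have := hoelder (lebesgue_rV m.+2) mg mHb a0 b0 ab.
rewrite Lnorm1 unlock.
under eq_integral => x _ do rewrite /= ger0_norm ?mulr_ge0 ?powR_ge0//.
move=> /le_trans; apply; rewrite EFinM; apply: lee_pmul.
- exact: poweR_ge0.
- exact: poweR_ge0.
- apply: (@le_trans _ _ (((\int[lebesgue_rV m.+2]_x G x) `^ a)%:E `^ a^-1)%E).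
    rewrite gt0_ler_poweR ?in_itv/= ?leey ?andbT ?invr_ge0 ?(ltW a0)//.
    + by apply: integral_ge0 => x _; rewrite lee_fin powR_ge0.
    + by rewrite lee_fin powR_ge0.
    + apply: le_trans h; rewrite le_eqVlt; apply/orP; left; apply/eqP.
      by apply: eq_integral => x _ /=; rewrite ger0_norm.
  rewrite poweR_EFin -powRrM mulfV ?gt_eqF// powRr1//.
  by apply: Rintegral_ge0 => x _.
- rewrite -poweR_EFin EFin_Rintegral// le_eqVlt; apply/orP; left; apply/eqP.
  congr poweR; apply: eq_integral => x _ /=.
  by rewrite ger0_norm ?powR_ge0// -powRrM mulVf ?gt_eqF// powRr1.
Qed.

Lemma gagliardo n M (g G : 'rV[R]_n.+2 -> R) :
  continuous g -> supported M g -> (forall x, 0 <= g x) ->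
  continuous G -> supported M G -> (forall x, 0 <= G x) -> line_dominated g G ->
  (\int[lebesgue_rV n.+2]_x (g x `^ (1 + n.+1%:R^-1))%:E <=
   ((\int[lebesgue_rV n.+2]_x G x) `^ (1 + n.+1%:R^-1))%:E)%E.
Proof.
apply: dual_bound_gagliardo.
by elim: n {g G} => [|n IH]; [exact: dual_bound_1|exact: dual_bound_S].
Qed.

End gagliardo_nirenberg.

Lemma sqint_bounded d (T : measurableType d) (R : realType)
    (mu : {measure set T -> \bar R}) (D : set T) (f : T -> R) (K : R) :
  measurable D -> (mu D < +oo)%E -> measurable_fun D f ->
  (forall x, D x -> `|f x| <= K) -> sqint mu D f.
Proof.
move=> mD Dfin mf fK; split=> //.
apply: (@le_lt_trans _ _ (\int[mu]_(x in D) (cst (K ^+ 2)%:E x))%E).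
  apply: ge0_le_integral => //.
  - by move=> x _; rewrite lee_fin sqr_ge0.
  - by apply/measurable_EFinP; exact: measurable_funX.
  - move=> x Dx; rewrite lee_fin -real_normK ?num_real// lerXn2r ?nnegrE//; last exact: fK.
    by apply: le_trans (fK x Dx).
by rewrite integral_cst// lte_mul_pinfty ?lee_fin ?sqr_ge0.
Qed.

(** * The Poincare inequality *)

Section C1_compact_support.
Context {R : realType}.

Lemma continuous_sqr (T : topologicalType) (f : T -> R) :
  continuous f -> continuous (fun x => f x ^+ 2).
Proof. by move=> cf; under eq_fun do rewrite expr2; move=> x; apply: cvgM; exact: cf. Qed.

Lemma partial_outside n (K : set 'rV[R]_n) (f : 'rV[R]_n -> R) i x : closed K ->
  (forall x, ~ K x -> f x = 0) -> ~ K x -> partial i f x = 0.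
Proof.
move=> cK f0 Kx.
have nK : nbhs x (~` K) by apply: open_nbhs_nbhs; split => //; exact: closed_openC.
suff : is_derive x (delta_mx ord0 i) f 0 by move=> h; exact: derive_val.
apply: (@near_eq_is_derive _ _ _ (cst 0)) => /=.
by apply: filterS nK => y /= /f0.
Qed.

Lemma closed_box n M : closed (@box R n M).
Proof. by apply: compact_closed; [exact: norm_hausdorff|exact: compact_box]. Qed.

Lemma supported_partial n M (f : 'rV[R]_n -> R) i : supported M f ->
  supported M (partial i f).
Proof.
move=> sf x; apply: contra_neqP => Mx.
apply: (partial_outside i (@closed_box n M)) => // y My.
by apply/eqP/negPn/negP => /sf.
Qed.

(** Cauchy-Schwarz against the constant 1 on the interval from -L to L, of length [2 L], applied to
    [|h t| <= \int |h'|]. *)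
Lemma sqr_le_integral_derive (h h' : R -> R) (L : R) : 0 < L ->
  (forall t : R, is_derive t 1 h (h' t)) -> continuous h' ->
  (forall t, L <= `|t| -> h t = 0) -> forall t,
  ((h t ^+ 2)%:E <= (2 * L)%:E * \int[lebesgue_measure]_s (h' s ^+ 2)%:E)%E.
Proof.
move=> L0 dh ch hL t.
pose I : set (measurableTypeR R) := `[(- L), L]%classic.
have mI : measurable I by exact: measurable_itv.
have muI : @lebesgue_measure R I = (2 * L)%:E.
  by rewrite /I lebesgue_measure_itv/= lte_fin gtrN// -EFinB opprK mulr2n mulrDl mul1r.
have muIoo : (@lebesgue_measure R I < +oo)%E by rewrite muI ltry.
have mh : measurable_fun setT h' by exact: continuous_measurable_fun.
have [K [Kr hK]] : bounded_set (h' @` I).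
  apply: compact_bounded; apply: continuous_compact; last exact: segment_compact.
  exact: continuous_subspaceT.
have Lh : sqint lebesgue_measure I (fun s => `|h' s|).
  apply: (@sqint_bounded _ _ _ _ _ _ (`|K| + 1)) => //.
  - by apply: measurableT_comp => //; exact: measurable_funTS.
  - move=> s Is; rewrite normr_id; apply: (hK (`|K| + 1)); last by exists s.
    by rewrite (le_lt_trans (ler_norm _))// ltrDl.
have L1 : sqint lebesgue_measure I (fun=> 1).
  apply: (@sqint_bounded _ _ _ _ _ _ 1) => //.
  by move=> s _; rewrite normr1.
have := ip_CS mI L1 Lh.
have -> : ip lebesgue_measure I (fun=> 1) (fun=> 1) = 2 * L.
  rewrite /ip mulr1 Rintegral_cst// mul1r.
  by rewrite -[RHS]/(fine (2 * L)%:E) -muI.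
have hE : (`|h t|%:E <= (ip lebesgue_measure I (fun=> 1) (fun s => `|h' s|))%:E)%E.
  rewrite EFin_Rintegral//; last exact: sqint_mul.
  by under eq_integral do rewrite mul1r; exact: le_integral_derive.
rewrite lee_fin in hE => CS.
apply: (@le_trans _ _ ((2 * L) * ip lebesgue_measure I (fun s => `|h' s|) (fun s => `|h' s|))%:E).
  rewrite lee_fin; apply: le_trans CS; rewrite -(real_normK (num_real (h t))).
  have ip0 := le_trans (normr_ge0 (h t)) hE.
  by rewrite lerXn2r ?nnegrE.
rewrite EFinM lee_pmul2l// ?lte_fin ?mulr_gt0// EFin_ip//.
under eq_integral do rewrite real_normK ?num_real//.
apply: ge0_subset_integral => //.
- by apply/measurable_EFinP; exact: measurable_funX.
- by move=> s _; rewrite lee_fin sqr_ge0.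
Qed.

Lemma integral_rV1 (F : 'rV[R]_1 -> R) x : continuous F -> (forall y, 0 <= F y) ->
  (\int[lebesgue_rV 1]_y (F y)%:E = \int[lebesgue_measure]_t (F (upd x ord0 t))%:E)%E.
Proof.
move=> cF F0; rewrite tonelli_rV; last 2 first.
- by apply/measurable_EFinP; exact: continuous_measurable_rV.
- by move=> y; rewrite lee_fin.
have [s [y ->]] := rV_cons_split x.
apply: eq_integral => t _; rewrite upd_cons0 /= integral_dirac//; last first.
  apply/measurable_EFinP; apply: continuous_measurable_rV.
  by apply: continuous_comp_rV; [exact: cF|exact: continuous_rV_cons].
by rewrite diracE mem_set// mul1e (thinmx0 y).
Qed.

Section inequalities.
Variables (n : nat) (f : 'rV[R]_n -> R) (M : R).
Hypothesis M0 : 0 < M.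
Hypothesis df : forall i x, derivable f x (delta_mx ord0 i).
Hypothesis cdf : forall i, continuous (partial i f).
Hypothesis sf : supported M f.

(** The Dirichlet energy on the whole space, with classical derivatives; for test functions it is
    the energy on Omega ([vip_gradient]). *)
Definition dirichlet_sum := \sum_i \int[lebesgue_rV n]_x (partial i f x ^+ 2).

Let M10 : 0 < M + 1. Proof. by rewrite addr_gt0. Qed.

(** [supported M] says nothing at [|t| = M], whereas the one-dimensional lemmas want the function to
    vanish at the endpoints too; hence the [M + 1] in all constants. *)
Let fM1 x i t : M + 1 <= `|t| -> f (upd x i t) = 0.
Proof.
move=> Mt; apply: (supported_upd sf); apply: lt_le_trans Mt.
by rewrite ltrDl.
Qed.

Let cpl x i : continuous (fun t : R => partial i f (upd x i t)).
Proof. by apply: continuous_comp_rV; [exact: cdf|exact: continuous_upd]. Qed.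

Lemma sqr_le_line x i : ((f x ^+ 2)%:E <=
  (2 * (M + 1))%:E * \int[lebesgue_measure]_t (partial i f (upd x i t) ^+ 2)%:E)%E.
Proof.
rewrite -{1}(upd_id x i).
exact: (sqr_le_integral_derive M10 (is_derive_line (@df i) x) (@cpl x i)
  (@fM1 x i) (x ord0 i)).
Qed.

Lemma le_dirichlet_sum i : \int[lebesgue_rV n]_x (partial i f x ^+ 2) <= dirichlet_sum.
Proof.
rewrite /dirichlet_sum (bigD1 i)//= lerDl; apply: sumr_ge0 => j _.
by apply: Rintegral_ge0 => x _; exact: sqr_ge0.
Qed.

End inequalities.

(** On each line in the first direction, [f^2] is at most [2 L] times the energy of the line, with
    [L = M + 1]; integrating over the interval of length [2 L] outside which f vanishes contributes
    the second factor [2 L]. *)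
Lemma poincare n (f : 'rV[R]_n.+1 -> R) (M : R) : 0 < M -> continuous f ->
  (forall i x, derivable f x (delta_mx ord0 i)) ->
  (forall i, continuous (partial i f)) -> supported M f ->
  \int[lebesgue_rV n.+1]_x (f x ^+ 2) <= (2 * (M + 1)) ^+ 2 * dirichlet_sum f.
Proof.
move=> M0 cf df cdf sf.
set L := M + 1; have L0 : 0 < L by rewrite addr_gt0.
have cf2 : continuous (fun x => f x ^+ 2) by exact: continuous_sqr.
have cdf2 : continuous (fun x => partial ord0 f x ^+ 2).
  by exact: continuous_sqr.
have s2 : supported M (fun x => f x ^+ 2) by move=> x; rewrite expf_eq0/= => /sf.
have sd2 : supported M (fun x => partial ord0 f x ^+ 2).
  by move=> x; rewrite expf_eq0/=; exact: supported_partial.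
apply: (@le_trans _ _ ((2 * L) ^+ 2 * \int[lebesgue_rV n.+1]_x (partial ord0 f x ^+ 2))); last first.
  by rewrite ler_wpM2l ?sqr_ge0//; exact: le_dirichlet_sum.
rewrite -lee_fin EFinM EFin_Rintegral//; last exact: supported_integrable s2.
rewrite EFin_Rintegral//; last exact: supported_integrable sd2.
have mf2 : measurable_fun setT (fun x => (f x ^+ 2)%:E).
  by apply/measurable_EFinP; exact: continuous_measurable_rV.
have md2 : measurable_fun setT (fun x => (partial ord0 f x ^+ 2)%:E).
  by apply/measurable_EFinP; exact: continuous_measurable_rV.
have f20 (x : 'rV_n.+1) : (0 <= (f x ^+ 2)%:E)%E by rewrite lee_fin sqr_ge0.
have d20 (x : 'rV_n.+1) : (0 <= (partial ord0 f x ^+ 2)%:E)%E by rewrite lee_fin sqr_ge0.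
rewrite !tonelli_rV'// -ge0_integralZl//; first last.
- by rewrite lee_fin sqr_ge0.
- by move=> y _; apply: integral_ge0.
- apply: (measurable_fun_fubini_tonelli_G (fun p => (partial ord0 f (rV_cons p) ^+ 2)%:E)) => //.
  by apply: (measurableT_comp md2); exact: measurable_rV_cons.
apply: ge0_le_integral => //.
- by move=> y _; apply: integral_ge0.
- apply: (measurable_fun_fubini_tonelli_G (fun p => (f (rV_cons p) ^+ 2)%:E)) => //.
  by apply: (measurableT_comp mf2); exact: measurable_rV_cons.
- apply: measurable_funeM.
  apply: (measurable_fun_fubini_tonelli_G (fun p => (partial ord0 f (rV_cons p) ^+ 2)%:E)) => //.
  by apply: (measurableT_comp md2); exact: measurable_rV_cons.
move=> y _; set E := (X in (_ <= _ * X)%E).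
pose I : set (measurableTypeR R) := `[(- L), L]%classic.
have mI : measurable I by exact: measurable_itv.
have muI : @lebesgue_measure R I = (2 * L)%:E.
  by rewrite /I lebesgue_measure_itv/= lte_fin gtrN// -EFinB opprK mulr2n mulrDl mul1r.
apply: (@le_trans _ _ (\int[lebesgue_measure]_(x in I) (f (rV_cons (x, y)) ^+ 2)%:E)%E).
  rewrite le_eqVlt; apply/orP; left; apply/eqP; rewrite [RHS]integral_mkcond; apply: eq_integral => t _; rewrite patchE.
  case: ifPn => //; rewrite notin_setE /I /= in_itv/= -ler_norml => /negP; rewrite -ltNge => Lt.
  have := supported_upd sf (rV_cons (0, y)) ord0 (_ : M < `|t|); rewrite upd_cons0 => ->.
    by rewrite expr0n.
  by apply: lt_trans Lt; rewrite ltrDl.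
have E0 : (0 <= E)%E by exact: integral_ge0.
apply: (@le_trans _ _ (\int[lebesgue_measure]_(x in I) (cst ((2 * L)%:E * E) x))%E).
  apply: ge0_le_integral => //.
  - apply/measurable_EFinP; apply: measurable_funTS; apply: continuous_measurable_fun.
    rewrite (_ : (fun t => _) = (fun t => f (upd (rV_cons (0, y)) ord0 t) ^+ 2)).
      by apply: continuous_sqr; apply: continuous_comp_rV; [exact: cf|exact: continuous_upd].
    by apply/funext => t; rewrite upd_cons0.
  - move=> t _ /=; have := sqr_le_line M0 df cdf sf (rV_cons (t, y)) ord0.
    under eq_integral do rewrite upd_cons0; exact.
rewrite integral_cst// [X in (_ * E * X <= _)%E](_ : _ = (2 * L)%:E); last exact: muI.
by rewrite muleAC -EFinM -expr2.
Qed.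

End C1_compact_support.

Lemma Rintegral_sum d (T : measurableType d) (R : realType)
    (mu : {measure set T -> \bar R}) (D : set T) (I : finType) (F : I -> T -> R) :
  measurable D -> (forall i, mu.-integrable D (EFin \o F i)) ->
  \int[mu]_(x in D) (\sum_i F i x) = \sum_i \int[mu]_(x in D) F i x.
Proof.
move=> mD iF; apply: EFin_inj; rewrite -sumEFin.
under [RHS]eq_bigr => i _ do rewrite EFin_Rintegral//.
rewrite EFin_Rintegral//; last first.
  under [EFin \o _]eq_fun do rewrite /= -sumEFin.
  by apply: integrable_sum => // i _; exact: iF.
under eq_integral do rewrite -sumEFin.
rewrite integral_sum// => i; exact: iF.
Qed.

Lemma integrable_Rsum d (T : measurableType d) (R : realType)
    (mu : {measure set T -> \bar R}) (D : set T) (I : finType) (F : I -> T -> R) :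
  measurable D -> (forall i, mu.-integrable D (EFin \o F i)) ->
  mu.-integrable D (EFin \o (fun x => \sum_i F i x)).
Proof.
move=> mD iF; under [EFin \o _]eq_fun do rewrite /= -sumEFin.
by apply: integrable_sum => // i _; exact: iF.
Qed.

(** * The Sobolev inequality in dimension at least 3 *)

Section sobolev_inequality.
Context {R : realType}.

Lemma supported_sqint n M (f : 'rV[R]_n -> R) : continuous f -> supported M f ->
  sqint (lebesgue_rV n) setT f.
Proof.
move=> cf sf; apply: sqintP => //; first exact: continuous_measurable_rV.
apply: (@supported_integrable _ _ M); first exact: continuous_sqr.
by move=> x; rewrite expf_eq0/= => /sf.
Qed.

Lemma continuous_norm_powR n (f : 'rV[R]_n -> R) a : 0 < a -> continuous f ->
  continuous (fun x => `|f x| `^ a).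
Proof.
move=> a0 cf x; apply: (@continuous_comp _ _ _ f (fun y => `|y| `^ a)); first exact: cf.
exact: norm_powR_continuous.
Qed.

Lemma supported_norm_powR n M (f : 'rV[R]_n -> R) a : 0 < a -> supported M f ->
  supported M (fun x => `|f x| `^ a).
Proof.
move=> a0 sf x; apply: contra_neqP => Mx.
have -> : f x = 0 by apply/eqP/negPn/negP => /sf.
by rewrite normr0 powR0// gt_eqF.
Qed.

(** With [N = n+3], apply [gagliardo] to [|f|^c], [c = 2(N-1)/(N-2)]. This c satisfies both
    [c N/(N-1) = s] and [2(c-1) = s], so Cauchy-Schwarz on [|f|^(c-1) |partial i f|] brings back
    [F], the integral of [|f|^s]: [F^(1/p) <= N c sqrt F sqrt D] with [p = N/(N-1)]. Since
    [1/p = 1/s + 1/2], a factor [sqrt F] cancels. *)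
Lemma sobolev n (f : 'rV[R]_n.+3 -> R) (M : R) : 0 < M -> continuous f ->
  (forall i x, derivable f x (delta_mx ord0 i)) ->
  (forall i, continuous (partial i f)) -> supported M f ->
  let s := 2 * n.+3%:R / n.+1%:R in
  (\int[lebesgue_rV n.+3]_x `|f x| `^ s) `^ s^-1 <=
  n.+3%:R * (2 * n.+2%:R / n.+1%:R) * Num.sqrt (dirichlet_sum f).
Proof.
move=> M0 cf df cdf sf.
set z : R := n.+1%:R; have z0 : 0 < z by [].
have -> : n.+2%:R = z + 1 :> R by rewrite natr1.
set nn : R := n.+3%:R; have nnE : nn = z + 2 by rewrite /nn -natr1 -natr1 -addrA.
rewrite /=; set s := 2 * nn / z; set c := 2 * (z + 1) / z; set D := dirichlet_sum f.
have D0 : 0 <= D by apply: sumr_ge0 => i _; apply: Rintegral_ge0 => x _; exact: sqr_ge0.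
have s0 : 0 < s by rewrite divr_gt0// mulr_gt0// nnE addr_gt0.
have c1 : 1 < c by rewrite ltr_pdivlMr// mul1r; lra.
have c0 : 0 < c by exact: lt_trans c1.
have c10 : 0 < c - 1 by rewrite subr_gt0.
pose g x := `|f x| `^ c; pose k x := `|f x| `^ (c - 1).
pose G x := \sum_i c * (k x * `|partial i f x|).
have ck : continuous k by exact: continuous_norm_powR.
have sk : supported M k by exact: supported_norm_powR.
have cd i : continuous (fun x => `|partial i f x|).
  by move=> x; apply: (@continuous_comp _ _ _ (partial i f) Num.norm); [exact: cdf|exact: norm_continuous].
have sd i : supported M (fun x => `|partial i f x|).
  by move=> x; rewrite normr_eq0; exact: supported_partial.
have ckd0 i : continuous (fun x => k x * `|partial i f x|).
  by move=> x; exact: (@cvgM _ _ _ _ k (fun x => `|partial i f x|) _ _ (ck x) (cd i x)).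
have ckd i : continuous (fun x => c * (k x * `|partial i f x|)).
  by move=> x; exact: (@cvgM _ _ _ _ (fun=> c) _ c _ (@cst_continuous _ _ c x) (ckd0 i x)).
have cG : continuous G.
  by apply: continuous_big => [|i _]; [exact: add_continuous|exact: ckd].
have k0 x : 0 <= k x by exact: powR_ge0.
have sG : supported M G.
  move=> x; apply: contra_neqP => Mx; rewrite /G big1// => i _.
  have -> : k x = 0 by apply/eqP/negPn/negP => /sk.
  by rewrite mul0r mulr0.
have G0 x : 0 <= G x.
  by apply: sumr_ge0 => i _; rewrite mulr_ge0 ?(ltW c0)// mulr_ge0.
have cg : continuous g by exact: continuous_norm_powR.
have sg : supported M g by exact: supported_norm_powR.
(* Along a line in direction i the derivative of [|f|^c] is in absolute value the i-th term of
   [G]. *)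
have gG : line_dominated g G.
  move=> x i.
  pose h t := `|f (upd x i t)| `^ c.
  pose h' t := c * (pospow (c - 1) (f (upd x i t)) - pospow (c - 1) (- f (upd x i t))) *
    partial i f (upd x i t).
  have cfl : continuous (fun t : R => f (upd x i t)).
    by apply: continuous_comp_rV; [exact: cf|exact: continuous_upd].
  have cpl : continuous (fun t : R => partial i f (upd x i t)).
    by apply: continuous_comp_rV; [exact: cdf|exact: continuous_upd].
  have dh (t : R) : is_derive t 1 h (h' t).
    have d1 := is_derive_line (@df i) x t.
    have d2 := is_derive_norm_powR (f (upd x i t)) c1.
    exact: is_derive1_comp d2 d1.
  have ch' : continuous h'.
    move=> t; apply: (@cvgM _ _ _ _ (fun t => c * (pospow (c - 1) (f (upd x i t)) -
      pospow (c - 1) (- f (upd x i t)))) (fun t => partial i f (upd x i t))); last exact: cpl.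
    apply: (@cvgM _ _ _ _ (fun=> c) (fun t => pospow (c - 1) (f (upd x i t)) -
      pospow (c - 1) (- f (upd x i t)))); first exact: cst_continuous.
    apply: (@cvgB _ _ _ _ _ (fun t => pospow (c - 1) (f (upd x i t)))
      (fun t => pospow (c - 1) (- f (upd x i t)))).
      apply: (@continuous_comp _ _ _ (fun t : R => f (upd x i t)) (pospow (c - 1))).
        exact: cfl.
      exact: pospow_continuous.
    apply: (@continuous_comp _ _ _ (fun t : R => - f (upd x i t)) (pospow (c - 1))).
      by apply: cvgN; exact: cfl.
    exact: pospow_continuous.
  have hM (t : R) : M + 1 <= `|t| -> h t = 0.
    move=> Mt; rewrite /h (supported_upd sf) ?normr0 ?powR0 ?gt_eqF//.
    by apply: lt_le_trans Mt; rewrite ltrDl.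
  have := le_integralT_derive dh ch' hM (x ord0 i).
  rewrite /h upd_id ger0_norm ?powR_ge0// => /le_trans; apply.
  apply: ge0_le_integral => //.
  - apply/measurable_EFinP; apply: measurableT_comp => //; exact: continuous_measurable_fun.
  - apply/measurable_EFinP; apply: continuous_measurable_fun.
    by apply: continuous_comp_rV; [exact: cG|exact: continuous_upd].
  move=> t _; rewrite lee_fin /h' normrM [X in X * _]normrM pospowBN_norm// (ger0_norm (ltW c0)) -mulrA.
  rewrite /G (bigD1 i)//= lerDl; apply: sumr_ge0 => j _.
  by rewrite mulr_ge0 ?(ltW c0)// mulr_ge0.
have := gagliardo cg sg (fun x => powR_ge0 _ _) cG sG G0 gG.
have -> : n.+2%:R^-1 = (z + 1)^-1 :> R by rewrite natr1.
set p := 1 + _; have p0 : 0 < p by rewrite addr_gt0// invr_gt0 addr_gt0.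
have cs : continuous (fun x => `|f x| `^ s) by exact: continuous_norm_powR.
have ss : supported M (fun x => `|f x| `^ s) by exact: supported_norm_powR.
have cps : c * p = s.
  by rewrite /c /p /s nnE; field; rewrite !gt_eqF// addr_gt0.
under eq_integral do rewrite /g -powRrM cps.
rewrite -EFin_Rintegral//; last exact: supported_integrable cs ss.
set F := \int[_]_x `|f x| `^ s; have F0 : 0 <= F by apply: Rintegral_ge0 => x _; exact: powR_ge0.
rewrite lee_fin => FG.
have Lk := supported_sqint ck sk.
have Ld i := supported_sqint (cd i) (sd i).
have kk : ip (lebesgue_rV n.+3) setT k k = F.
  apply: eq_Rintegral => x _; rewrite /k -powRD; last first.
    by rewrite (gt_eqF (addr_gt0 c10 c10)).
  by congr (_ `^ _); rewrite /c /s nnE; field; rewrite gt_eqF.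
have kd i : ip (lebesgue_rV n.+3) setT k (fun x => `|partial i f x|) <= Num.sqrt F * Num.sqrt D.
  have CS := ip_CS measurableT Lk (Ld i).
  rewrite -sqrtrM// -[leLHS]ger0_norm; last by apply: Rintegral_ge0 => x _; rewrite mulr_ge0.
  rewrite -sqrtr_sqr; apply: ler_wsqrtr; apply: le_trans CS _; rewrite kk ler_wpM2l//.
  apply: le_trans (le_dirichlet_sum f i); rewrite le_eqVlt; apply/orP; left; apply/eqP.
  by apply: eq_Rintegral => x _; rewrite -expr2 real_normK ?num_real.
have IG : \int[lebesgue_rV n.+3]_x G x <= nn * c * (Num.sqrt F * Num.sqrt D).
  rewrite /G Rintegral_sum//; last first.
    move=> i; apply: (@supported_integrable _ _ M).
      exact: ckd.
    by move=> x; rewrite !mulf_eq0 !negb_or => /and3P[_ /sk].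
  apply: (@le_trans _ _ (\sum_(i < n.+3) c * (Num.sqrt F * Num.sqrt D))); last first.
    by rewrite sumr_const card_ord -mulr_natl mulrA.
  apply: ler_sum => i _; rewrite RintegralZl//; last exact: sqint_mul.
  by rewrite (ler_pM2l c0); exact: kd.
(* The cancellation of [sqrt F] requires [F != 0]; finiteness of [F] comes from the compact
   support. *)
have [->|Fn0] := eqVneq F 0.
  by rewrite powR0 ?invr_eq0 ?gt_eqF// mulr_ge0 ?sqrtr_ge0// mulr_ge0 ?(ltW c0)// nnE addr_ge0// ltW.
have Fp : 0 < F by rewrite lt_def Fn0.
have I0 : 0 <= \int[lebesgue_rV n.+3]_x G x by apply: Rintegral_ge0 => x _; exact: G0.
have : F `^ p^-1 <= nn * c * (Num.sqrt F * Num.sqrt D).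
  apply: le_trans IG; apply: (@le_trans _ _ (((\int[lebesgue_rV n.+3]_x G x) `^ p) `^ p^-1)).
    by rewrite ge0_ler_powR ?nnegrE ?powR_ge0// invr_ge0 ltW.
  by rewrite -powRrM mulfV ?gt_eqF// powRr1.
have -> : p^-1 = s^-1 + 2^-1.
  rewrite /p /s nnE; field; rewrite !gt_eqF//; lra.
rewrite powRD; last by rewrite Fn0 implybT.
by rewrite powR12_sqrt// (mulrCA (nn * c)) [leLHS]mulrC ler_pM2l ?sqrtr_gt0.
Qed.

End sobolev_inequality.

(** * Bump functions and the fundamental lemma *)

Section smooth_bumps.
Context {R : realType}.

(** The whole sequence of derivatives is the witness, so that the mixed partial derivatives of a
    tensor product can be written down explicitly. *)
Definition smooth1 (h : R -> R) := exists H : nat -> R -> R,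
  H 0 = h /\ forall n (t : R), is_derive t 1 (H n) (H n.+1 t).

Lemma is_derive_continuous (h h' : R -> R) :
  (forall t : R, is_derive t 1 h (h' t)) -> continuous h.
Proof.
move=> dh t; apply: differentiable_continuous; apply/derivable1_diffP.
by case: (dh t).
Qed.

Lemma smooth1_affine h a b : smooth1 h -> smooth1 (fun t => h (a * t + b)).
Proof.
move=> [H [H0 dH]]; exists (fun n t => a ^+ n * H n (a * t + b)); split.
  by apply/funext => t; rewrite expr0 mul1r H0.
move=> n t; have d1 : is_derive t (1:R) (fun t : R => a * t + b) a.
  have -> : (fun t : R => a * t + b) = (a \*: (id : R -> R)) + cst b by [].
  by apply: is_derive_eq; rewrite addr0 /GRing.scale/= mulr1.
have d2 := @is_derive1_comp _ (H n) (fun t : R => a * t + b) t _ _ (dH n (a * t + b)) d1.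
have -> : (fun t => a ^+ n * H n (a * t + b)) = a ^+ n \*: (H n \o (fun t : R => a * t + b)) by [].
by apply: is_derive_eq; rewrite /GRing.scale/= exprSr; ring.
Qed.

(** Leibniz' rule without binomial coefficients: a list of pairs (i, j) stands for the sum of the
    [F i * G j], and [step] differentiates each product. *)
Lemma smooth1M f g : smooth1 f -> smooth1 g -> smooth1 (fun t => f t * g t).
Proof.
move=> [F [F0 dF]] [G [G0 dG]].
pose step s := flatten [seq [:: (p.1.+1, p.2); (p.1, p.2.+1)] | p <- s] : seq (nat * nat).
pose S s t := \sum_(p <- s) F p.1 t * G p.2 t.
have dS s (t : R) : is_derive t 1 (S s) (S (step s) t).
  elim: s => [|p s IH].
    rewrite (_ : S [::] = cst 0); last by apply/funext => u; rewrite /S big_nil.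
    exact: is_derive_cst.
  rewrite (_ : S (p :: s) = F p.1 * G p.2 + S s); last first.
    by apply/funext => u; rewrite /S big_cons.
  have dFp := dF p.1 t; have dGp := dG p.2 t.
  by apply: is_derive_eq; rewrite /S /= !big_cons/= /GRing.scale/=; ring.
exists (fun n => S (iter n step [:: (0, 0)])); split; last by move=> n t; exact: dS.
by apply/funext => t; rewrite /S /= big_cons big_nil F0 G0 addr0.
Qed.

(* The functions [P(1/x) exp(-1/x)], extended by 0 to [x <= 0]: a family stable
   under differentiation. *)
Definition flat_exp (P : {poly R}) (x : R) : R :=
  if 0 < x then P.[x^-1] * expR (- x^-1) else 0.

(** From [expR y >= y^(i+1) / (i+1)!] at [y = 1/x], each monomial satisfies
    [y^i expR (- y) <= (i+1)! x]. *)
Lemma flat_exp_bound P : exists K, forall x, `|flat_exp P x| <= K * `|x|.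
Proof.
exists (\sum_(i < size P) `|P`_i| * i.+1`!%:R) => x; rewrite /flat_exp.
case: ifPn => [x0|_]; last first.
  by rewrite normr0 mulr_ge0//; apply: sumr_ge0 => i _; rewrite mulr_ge0.
set y := x^-1; have y0 : 0 < y by rewrite invr_gt0.
have bnd i : y ^+ i * expR (- y) <= i.+1`!%:R * x.
  have f0 : 0 < i.+1`!%:R :> R by rewrite ltr0n fact_gt0.
  have := expR_ge1Dxn i (ltW y0); rewrite expRN => h.
  rewrite ler_pdivrMr ?expR_gt0//.
  have : y ^+ i.+1 / i.+1`!%:R <= expR y by apply: le_trans h; rewrite lerDr.
  rewrite ler_pdivrMr// exprS => h2.
  have -> : y ^+ i = x * (y * y ^+ i) by rewrite mulrA /y mulfV ?mul1r// gt_eqF.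
  apply: le_trans (_ : x * (expR y * i.+1`!%:R) <= _); first by rewrite ler_wpM2l// ltW.
  by rewrite le_eqVlt; apply/orP; left; apply/eqP; ring.
rewrite normrM (ger0_norm (expR_ge0 _)) horner_coef (gtr0_norm x0).
apply: (@le_trans _ _ ((\sum_(i < size P) `|P`_i| * y ^+ i) * expR (- y))).
  rewrite ler_wpM2r ?expR_ge0//; apply: le_trans (ler_norm_sum _ _ _) _.
  by apply: ler_sum => i _; rewrite normrM (ger0_norm (exprn_ge0 _ (ltW y0))).
rewrite !mulr_suml; apply: ler_sum => i _.
by rewrite -!mulrA ler_wpM2l.
Qed.

(** For [x > 0] the factor ['X^2] is the [x^-2] from the derivative of [1/x]. At 0 the difference
    quotient is [flat_exp ('X * P)], which tends to 0 by [flat_exp_bound]. *)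
Lemma is_derive_flat_exp P (x : R) :
  is_derive x 1 (flat_exp P) (flat_exp ('X^2 * (P - P^`())) x).
Proof.
have [x0|x0|->] := ltgtP x 0.
- rewrite {2}/flat_exp ltNge (ltW x0)/=.
  apply: (@near_eq_is_derive _ _ _ (cst 0)); near=> z.
  rewrite /flat_exp ltNge (_ : z <= 0)//= ltW//.
  by near: z; exact: lt_nbhsl.
- rewrite {2}/flat_exp x0.
  apply: (@near_eq_is_derive _ _ _ ((horner P \o (fun z => z^-1)) * (expR \o -%R \o (fun z => z^-1)))).
    near=> z; rewrite /flat_exp ifT//.
    by near: z; exact: lt_nbhsr.
  have xn0 : x != 0 by rewrite gt_eqF.
  have dV : is_derive x 1 (fun z : R => z^-1) (- x ^- 2).
    have := @is_deriveV R id x 1 1 xn0 (is_derive_id _ _).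
    by rewrite /GRing.scale/= mulr1.
  have d1 := is_derive1_comp (is_derive_poly P (x^-1)) dV.
  have dN : is_derive x 1 (-%R \o (fun z : R => z^-1)) (- (- x ^- 2)).
    exact: is_deriveN.
  have d2 := @is_derive1_comp _ expR (-%R \o (fun z : R => z^-1)) x _ _ (is_derive_expR (- x^-1)) dN.
  have d3 := is_deriveM d1 d2.
  apply: (is_derive_eq d3).
  rewrite /GRing.scale/= hornerM hornerXn hornerD hornerN -exprVn; ring.
- have [K hK] := flat_exp_bound ('X * P).
  have lim0 : (fun h : R => h^-1 *: (flat_exp P (h *: 1 + 0) - flat_exp P 0)) @ 0^' --> (0 : R).
    rewrite [X in X @ _ --> _](_ : _ = flat_exp ('X * P)); last first.
      apply/funext => h; rewrite /flat_exp ltxx subr0 addr0 /GRing.scale/= mulr1.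
      by case: ifPn; rewrite ?mulr0// hornerM hornerX mulrA.
    have c0 : (fun h : R => K * `|h|) @ 0^' --> (0 : R).
      have : (fun h : R => K * `|h|) @ (0 : R) --> (K * `|0 : R|).
        by apply: cvgM; [exact: cst_continuous|exact: norm_continuous].
      by rewrite normr0 mulr0; apply: cvg_trans; apply: cvg_app; exact: nbhs_dnbhs.
    apply/norm_cvg0P; apply: (squeeze_cvgr _ (@cvg_cst _ 0 _ _ _) c0).
    by apply: nearW => h; rewrite normr_ge0 hK.
  rewrite {2}/flat_exp ltxx; apply: DeriveDef; first by apply/cvg_ex; exists 0.
  by rewrite /derive; exact/cvg_lim.
Unshelve. all: by end_near. Qed.

Definition flat (x : R) : R := flat_exp 1 x.

Lemma smooth1_flat : smooth1 flat.
Proof.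
exists (fun n => flat_exp (iter n (fun P => 'X^2 * (P - P^`())) 1)); split=> //.
by move=> n t; exact: is_derive_flat_exp.
Qed.

Lemma flat_pos x : 0 < x -> flat x = expR (- x^-1).
Proof. by move=> x0; rewrite /flat /flat_exp x0 hornerC mul1r. Qed.

Lemma flat_npos x : x <= 0 -> flat x = 0.
Proof. by move=> x0; rewrite /flat /flat_exp ltNge x0. Qed.

Lemma flat_ge0 x : 0 <= flat x.
Proof.
by have [/flat_pos ->|/flat_npos ->//] := ltP 0 x; exact: expR_ge0.
Qed.

Lemma flat_le1 x : flat x <= 1.
Proof.
have [x0|/flat_npos ->//] := ltP 0 x.
by rewrite flat_pos// -[leRHS]expR0 ler_expR oppr_le0 invr_ge0 ltW.
Qed.

(** The product of [flat] at [(k+1)(t - a)] and at [(k+1)(b - t)]. With values in [0, 1], it tends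
    pointwise to the indicator of the open interval as k grows, ready for dominated convergence. *)
Definition itv_bump (a b : R) (k : nat) (t : R) : R :=
  flat (k.+1%:R * t + - (k.+1%:R * a)) * flat (- k.+1%:R * t + k.+1%:R * b).

Lemma smooth1_itv_bump a b k : smooth1 (itv_bump a b k).
Proof. by apply: smooth1M; apply: smooth1_affine; exact: smooth1_flat. Qed.

Lemma itv_bump_ge0 a b k t : 0 <= itv_bump a b k t.
Proof. by rewrite mulr_ge0// flat_ge0. Qed.

Lemma itv_bump_le1 a b k t : itv_bump a b k t <= 1.
Proof. by rewrite mulr_ile1 ?flat_ge0 ?flat_le1. Qed.

Lemma itv_bump_out a b k t : ~~ (a < t < b) -> itv_bump a b k t = 0.
Proof.
rewrite negb_and -!leNgt => /orP[ta|bt]; rewrite /itv_bump.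
  by rewrite (flat_npos (_ : k.+1%:R * t + _ <= 0)) ?mul0r// subr_le0 ler_wpM2l.
by rewrite (flat_npos (_ : - k.+1%:R * t + _ <= 0)) ?mulr0// mulNr addrC subr_le0 ler_wpM2l.
Qed.

Lemma cvg_flat (x : R) : 0 < x -> (fun k => flat (k.+1%:R * x)) @ \oo --> (1 : R).
Proof.
move=> x0; rewrite (_ : (fun k => _) = expR \o (fun k => - (x^-1 * k.+1%:R^-1))); last first.
  by apply/funext => k; rewrite flat_pos ?mulr_gt0// invfM mulrC.
rewrite -[X in _ --> X]expR0; apply: continuous_cvg; first exact: continuous_expR.
rewrite -[X in _ --> X]oppr0 -[X in _ --> - X](mulr0 x^-1); apply: cvgN; apply: cvgM; first exact: cvg_cst.
exact: cvg_harmonic.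
Qed.

Lemma cvg_itv_bump a b t : (fun k => itv_bump a b k t) @ \oo --> ((a < t < b)%R%:R : R).
Proof.
have [/andP[ta tb]|tab] := boolP (a < t < b); last first.
  by under eq_fun do rewrite itv_bump_out//; exact: cvg_cst.
rewrite -[X in _ --> X]mulr1.
have -> : (fun k => itv_bump a b k t) = (fun k => flat (k.+1%:R * (t - a)) * flat (k.+1%:R * (b - t))).
  by apply/funext => k; rewrite /itv_bump !mulrBr mulNr [- _ + _]addrC.
by apply: cvgM; apply: cvg_flat; rewrite subr_gt0.
Qed.

End smooth_bumps.

(** * Smooth bumps on boxes *)

Section box_bumps.
Context {R : realType} {n : nat}.

Lemma is_derive_from_line (f : 'rV[R]_n -> R) (x : 'rV[R]_n) i (d : R) :
  is_derive (x ord0 i : R) 1 (fun s => f (upd x i s)) d ->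
  is_derive x (delta_mx ord0 i) f d.
Proof.
move=> [df dE].
have e : (fun h : R => h^-1 *: (f (h *: delta_mx ord0 i + x) - f x)) =
    (fun h => h^-1 *: (f (upd x i (h *: 1 + x ord0 i)) - f (upd x i (x ord0 i)))).
  apply/funext => h; rewrite -{1}(upd_id x i) shift_upd upd_id.
  by rewrite /GRing.scale/= mulr1.
by apply: DeriveDef; rewrite /derivable ?/derive e.
Qed.

Section tensor_product.
Variable H : 'I_n -> nat -> R -> R.
Hypothesis dH : forall i m (t : R), is_derive t 1 (H i m) (H i m.+1 t).

Let tens (k : 'I_n -> nat) (x : 'rV[R]_n) := \prod_i H i (k i) (x ord0 i).

Let is_derive_tens k j x : is_derive x (delta_mx ord0 j) (tens k)
  (tens (fun i => (j == i) + k i)%N x).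
Proof.
apply: is_derive_from_line.
pose c := \prod_(i | i != j) H i (k i) (x ord0 i).
have -> : (fun s => tens k (upd x j s)) = c \*: H j (k j).
  apply/funext => s; rewrite /tens (bigD1 j)//= mxE eqxx mulrC; congr (_ * _).
  by apply: eq_bigr => i ij; rewrite mxE (negbTE ij).
have -> : tens (fun i => (j == i) + k i)%N x = c *: H j (k j).+1 (x ord0 j).
  rewrite /tens (bigD1 j)//= eqxx add1n mulrC; congr (_ * _).
  by apply: eq_bigr => i; rewrite eq_sym => /negbTE ->.
have := dH j (k j) (x ord0 j) => d; exact: is_deriveZ.
Qed.

Let continuous_tens k : continuous (tens k).
Proof.
apply: continuous_big => [|i _ x]; first exact: mul_continuous.
apply: (@continuous_comp _ _ _ (fun x : 'rV[R]_n => x ord0 i) (H i (k i))).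
  exact: coord_continuous.
exact: (is_derive_continuous (dH i (k i))).
Qed.

(** Every iterated partial derivative is again a tensor product: the i-th factor is differentiated
    as often as i occurs in the list. *)
Lemma smooth_tensor : smooth (fun x => \prod_i H i 0 (x ord0 i)).
Proof.
move=> s; have -> : foldr partial (fun x => \prod_i H i 0 (x ord0 i)) s =
    tens (fun i => count_mem i s).
  elim: s => // j s IH; apply/funext => x /=; rewrite IH.
  by rewrite /partial; apply: derive_val.
split; first exact: continuous_tens.
by move=> i x; case: (is_derive_tens (fun i => count_mem i s) i x).
Qed.

End tensor_product.

Definition open_box (a b : 'I_n -> R) : set 'rV[R]_n :=
  [set x | forall i, a i < x ord0 i < b i].

Definition closed_box_itv (a b : 'I_n -> R) : set 'rV[R]_n :=
  [set x | forall i, a i <= x ord0 i <= b i].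

Definition box_bump (a b : 'I_n -> R) (k : nat) (x : 'rV[R]_n) : R :=
  \prod_i itv_bump (a i) (b i) k (x ord0 i).

Lemma measurable_open_box a b : measurable (open_box a b).
Proof.
rewrite (_ : open_box a b = \bigcap_(i in [set: 'I_n]) (rV_coord i @^-1` `]a i, b i[%classic)).
  apply: fin_bigcap_measurable; first exact: finite_finset.
  move=> i _; rewrite -[X in measurable X]setTI.
  by apply: measurable_rV_coord => //; exact: measurable_itv.
apply/seteqP; split=> x h i => [_|]; first by rewrite /= in_itv/=; exact: h.
by have := h i I; rewrite /= in_itv.
Qed.

Lemma test_function_box_bump (Omega : set 'rV[R]_n) a b k :
  closed_box_itv a b `<=` Omega -> test_function Omega (box_bump a b k).
Proof.
move=> abO; split.
  have /choice[H hH] : forall i : 'I_n, exists H : nat -> R -> R,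
      H 0 = itv_bump (a i) (b i) k /\ forall m (t : R), is_derive t 1 (H m) (H m.+1 t).
    by move=> i; exact: smooth1_itv_bump.
  rewrite (_ : box_bump a b k = (fun x => \prod_i H i 0 (x ord0 i))).
    by apply: smooth_tensor => i; case: (hH i).
  by apply/funext => x; apply: eq_bigr => i _; case: (hH i) => ->.
exists (closed_box_itv a b); split => //.
  rewrite (_ : closed_box_itv a b = [set x | forall i, `[a i, b i]%classic (x ord0 i)]).
    by apply: (@rV_compact _ _ (fun i => `[a i, b i]%classic)) => i; exact: segment_compact.
  by apply/seteqP; split=> x h i; have := h i; rewrite /= in_itv.
move=> x /existsNP[i hi]; rewrite /box_bump (bigD1 i)//= itv_bump_out ?mul0r//.
by apply/negP => /andP[/ltW ax /ltW xb]; apply: hi; rewrite ax.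
Qed.

Lemma box_bump_ge0 a b k x : 0 <= box_bump a b k x.
Proof. by apply: prodr_ge0 => i _; exact: itv_bump_ge0. Qed.

Lemma box_bump_le1 a b k x : box_bump a b k x <= 1.
Proof.
by apply: (@prodr_ile1 R) => i _; rewrite itv_bump_ge0 itv_bump_le1.
Qed.

Lemma cvg_box_bump a b x : (fun k => box_bump a b k x) @ \oo --> (\1_(open_box a b) x : R).
Proof.
have -> : \1_(open_box a b) x = \prod_i ((a i < x ord0 i < b i)%R%:R : R).
  rewrite indicE; have [xab|xab] := boolP (x \in open_box a b).
    by move: xab; rewrite inE => xab; rewrite big1// => i _; rewrite xab.
  move: xab; rewrite notin_setE => /existsNP[i /negP hi].
  by rewrite (bigD1 i)//= (negbTE hi) mul0r.
apply: cvg_big; first exact: mul_continuous.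
by move=> i _; exact: cvg_itv_bump.
Qed.

End box_bumps.

(** * The fundamental lemma of the calculus of variations *)

Section fundamental_lemma.
Context {R : realType} {n : nat}.
Local Notation mu := (@lebesgue_rV R n).
Variables (Omega : set 'rV[R]_n) (h : 'rV[R]_n -> R).
Hypotheses (oOmega : open Omega) (ih : mu.-integrable Omega (EFin \o h)).
Hypothesis h0 : forall phi, test_function Omega phi ->
  \int[mu]_(x in Omega) (h x * phi x) = 0.

Let mO : measurable Omega := open_measurable_rV oOmega.
Let mh : measurable_fun Omega h.
Proof. by case/integrableP : ih => /measurable_EFinP. Qed.

Lemma test_function_measurable phi : test_function Omega phi -> measurable_fun setT phi.
Proof. by move=> [/(_ [::])[/= c _] _]; exact: continuous_measurable_rV. Qed.

Let integral_open_box a b : closed_box_itv a b `<=` Omega ->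
  (\int[mu]_(x in Omega `&` open_box a b) (h x)%:E = 0)%E.
Proof.
move=> abO.
pose f_ k x := (h x * box_bump a b k x)%:E.
pose f x := (h x * \1_(open_box a b) x)%:E.
have mb k : measurable_fun Omega (box_bump a b k).
  by apply: measurable_funTS; exact: test_function_measurable (test_function_box_bump k abO).
have mf_ k : measurable_fun Omega (f_ k).
  by apply/measurable_EFinP; exact: measurable_funM.
have mf : measurable_fun Omega f.
  apply/measurable_EFinP; apply: measurable_funM => //.
  by apply: measurable_indic; exact: measurable_open_box.
have cv : {ae mu, forall x, Omega x -> f_ ^~ x @ \oo --> f x}.
  apply: aeW => x _; apply: cvg_EFin; first exact: nearW.
  by apply: cvgM; [exact: cvg_cst|exact: cvg_box_bump].
have dom : {ae mu, forall x k, Omega x -> `|f_ k x| <= (abse \o (EFin \o h)) x}%E.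
  apply: aeW => x k _; rewrite /f_ /= lee_fin normrM (ger0_norm (box_bump_ge0 _ _ _ _)).
  by rewrite ler_piMr// box_bump_le1.
have [_ _] := dominated_convergence mO mf_ mf cv (integrable_abse ih) dom.
have -> : [sequence (\int[mu]_(x in Omega) f_ k x)%E]_k = cst 0%E.
  apply/funext => k /=; have := h0 (test_function_box_bump k abO).
  rewrite -EFin_Rintegral//; first by move=> ->.
  apply: le_integrable ih => //; first exact: mf_.
  move=> x _; rewrite /= lee_fin normrM.
  by rewrite (ger0_norm (box_bump_ge0 _ _ _ _)) ler_piMr// box_bump_le1.
move=> cvf; have <- : (\int[mu]_(x in Omega) f x = 0)%E.
  by rewrite -(cvg_lim (@ereal_hausdorff R) cvf) lim_cst.
rewrite integral_mkcondr; apply: eq_integral => x _.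
by rewrite /f patchE indicE; case: (_ \in _); rewrite ?mulr1 ?mulr0.
Qed.

(** Orthants are stable under intersection and generate the sigma-algebra; moreover a cube meets an
    orthant in an open box. *)
Definition orthant (c : 'I_n -> R) : set 'rV[R]_n := [set x | forall i, c i < x ord0 i].

Let orthants := [set A : set 'rV[R]_n | exists c, A = orthant c].

Let measurable_orthant c : measurable (orthant c).
Proof.
rewrite (_ : orthant c = \bigcap_(i in [set: 'I_n]) (rV_coord i @^-1` `]c i, +oo[%classic)).
  apply: fin_bigcap_measurable; first exact: finite_finset.
  move=> i _; rewrite -[X in measurable X]setTI.
  by apply: measurable_rV_coord => //; exact: measurable_itv.
apply/seteqP; split=> x hx i => [_|]; first by rewrite /= in_itv/= andbT; exact: hx.
by have := hx i I; rewrite /= in_itv/= andbT.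
Qed.

Let measurable_orthants : @measurable _ 'rV[R]_n = <<s orthants >>.
Proof.
apply/seteqP; split; last first.
  apply: smallest_sub; first exact: sigma_algebra_measurable.
  by move=> _ [c ->]; exact: measurable_orthant.
suff coord (i : 'I_n) (B : set (measurableTypeR R)) : measurable B ->
    <<s orthants >> (rV_coord i @^-1` B).
  apply: smallest_sub; first exact: smallest_sigma_algebra.
  rewrite -bigcup_seq/=; apply: bigcup_sub => i _ _ [B mB <-].
  by rewrite setTI; exact: coord.
move=> mB.
suff : measurable_fun [set: g_sigma_algebraType orthants] (rV_coord i : g_sigma_algebraType orthants -> _).
  by move=> /(_ measurableT B mB); rewrite setTI.
apply: (measurability _ (RGenOInfty.measurableE R)).
move=> _ [_ [t ->] <-]; rewrite setTI.
rewrite (_ : _ @^-1` _ = \bigcup_k orthant (fun j => if j == i then t else - k%:R)).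
  by apply: bigcupT_measurable => k; apply: sub_sigma_algebra; eexists.
apply/seteqP; split=> [x|x [k _]] /=; rewrite /rV_coord in_itv/= andbT; last first.
  by move=> /(_ i); rewrite eqxx.
move=> tx; have [k hk] : exists k, forall j, - x ord0 j < k%:R.
  exists (Num.truncn (\big[Num.max/0]_j `|x ord0 j|)).+1 => j.
  apply: le_lt_trans (truncnS_gt _); apply: le_trans (_ : `|x ord0 j| <= _).
    by rewrite -normrN ler_norm.
  exact: (le_bigmax _ (fun j => `|x ord0 j|)).
exists k => // j; case: eqP => [->//|_].
by rewrite ltrNl.
Qed.

(** The intersection is an open box whose closed version stays in the ball of doubled radius, hence
    in Omega, so bumps on it are test functions. *)
Let integral_orthant (q : 'rV[R]_n) r c : 0 < r -> ball q (2 * r) `<=` Omega ->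
  (\int[mu]_(x in ball q r `&` orthant c) (h x)%:E = 0)%E.
Proof.
move=> r0 qO.
pose a i := Num.max (c i) (q ord0 i - r); pose b i := q ord0 i + r.
have -> : ball q r `&` orthant c = Omega `&` open_box a b.
  apply/seteqP; split=> x.
    move=> [qx cx]; split; first by apply: qO; apply: le_ball qx; lra.
    move=> i; rewrite /a /b gt_max cx/=; move/(ball_rVP _ _ r0) : qx => /(_ i).
    by rewrite ltr_distlC => /andP[-> ->].
  move=> [_ abx]; split.
    apply/(ball_rVP _ _ r0) => i; have := abx i; rewrite /a /b gt_max ltr_distlC.
    by move=> /andP[/andP[_ ->] ->].
  by move=> i; have := abx i; rewrite gt_max => /andP[/andP[]].
apply: integral_open_box => x abx; apply: qO.
have r2 : 0 < 2 * r by rewrite mulr_gt0.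
apply/(ball_rVP _ _ r2) => i; have := abx i; rewrite /a /b ge_max ltr_distlC.
by move=> /andP[/andP[_ h1] h2]; apply/andP; split; lra.
Qed.

(** Dynkin's pi-lambda argument. The case of the whole space is that of an orthant containing the
    ball, and complements are obtained by difference from it. *)
Let integral_ball (q : 'rV[R]_n) r A : 0 < r -> ball q (2 * r) `<=` Omega ->
  measurable A -> (\int[mu]_(x in ball q r `&` A) (h x)%:E = 0)%E.
Proof.
move=> r0 qO.
have mQ : measurable (ball q r) by exact: measurable_ball_rV.
have QO : ball q r `<=` Omega by apply: subset_trans qO; apply: le_ball; lra.
have ihS B : measurable B -> B `<=` Omega -> mu.-integrable B (EFin \o h).
  by move=> mB BO; exact: integrableS ih.
rewrite measurable_orthants => sA.
apply: (dynkin_induction (P := fun A => \int[mu]_(x in ball q r `&` A) (h x)%:E = 0)%E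
  measurable_orthants) sA.
- move=> _ _ [c ->] [d ->]; exists (fun i => Num.max (c i) (d i)).
  apply/seteqP; split=> x; first by move=> [cx dx] i; rewrite gt_max cx dx.
  by move=> hx; split=> i; have := hx i; rewrite gt_max => /andP[].
- have -> : ball q r `&` setT = ball q r `&` orthant (fun i => q ord0 i - r).
    rewrite setIT; apply/seteqP; split=> x; last by case.
    move=> qx; split=> // i; move/(ball_rVP _ _ r0) : qx => /(_ i).
    by rewrite ltr_distlC => /andP[].
  exact: integral_orthant.
- by move=> _ [c ->]; exact: integral_orthant.
- move=> S mS S0.
  have QT : (\int[mu]_(x in ball q r) (h x)%:E = 0)%E.
    rewrite (_ : ball q r = ball q r `&` orthant (fun i => q ord0 i - r)); first exact: integral_orthant.
    apply/seteqP; split=> x; last by case.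
    move=> qx; split=> // i; move/(ball_rVP _ _ r0) : qx => /(_ i).
    by rewrite ltr_distlC => /andP[].
  move: QT; rewrite -{1}(setUIDK (ball q r) S) integral_setU//.
  + by rewrite S0 add0e setDE.
  + exact: measurableI.
  + exact: measurableD.
  + by rewrite setUIDK; case/integrableP: (ihS _ mQ QO).
  + by apply/disj_setPS => x [[_ Sx] [_ +]].
- move=> F mF tF F0; rewrite setI_bigcupr integral_bigcup//.
  + by apply: eseries0 => k _ _; exact: F0.
  + exact: trivIset_setIl.
  + by move=> k; exact: measurableI.
  + apply: ihS; first by apply: bigcupT_measurable => k; exact: measurableI.
    by apply: bigcup_sub => k _ x [/QO].
Qed.

(** On a small cube all integrals of [h] over measurable subsets vanish, so [h = 0] almost
    everywhere there; countably many rational cubes cover Omega. *)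
Lemma fundamental_lemma : h = (fun=> 0) %[ae mu in Omega].
Proof.
pose Q (p : 'rV[rat]_n * nat) : set 'rV[R]_n := ball (rat_center p) (rat_radius p).
pose good (p : 'rV[rat]_n * nat) := ball (@rat_center R n p) (2 * rat_radius p) `<=` Omega.
have aeQ p : good p -> {ae mu, forall x, Q p x -> h x = 0}.
  move=> gp; have r0 := @rat_radius_gt0 R n p.
  have mQ : measurable (Q p) by exact: measurable_ball_rV.
  have QO : Q p `<=` Omega by apply: subset_trans gp; apply: le_ball; lra.
  have : ae_eq mu (Q p) (EFin \o h) (cst 0%E).
    apply: integral_ae_eq => //; first exact: integrableS ih.
    move=> E EQ mE; rewrite integral0 -(integral_ball r0 gp mE).
    by rewrite setIC (setIidl EQ).
  by apply: filterS => x + Qx => /(_ Qx) -[].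
pose N k := if unpickle k is Some p then
   if `[< good p >] then [set x | ~ (Q p x -> h x = 0)] else set0 else set0.
have : mu.-negligible (\bigcup_k N k).
  apply: negligible_bigcup => k; rewrite /N; case: unpickle => [p|]; last exact: negligible_set0.
  by case: ifPn => [/asboolP/aeQ|_]; [|exact: negligible_set0].
apply: negligibleS => x; apply: contra_notP => hx /= Ox.
have [p [px pO]] := open_rat_ball oOmega Ox.
apply: contra_notP hx => hx0; exists (pickle p) => //.
by rewrite /N pickleK ifT; [move=> /(_ px)|exact/asboolP].
Qed.

End fundamental_lemma.

(** * Weak gradients and the space H_0^1 *)

Section square_integrable_Lp.
Context {R : realType} {n : nat}.
Local Notation mu := (@lebesgue_rV R n).
Variable Omega : set 'rV[R]_n.
Hypothesis mO : measurable Omega.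

Lemma Lp2P u : Lp 2%:E Omega u <-> sqint mu Omega u.
Proof.
split=> [h|[mu_ iu]].
  have := Lfun2_integrable_sqr h.
  move: h; rewrite /Lp inE => /andP[/[!inE]/= mu_ _] h.
  have mu' : measurable_fun Omega u by apply/measurable_restrictT.
  apply: sqintP => //; apply/(integrable_mkcond _ mO).
  rewrite (_ : _ \_ Omega = EFin \o (fun x => (u \_ Omega) x ^+ 2))//.
  by apply/funext => x; rewrite /= !patchE; case: ifP => //; rewrite expr0n.
rewrite /Lp inE; apply/andP; split.
  by rewrite inE/=; apply/(measurable_restrictT u mO).
rewrite inE/= /finite_norm unlock; apply: poweR_lty; apply: le_lt_trans iu.
rewrite [leRHS]integral_mkcond le_eqVlt; apply/orP; left; apply/eqP.
apply: eq_integral => x _ /=; rewrite powR_mulrn// patchE [in RHS]patchE.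
by case: ifP => _; rewrite real_normK ?num_real// expr0n.
Qed.

Lemma sqint_subset f : sqint mu setT f -> sqint mu Omega f.
Proof.
move=> [mf fi]; split; first exact: measurable_funTS.
apply: le_lt_trans fi; apply: ge0_subset_integral => //.
- by apply/measurable_EFinP; exact: measurable_funX.
- by move=> x _; rewrite lee_fin sqr_ge0.
Qed.

End square_integrable_Lp.

Lemma continuous_add (R : realType) (T : topologicalType) (f g : T -> R) :
  continuous f -> continuous g -> continuous (fun x => f x + g x).
Proof. by move=> cf cg x; exact: (@cvgD _ _ _ _ _ f g _ _ (cf x) (cg x)). Qed.

Lemma continuous_mul (R : realType) (T : topologicalType) (f g : T -> R) :
  continuous f -> continuous g -> continuous (fun x => f x * g x).
Proof. by move=> cf cg x; exact: (@cvgM _ _ _ _ f g _ _ (cf x) (cg x)). Qed.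

(** * Test functions and integration by parts *)

Section test_functions.
Context {R : realType} {n : nat}.
Local Notation mu := (@lebesgue_rV R n).
Implicit Types (phi psi : 'rV[R]_n -> R).

Lemma foldr_partial_lin phi psi c s : smooth phi -> smooth psi ->
  foldr partial (fun x => phi x + c * psi x) s =
  (fun x => foldr partial phi s x + c * foldr partial psi s x).
Proof.
move=> sp sq; elim: s => // i s IH /=; rewrite IH; apply/funext => x.
have dp := (sp s).2 i x; have dq := (sq s).2 i x.
rewrite /partial -[LHS]/('D_(delta_mx ord0 i) (foldr partial phi s + c \*: foldr partial psi s) x).
by rewrite deriveD//; [rewrite deriveZ|exact: derivableZ].
Qed.

Lemma smooth_lin phi psi c : smooth phi -> smooth psi ->
  smooth (fun x => phi x + c * psi x).
Proof.
move=> sp sq s; rewrite foldr_partial_lin//; split=> [x|i x].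
  have [c1 _] := sp s; have [c2 _] := sq s.
  exact: (@cvgD _ _ _ _ _ (foldr partial phi s) (fun x => c * foldr partial psi s x) _ _
    (c1 x) (@cvgM _ _ _ _ (fun=> c) _ c _ (@cst_continuous _ _ c x) (c2 x))).
rewrite -[X in derivable X]/(foldr partial phi s + c \*: foldr partial psi s).
by apply: derivableD; [exact: (sp s).2|apply: derivableZ; exact: (sq s).2].
Qed.

Lemma smooth_continuous phi : smooth phi -> continuous phi.
Proof. by move=> /(_ [::])[]. Qed.

Lemma smooth_derivable phi : smooth phi -> forall i x, derivable phi x (delta_mx ord0 i).
Proof. by move=> /(_ [::])[]. Qed.

Lemma smooth_partial_continuous phi : smooth phi -> forall i, continuous (partial i phi).
Proof. by move=> sp i; have [] := sp [:: i]. Qed.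

Lemma gradient_lin phi psi c x : smooth phi -> smooth psi ->
  gradient (fun x => phi x + c * psi x) x = gradient phi x + c *: gradient psi x.
Proof.
move=> sp sq; apply/rowP => i; rewrite !mxE.
have /= := foldr_partial_lin c [:: i] sp sq.
by move=> /(congr1 (fun f => f x)).
Qed.

Variable Omega : set 'rV[R]_n.
Hypothesis oO : open Omega.
Variable M : R.
Hypotheses (M0 : 0 < M) (OM : Omega `<=` box M).

Let mO : measurable Omega := open_measurable_rV oO.

Lemma test0 : test_function Omega (fun=> 0).
Proof.
split; last by exists set0; split => //; exact: compact0.
have e s : foldr partial (fun=> 0 : R) s = (fun _ : 'rV[R]_n => 0 : R).
  elim: s => // i s /= ->; apply/funext => x.
  by rewrite /partial; apply: derive_val.
by move=> s; rewrite e; split=> [|i x]; [exact: cst_continuous|exact: derivable_cst].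
Qed.

Lemma test_lin phi psi c : test_function Omega phi -> test_function Omega psi ->
  test_function Omega (fun x => phi x + c * psi x).
Proof.
move=> [sp [K [cK KO K0]]] [sq [L [cL LO L0]]]; split; first exact: smooth_lin.
exists (K `|` L); split; first exact: compactU.
  by move=> x [/KO|/LO].
by move=> x /not_orP[Kx Lx]; rewrite K0// L0// mulr0 addr0.
Qed.

Section one_test_function.
Variable phi : 'rV[R]_n -> R.
Hypothesis tp : test_function Omega phi.

Lemma test_out x : ~ Omega x -> phi x = 0.
Proof. by case: tp => _ [K [_ KO K0]] Ox; apply: K0 => /KO. Qed.

Lemma test_partial_out i x : ~ Omega x -> partial i phi x = 0.
Proof.
case: tp => _ [K [cK KO K0]] Ox; apply: (@partial_outside _ _ K) => //.
  by apply: compact_closed => //; exact: norm_hausdorff.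
by move=> /KO.
Qed.

Lemma test_continuous : continuous phi.
Proof. by apply: smooth_continuous; case: tp. Qed.

Lemma test_partial_continuous i : continuous (partial i phi).
Proof. by apply: smooth_partial_continuous; case: tp. Qed.

Lemma test_derivable i x : derivable phi x (delta_mx ord0 i).
Proof. by apply: smooth_derivable; case: tp. Qed.

Lemma test_supported : supported M phi.
Proof. by move=> x; apply: contra_neqP => Mx; apply: test_out => /OM. Qed.

Lemma test_partial_supported i : supported M (partial i phi).
Proof. exact: supported_partial test_supported. Qed.

Lemma test_sqint : sqint mu Omega phi.
Proof. by apply: sqint_subset => //; exact: supported_sqint test_continuous test_supported. Qed.

Lemma test_partial_sqint i : sqint mu Omega (partial i phi).
Proof.
apply: sqint_subset => //.
exact: supported_sqint (@test_partial_continuous i) (@test_partial_supported i).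
Qed.

End one_test_function.

Lemma Rintegral_out (F : 'rV[R]_n -> R) : (forall x, ~ Omega x -> F x = 0) ->
  \int[mu]_(x in Omega) F x = \int[mu]_x F x.
Proof.
move=> F0; rewrite Rintegral_mkcond; apply: eq_Rintegral => x _.
by rewrite patchE; case: ifPn => //; rewrite notin_setE => /F0.
Qed.

(** The sum of the two integrands is the derivative of [phi * psi] along each line in direction i,
    so its integral along every such line is 0. *)
Lemma test_integration_by_parts phi psi i :
  test_function Omega phi -> test_function Omega psi ->
  \int[mu]_(x in Omega) (phi x * partial i psi x) =
  - \int[mu]_(x in Omega) (partial i phi x * psi x).
Proof.
move=> tp tq; apply/eqP; rewrite -subr_eq0 opprK; apply/eqP.
rewrite -RintegralD//; last 2 first.
- by apply: sqint_mul => //; [exact: test_sqint|exact: test_partial_sqint].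
- by apply: sqint_mul => //; [exact: test_partial_sqint|exact: test_sqint].
rewrite Rintegral_out; last first.
  by move=> x Ox; rewrite (test_out tp)// mul0r add0r (test_out tq)// mulr0.
pose F x := phi x * partial i psi x + partial i phi x * psi x.
have cF : continuous F.
  apply: continuous_add; apply: continuous_mul.
  - exact: test_continuous.
  - exact: test_partial_continuous.
  - exact: test_partial_continuous.
  - exact: test_continuous.
have sF : supported M F.
  move=> x; apply: contra_neqP => Mx.
  have Ox : ~ Omega x by move=> /OM.
  by rewrite /F (test_out tp)// mul0r add0r (test_out tq)// mulr0.
rewrite /Rintegral (@integral_lines_eq0 _ _ i M F cF sF)// => x.
have M1 : 0 < M + 1 by rewrite addr_gt0.
have cl (f : 'rV[R]_n -> R) : continuous f -> continuous (fun t : R => f (upd x i t)).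
  by move=> cf; apply: continuous_comp_rV; [exact: cf|exact: continuous_upd].
apply: (@integral_derive_eq0 _ (fun t => phi (upd x i t) * psi (upd x i t)) _ (M + 1)) => //.
- move=> t.
  have d1 := is_derive_line (@test_derivable _ tp i) x t.
  have d2 := is_derive_line (@test_derivable _ tq i) x t.
  have d3 := is_deriveM d1 d2; apply: (is_derive_eq d3).
  by rewrite /F /GRing.scale/= [psi _ * _]mulrC.
- exact: cl cF.
- move=> t Mt; rewrite (supported_upd (test_supported tp)) ?mul0r//.
  by apply: lt_le_trans Mt; rewrite ltrDl.
Qed.

Lemma test_weak_gradient phi : test_function Omega phi ->
  is_weak_gradient Omega phi (gradient phi).
Proof.
move=> tp; split=> [i|psi i tq].
  apply/Lp2P => //; under eq_fun do rewrite mxE; exact: test_partial_sqint.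
rewrite test_integration_by_parts//; congr (- _).
by apply: eq_Rintegral => x _; rewrite mxE.
Qed.

End test_functions.

(** Passage to the limit along the sequences of rate [4^-n]: the weak gradient identity and the
    Euler-Lagrange equation are both obtained this way. *)
Lemma geometric_eq0 (R : realType) (d B : R) : (forall n, d ^+ 2 <= B / 4 ^+ n) -> d = 0.
Proof.
move=> h; apply/eqP; rewrite -sqrf_eq0 eq_le sqr_ge0 andbT.
have c : (fun n => B / 4 ^+ n) @ \oo --> (0 : R).
  rewrite (_ : (fun n => _) = geometric B (4^-1)); last by apply/funext => n /=; rewrite exprVn.
  by apply: cvg_geometric; rewrite ger0_norm; lra.
rewrite -(cvg_lim (@Rhausdorff R) c); apply: limr_ge; first by apply/cvg_ex; exists 0.
exact: nearW.
Qed.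

Lemma funB_mulN1r (R : realType) (n : nat) (u v : 'rV[R]_n -> R) :
  (fun x => u x - v x) = (fun x => u x + (-1) * v x).
Proof. by apply/funext => x; rewrite mulN1r. Qed.

Lemma funB_scaleN1r (R : realType) (n : nat) (g h : 'rV[R]_n -> 'rV[R]_n) :
  (fun x => g x - h x) = (fun x => g x + (-1) *: h x).
Proof. by apply/funext => x; rewrite scaleN1r. Qed.

Section weak_gradients.
Context {R : realType} {n : nat}.
Local Notation mu := (@lebesgue_rV R n).
Variable Omega : set 'rV[R]_n.
Hypothesis oO : open Omega.
Variable M : R.
Hypotheses (M0 : 0 < M) (OM : Omega `<=` box M).
Local Notation ipO := (ip mu Omega).
Local Notation L2 := (sqint mu Omega).
Local Notation WG := (is_weak_gradient Omega).
Implicit Types (u v phi psi : 'rV[R]_n -> R) (g h k : 'rV[R]_n -> 'rV[R]_n).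

Let mO : measurable Omega := open_measurable_rV oO.

Definition vsqint g := forall i, L2 (fun x => g x ord0 i).
Definition vip g h := \int[mu]_(x in Omega) dot (g x) (h x).

Lemma finite_Omega : (mu Omega < +oo)%E.
Proof.
apply: le_lt_trans (lebesgue_box_fin M).
by apply: le_measure OM; rewrite inE//; exact: measurable_box.
Qed.

Lemma sqint_cst (c : R) : L2 (fun=> c).
Proof. by apply: (@sqint_bounded _ _ _ _ _ _ `|c|) => //; exact: finite_Omega. Qed.

Lemma sqint_integrable u : L2 u -> mu.-integrable Omega (EFin \o u).
Proof.
move=> Lu; have := sqint_mul mO Lu (sqint_cst 1).
by under eq_fun do rewrite mulr1.
Qed.

Lemma vipE g h : vsqint g -> vsqint h ->
  vip g h = \sum_i ipO (fun x => g x ord0 i) (fun x => h x ord0 i).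
Proof. by move=> Lg Lh; rewrite /vip /dot Rintegral_sum// => i; exact: sqint_mul. Qed.

Lemma dot_integrable g h : vsqint g -> vsqint h ->
  mu.-integrable Omega (EFin \o (fun x => dot (g x) (h x))).
Proof. by move=> Lg Lh; apply: integrable_Rsum => // i; exact: sqint_mul. Qed.

Lemma vsqint_lin c g h : vsqint g -> vsqint h -> vsqint (fun x => g x + c *: h x).
Proof.
move=> Lg Lh i; under eq_fun do rewrite !mxE.
by apply: sqintD => //; exact: sqintZ.
Qed.

Lemma vipC g h : vip g h = vip h g.
Proof. by apply: eq_Rintegral => x _; apply: eq_bigr => i _; rewrite mulrC. Qed.

Lemma vip_ge0 g : 0 <= vip g g.
Proof.
by apply: Rintegral_ge0 => x _; apply: sumr_ge0 => i _; rewrite -expr2 sqr_ge0.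
Qed.

Lemma vip_lin c g h k : vsqint g -> vsqint h -> vsqint k ->
  vip (fun x => g x + c *: h x) k = vip g k + c * vip h k.
Proof.
move=> Lg Lh Lk; have Lgh := vsqint_lin c Lg Lh.
rewrite !vipE// mulr_sumr -big_split/=; apply: eq_bigr => i _.
under eq_fun do rewrite !mxE.
have Lch := sqintZ mO c (Lh i).
by rewrite ipDl// ipZl.
Qed.

Lemma ip_lin c u v w : L2 u -> L2 v -> L2 w ->
  ipO (fun x => u x + c * v x) w = ipO u w + c * ipO v w.
Proof. by move=> Lu Lv Lw; have Lcv := sqintZ mO c Lv; rewrite ipDl// ipZl. Qed.

Lemma vip_CS g h : vsqint g -> vsqint h -> vip g h ^+ 2 <= vip g g * vip h h.
Proof.
move=> Lg Lh; apply: discriminant_le => t.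
have Lgh := vsqint_lin t Lg Lh.
have := vip_ge0 (fun x => g x + t *: h x).
rewrite vip_lin// (vipC g) (vipC h) !vip_lin// (vipC h g); lra.
Qed.

Lemma vip_ae_eq g g' h h' : vsqint g -> vsqint g' -> vsqint h -> vsqint h' ->
  g = g' %[ae mu in Omega] -> h = h' %[ae mu in Omega] -> vip g h = vip g' h'.
Proof.
move=> Lg Lg' Lh Lh' gg' hh'; rewrite !vipE//; apply: eq_bigr => i _.
by apply: ip_ae_eq => //; [apply: filterS gg'|apply: filterS hh'] => x /[apply] ->.
Qed.

Lemma weak_gradient_vsqint u g : WG u g -> vsqint g.
Proof. by move=> [Lg _] i; apply/Lp2P. Qed.

(** The fundamental lemma applied to each component of the difference, which is integrable because
    Omega has finite measure. *)
Lemma weak_gradient_unique u g g' : WG u g -> WG u g' -> g = g' %[ae mu in Omega].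
Proof.
move=> wg wg'; have Lg := weak_gradient_vsqint wg; have Lg' := weak_gradient_vsqint wg'.
have comp i : (fun x => g x ord0 i - g' x ord0 i) = (fun=> 0) %[ae mu in Omega].
  apply: fundamental_lemma => //; first by apply: sqint_integrable; exact: sqintB.
  move=> phi tp; have Lp := test_sqint oO OM tp.
  under eq_Rintegral do rewrite mulrBl.
  rewrite RintegralB//; [|exact: sqint_mul..].
  have := wg.2 phi i tp; rewrite (wg'.2 phi i tp) => /oppr_inj ->.
  by rewrite subrr.
have : {ae mu, forall x, forall i, Omega x -> g x ord0 i - g' x ord0 i = 0}.
  by apply: filter_forall => i; exact: comp.
apply: filterS => x hx Ox; apply/rowP => i.
by apply/eqP; rewrite -subr_eq0; apply/eqP; exact: hx.
Qed.

Lemma weak_gradient_lin c u v g h : L2 u -> L2 v -> WG u g -> WG v h ->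
  WG (fun x => u x + c * v x) (fun x => g x + c *: h x).
Proof.
move=> Lu Lv wg wh; have Lg := weak_gradient_vsqint wg; have Lh := weak_gradient_vsqint wh.
split; first by move=> i; apply/Lp2P => //; exact: vsqint_lin.
move=> phi i tp; have Lp := test_sqint oO OM tp; have Lpi := test_partial_sqint oO OM tp i.
have Lcv := sqintZ mO c Lv; have Lch := sqintZ mO c (Lh i).
transitivity (ipO (fun x => u x + c * v x) (partial i phi)); first by [].
transitivity (- ipO (fun x => g x ord0 i + c * h x ord0 i) phi); last first.
  by congr (- _); apply: eq_Rintegral => x _; rewrite !mxE.
rewrite !ip_lin//.
have -> : ipO u (partial i phi) = - ipO (fun x => g x ord0 i) phi by exact: wg.2.
have -> : ipO v (partial i phi) = - ipO (fun x => h x ord0 i) phi by exact: wh.2.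
by rewrite opprD mulrN.
Qed.

Lemma weak_gradientP u g : WG u g -> WG u (weak_gradient Omega u).
Proof. by move=> wg; apply: (xgetPex (cst 0) (ex_intro _ g wg)). Qed.

(** Frees [dirichlet] from the choice in [weak_gradient]: any weak gradients compute it. *)
Lemma dirichletE u v g h : WG u g -> WG v h -> dirichlet Omega u v = vip g h.
Proof.
move=> wg wh; have wg' := weak_gradientP wg; have wh' := weak_gradientP wh.
apply: vip_ae_eq.
- exact: weak_gradient_vsqint wg'.
- exact: weak_gradient_vsqint wg.
- exact: weak_gradient_vsqint wh'.
- exact: weak_gradient_vsqint wh.
- exact: weak_gradient_unique wg' wg.
- exact: weak_gradient_unique wh' wh.
Qed.

Lemma H1_norm2E u g : L2 u -> WG u g -> H1_norm2 Omega u = (ipO u u + vip g g)%:E.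
Proof.
move=> Lu wg; have wg' := weak_gradientP wg.
rewrite -(dirichletE wg wg) /dirichlet /H1_norm2 -EFin_Rintegral//; last first.
  rewrite (_ : _ \o _ = (fun x => (u x * u x)%:E +
     (dot (weak_gradient Omega u x) (weak_gradient Omega u x))%:E)%E).
    apply: integrableD => //; first exact: sqint_mul.
    by apply: dot_integrable; exact: weak_gradient_vsqint wg'.
  by apply/funext => x /=; rewrite expr2.
rewrite RintegralD//.
- exact: sqint_integrable_sqr.
- by apply: dot_integrable; exact: weak_gradient_vsqint wg'.
Qed.

(** Membership in H_0^1 with the gradient as explicit datum and distances in [R]; by [H01P], [H01]
    is the existence of such a [g]. *)
Definition H01g u g := [/\ L2 u, WG u g & forall e : R, 0 < e ->
  exists2 phi, test_function Omega phi &
    ipO (fun x => u x - phi x) (fun x => u x - phi x) +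
    vip (fun x => g x - gradient phi x) (fun x => g x - gradient phi x) < e].

Lemma H01P u : H01 Omega u <-> exists g, H01g u g.
Proof.
split.
  move=> [[/Lp2P Lu [g wg]] happ]; exists g; split=> //; first exact: Lu.
  move=> e /happ[phi tp]; have Lu' := Lu mO; have Lp := test_sqint oO OM tp.
  have wp := test_weak_gradient oO M0 OM tp.
  rewrite (@H1_norm2E _ (fun x => g x - gradient phi x)) ?lte_fin; first by exists phi.
  - exact: sqintB.
  - by rewrite funB_scaleN1r [X in WG X](funB_mulN1r u phi); exact: weak_gradient_lin.
move=> [g [Lu wg happ]]; split; first by split; [exact/Lp2P|exists g].
move=> e /happ[phi tp hphi]; exists phi => //.
have Lp := test_sqint oO OM tp; have wp := test_weak_gradient oO M0 OM tp.
rewrite (@H1_norm2E _ (fun x => g x - gradient phi x)) ?lte_fin//.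
- exact: sqintB.
- by rewrite funB_scaleN1r [X in WG X](funB_mulN1r u phi); exact: weak_gradient_lin.
Qed.

Lemma vsqint_gradient phi : test_function Omega phi -> vsqint (gradient phi).
Proof.
by move=> tp; exact: (weak_gradient_vsqint (test_weak_gradient oO M0 OM tp)).
Qed.

Lemma H01g_test phi : test_function Omega phi -> H01g phi (gradient phi).
Proof.
move=> tp; split; [exact: (test_sqint oO OM tp)|exact: (test_weak_gradient oO M0 OM tp)|].
move=> e e0; exists phi => //.
rewrite (_ : ipO _ _ = 0); last first.
  by rewrite /ip /Rintegral integral0_eq// => x _; rewrite subrr mulr0.
rewrite add0r (_ : vip _ _ = 0)//.
rewrite /vip /Rintegral integral0_eq// => x _; rewrite /dot big1// => i _.
by rewrite subrr mxE mulr0.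
Qed.

Lemma ip_lin2 c u v : L2 u -> L2 v -> ipO (fun x => u x + c * v x) (fun x => u x + c * v x) =
  ipO u u + 2 * c * ipO u v + c ^+ 2 * ipO v v.
Proof.
move=> Lu Lv; have Lcv := sqintZ mO c Lv; have Luv := sqintD mO Lu Lcv.
by rewrite ip_lin// (ipC _ _ u) (ipC _ _ v) !ip_lin// (ipC _ _ v u); ring.
Qed.

Lemma vip_lin2 c g h : vsqint g -> vsqint h ->
  vip (fun x => g x + c *: h x) (fun x => g x + c *: h x) =
  vip g g + 2 * c * vip g h + c ^+ 2 * vip h h.
Proof.
move=> Lg Lh; have Lgh := vsqint_lin c Lg Lh.
by rewrite vip_lin// (vipC g) (vipC h) !vip_lin// (vipC h g); ring.
Qed.

Lemma ip_lin_le c u v : L2 u -> L2 v -> ipO (fun x => u x + c * v x) (fun x => u x + c * v x) <=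
  2 * ipO u u + 2 * c ^+ 2 * ipO v v.
Proof.
move=> Lu Lv; have := ip_ge0 mu Omega (fun x => u x + - c * v x).
by rewrite !ip_lin2//; lra.
Qed.

Lemma vip_lin_le c g h : vsqint g -> vsqint h ->
  vip (fun x => g x + c *: h x) (fun x => g x + c *: h x) <= 2 * vip g g + 2 * c ^+ 2 * vip h h.
Proof.
move=> Lg Lh; have := vip_ge0 (fun x => g x + - c *: h x).
by rewrite !vip_lin2//; lra.
Qed.

Lemma H01g_lin c u v g h : H01g u g -> H01g v h ->
  H01g (fun x => u x + c * v x) (fun x => g x + c *: h x).
Proof.
move=> [Lu wg ug] [Lv wh vh]; split.
- by apply: sqintD => //; exact: sqintZ.
- exact: weak_gradient_lin.
move=> e e0.
(* The tolerances fit [|x + c y|^2 <= 2 |x|^2 + 2 c^2 |y|^2]: each term contributes at most [e / 2].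
   The [+ 1] avoids a division by zero at [c = 0]. *)
have [phi tp hp] := ug (e / 4) (divr_gt0 e0 (ltr0Sn _ _)).
have c20 : 0 < c ^+ 2 + 1 by rewrite ltr_wpDl ?sqr_ge0.
have [psi tq hq] := vh (e / (4 * (c ^+ 2 + 1))) (divr_gt0 e0 (mulr_gt0 (ltr0Sn _ _) c20)).
exists (fun x => phi x + c * psi x); first exact: test_lin.
have Lp := test_sqint oO OM tp; have Lq := test_sqint oO OM tq.
have Lgp := vsqint_gradient tp; have Lgq := vsqint_gradient tq.
have Lg := weak_gradient_vsqint wg; have Lh := weak_gradient_vsqint wh.
have -> : (fun x => u x + c * v x - (phi x + c * psi x)) =
    (fun x => (u x - phi x) + c * (v x - psi x)) by apply/funext => x; ring.
have -> : (fun x => g x + c *: h x - gradient (fun y => phi y + c * psi y) x) =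
    (fun x => (g x - gradient phi x) + c *: (h x - gradient psi x)).
  apply/funext => x; rewrite gradient_lin; [|by case: tp|by case: tq].
  by rewrite scalerBr opprD addrACA.
have L1 : L2 (fun x => u x - phi x) by exact: sqintB.
have L3 : L2 (fun x => v x - psi x) by exact: sqintB.
have L4 : vsqint (fun x => g x - gradient phi x) by rewrite funB_scaleN1r; exact: vsqint_lin.
have L5 : vsqint (fun x => h x - gradient psi x) by rewrite funB_scaleN1r; exact: vsqint_lin.
have i1 := ip_lin_le c L1 L3; have i2 := vip_lin_le c L4 L5.
apply: le_lt_trans (lerD i1 i2) _.
move: hp hq; set A := ipO _ _; set B := vip _ _; set A' := ipO _ _; set B' := vip _ _ => hp.
rewrite ltr_pdivlMr ?mulr_gt0// => hq.
have A'0 : 0 <= A' by exact: ip_ge0.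
have B'0 : 0 <= B' by exact: vip_ge0.
clearbody A B A' B'; clear -hp hq A'0 B'0; lra.
Qed.

End weak_gradients.

(** * The energy norm and completeness *)

Section sobolev_space.
Context {R : realType} {n : nat}.
Local Notation mu := (@lebesgue_rV R n).
Variable Omega : set 'rV[R]_n.
Hypothesis oO : open Omega.
Variable M : R.
Hypotheses (M0 : 0 < M) (OM : Omega `<=` box M).
Local Notation ipO := (ip mu Omega).
Local Notation L2 := (sqint mu Omega).
Local Notation WG := (is_weak_gradient Omega).
Local Notation vL2 := (vsqint Omega).
Local Notation vip := (vip Omega).
Local Notation H01g := (H01g Omega).
Local Notation test := (test_function Omega).
Implicit Types (u v phi psi : 'rV[R]_n -> R) (g h : 'rV[R]_n -> 'rV[R]_n).

Let mO : measurable Omega := open_measurable_rV oO.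

Lemma vsqintB g h : vL2 g -> vL2 h -> vL2 (fun x => g x - h x).
Proof. by move=> Lg Lh; rewrite funB_scaleN1r; exact: vsqint_lin. Qed.

Lemma testB phi psi : test phi -> test psi -> test (fun x => phi x - psi x).
Proof. by move=> tp tq; rewrite funB_mulN1r; exact: test_lin. Qed.

Lemma gradientB phi psi : test phi -> test psi ->
  gradient (fun x => phi x - psi x) = (fun x => gradient phi x - gradient psi x).
Proof.
move=> [sp _] [sq _]; apply/funext => x; rewrite funB_mulN1r gradient_lin//.
by rewrite scaleN1r.
Qed.

Definition vnorm g : R := Num.sqrt (vip g g).

Lemma vnorm_ge0 g : 0 <= vnorm g.
Proof. exact: sqrtr_ge0. Qed.

Lemma sqr_vnorm g : vnorm g ^+ 2 = vip g g.
Proof. by rewrite sqr_sqrtr// vip_ge0. Qed.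

Lemma vip_le_vnorm g h : vL2 g -> vL2 h -> `|vip g h| <= vnorm g * vnorm h.
Proof.
move=> Lg Lh; rewrite -[leLHS]sqrtr_sqr /vnorm -sqrtrM ?vip_ge0//.
by apply: ler_wsqrtr; exact: vip_CS.
Qed.

Lemma vnorm_lin_le c g h : vL2 g -> vL2 h ->
  vnorm (fun x => g x + c *: h x) <= vnorm g + `|c| * vnorm h.
Proof.
move=> Lg Lh; rewrite -[leRHS]ger0_norm ?addr_ge0 ?mulr_ge0 ?vnorm_ge0//.
rewrite -sqrtr_sqr; apply: ler_wsqrtr; rewrite vip_lin2// sqrrD.
rewrite sqr_vnorm exprMn sqr_vnorm real_normK ?num_real// lerD2r lerD2l.
have h1 := vip_le_vnorm Lg Lh.
have h2 : c * vip g h <= `|c| * (vnorm g * vnorm h).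
  by apply: le_trans (ler_norm _) _; rewrite normrM ler_wpM2l.
by rewrite -[leRHS]mulr_natl -mulrA ler_pM2l// (mulrCA (vnorm g)).
Qed.

Lemma vnormB_le g h : vL2 g -> vL2 h -> vnorm (fun x => g x - h x) <= vnorm g + vnorm h.
Proof.
by move=> Lg Lh; rewrite funB_scaleN1r (le_trans (vnorm_lin_le _ Lg Lh))// normrN1 mul1r.
Qed.

Lemma vnormBC g h : vL2 g -> vL2 h -> vnorm (fun x => g x - h x) = vnorm (fun x => h x - g x).
Proof.
move=> Lg Lh; rewrite /vnorm; congr Num.sqrt.
by apply: eq_Rintegral => x _; apply: eq_bigr => i _; rewrite !mxE; ring.
Qed.

Section with_poincare.
Variable Cp : R.
Hypothesis Cp0 : 0 <= Cp.
Hypothesis poinc : forall phi, test phi -> ipO phi phi <= Cp * vip (gradient phi) (gradient phi).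

(** By the Poincare inequality the functions are Cauchy along with their gradients. Riesz-Fischer
    applies to the functions and to each component of the gradients, and the sequence itself
    witnesses that the limit is in the closure of the test functions. *)
Lemma H01g_complete (phi : nat -> 'rV[R]_n -> R) (c : R) : (forall m, test (phi m)) ->
  (forall m k, (m <= k)%N ->
     vip (fun x => gradient (phi m) x - gradient (phi k) x)
         (fun x => gradient (phi m) x - gradient (phi k) x) <= c / 4 ^+ m) ->
  exists u g C, H01g u g /\ forall m,
    ipO (fun x => phi m x - u x) (fun x => phi m x - u x) +
    vip (fun x => gradient (phi m) x - g x) (fun x => gradient (phi m) x - g x) <= C / 4 ^+ m.
Proof.
move=> tp cp.
have Lp m : L2 (phi m) := test_sqint oO OM (tp m).
have Lgp m : vL2 (gradient (phi m)) := vsqint_gradient oO M0 OM (tp m).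
have p4 m : (0 : R) < 4 ^+ m by rewrite exprn_gt0.
have [u Lu uc] : exists2 u, L2 u & forall m,
    ipO (fun x => phi m x - u x) (fun x => phi m x - u x) <= (Cp * c) / 4 ^+ m.
  apply: riesz_fischer => // m k mk; apply: le_trans (poinc (testB (tp m) (tp k))) _.
  by rewrite gradientB// -mulrA ler_wpM2l// cp.
have /choice[gi hgi] : forall i : 'I_n, exists v, L2 v /\ forall m,
    ipO (fun x => gradient (phi m) x ord0 i - v x) (fun x => gradient (phi m) x ord0 i - v x) <= c / 4 ^+ m.
  move=> i; have [v Lv vc] : exists2 v, L2 v & forall m,
    ipO (fun x => gradient (phi m) x ord0 i - v x) (fun x => gradient (phi m) x ord0 i - v x) <= c / 4 ^+ m.
    apply: (@riesz_fischer _ _ _ _ _ mO (fun m x => gradient (phi m) x ord0 i)) => [m|m k mk]; first exact: Lgp.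
    apply: le_trans (cp _ _ mk); rewrite vipE//; [|exact: vsqintB..].
    rewrite (bigD1 i)//=; under [X in _ <= X + _]eq_Rintegral do rewrite !mxE.
    under [leLHS]eq_Rintegral do rewrite !mxE.
    by rewrite lerDl; apply: sumr_ge0 => j _; exact: ip_ge0.
  by exists v.
pose g x : 'rV[R]_n := \row_i gi i x.
have Lg : vL2 g by move=> i; under eq_fun do rewrite mxE; case: (hgi i).
have gc m i : ipO (fun x => gradient (phi m) x ord0 i - g x ord0 i)
    (fun x => gradient (phi m) x ord0 i - g x ord0 i) <= c / 4 ^+ m.
  have [_ /(_ m)] := hgi i; congr (_ <= _).
  by apply: eq_Rintegral => x _; rewrite [g x _ _]mxE.
have vgc m : vip (fun x => gradient (phi m) x - g x) (fun x => gradient (phi m) x - g x) <=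
    n%:R * c / 4 ^+ m.
  rewrite vipE//; [|exact: vsqintB..].
  rewrite -mulrA mulr_natl -[n in X in _ <= X]card_ord -sumr_const; apply: ler_sum => i _.
  apply: le_trans (gc m i); rewrite le_eqVlt; apply/orP; left; apply/eqP.
  by apply: eq_Rintegral => x _; rewrite /= !mxE.
have both m : ipO (fun x => phi m x - u x) (fun x => phi m x - u x) +
    vip (fun x => gradient (phi m) x - g x) (fun x => gradient (phi m) x - g x) <=
    (Cp * c + n%:R * c) / 4 ^+ m.
  by rewrite mulrDl; apply: lerD; [exact: uc|exact: vgc].
have WGu : WG u g.
  split; first by move=> i; apply/Lp2P.
  move=> psi i tq; apply/eqP; rewrite -subr_eq0 opprK; apply/eqP.
  have Lq := test_sqint oO OM tq; have Lqi := test_partial_sqint oO OM tq i.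
  apply: (@geometric_eq0 _ _ (2 * (Cp * c * ipO (partial i psi) (partial i psi)) +
    2 * (c * ipO psi psi))) => m.
  have wm := (test_weak_gradient oO M0 OM (tp m)).2 psi i tq.
  have L1 : L2 (fun x => phi m x - u x) by exact: sqintB.
  have L3 : L2 (fun x => gradient (phi m) x ord0 i - g x ord0 i).
    exact: (sqintB mO (Lgp m i) (Lg i)).
  (* The defect in the identity defining the weak gradient of [u]. Subtracting the identity for
     [phi m] leaves two products with differences, which Cauchy-Schwarz bounds by a multiple of
     [2^-m]. *)
  set d := _ + _.
  have -> : d = - (ipO (fun x => phi m x - u x) (partial i psi) +
      ipO (fun x => gradient (phi m) x ord0 i - g x ord0 i) psi).
    rewrite (funB_mulN1r (phi m) u) (funB_mulN1r (fun x => gradient (phi m) x ord0 i) (fun x => g x ord0 i)).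
    have Lgpi := Lgp m i; have Lgi := Lg i.
    rewrite !(ip_lin oO)//.
    have -> : ipO (phi m) (partial i psi) = - ipO (fun x => gradient (phi m) x ord0 i) psi.
      exact: wm.
    by rewrite /d /ip; ring.
  have e1 := ip_CS mO L1 Lqi; have e2 := ip_CS mO L3 Lq.
  have e3 : ipO (fun x => phi m x - u x) (fun x => phi m x - u x) *
     ipO (partial i psi) (partial i psi) <= Cp * c / 4 ^+ m * ipO (partial i psi) (partial i psi).
    by rewrite ler_wpM2r ?ip_ge0// uc.
  have e4 : ipO (fun x => gradient (phi m) x ord0 i - g x ord0 i)
     (fun x => gradient (phi m) x ord0 i - g x ord0 i) * ipO psi psi <= c / 4 ^+ m * ipO psi psi.
    by rewrite ler_wpM2r ?ip_ge0// gc.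
  move: (le_trans e1 e3) (le_trans e2 e4); set A := ipO _ _; set B := ipO _ psi => hA hB.
  have : (A + B) ^+ 2 <= 2 * A ^+ 2 + 2 * B ^+ 2 by have := sqr_ge0 (A - B); nra.
  rewrite sqrrN => /le_trans; apply; rewrite [leRHS]mulrDl; apply: lerD.
    by rewrite -[leRHS]mulrA ler_pM2l//; apply: le_trans hA _; rewrite mulrAC.
  by rewrite -[leRHS]mulrA ler_pM2l//; apply: le_trans hB _; rewrite mulrAC.
exists u, g, (Cp * c + n%:R * c); split=> //; split=> // e e0.
have [m hm] : exists m, (Cp * c + n%:R * c) / 4 ^+ m < e.
  have cv : (fun m => (Cp * c + n%:R * c) / 4 ^+ m) @ \oo --> (0 : R).
    rewrite (_ : (fun m => _) = geometric (Cp * c + n%:R * c) (4^-1)).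
      by apply: cvg_geometric; rewrite ger0_norm; lra.
    by apply/funext => m /=; rewrite exprVn.
  by have /cvgr_lt/(_ e e0)[m _ /(_ m (leqnn m))] := cv; exists m.
exists (phi m) => //; apply: le_lt_trans hm; apply: le_trans (both m).
rewrite le_eqVlt; apply/orP; left; apply/eqP; congr (_ + _).
  by apply: eq_Rintegral => x _; ring.
by apply: eq_Rintegral => x _; apply: eq_bigr => i _; rewrite !mxE; ring.
Qed.

End with_poincare.
End sobolev_space.

(** * Bounded pairings *)

(** Isolates the estimate used for the Euler-Lagrange equation: [a], [b], [c] are the energy product
    of the approximation, that of the limit, and the pairing with f; [q] is [4^-m]. *)
Lemma sqr_dist_le (R : realFieldType) (a b c K A q : R) :
  (a - c) ^+ 2 <= A * q -> (a - b) ^+ 2 <= K * q * A ->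
  (b - c) ^+ 2 <= (2 * (K * A) + 2 * A) * q.
Proof.
move=> h1 h2.
have -> : (b - c) ^+ 2 = 2 * (a - c) ^+ 2 + 2 * (a - b) ^+ 2 - ((a - c) + (a - b)) ^+ 2.
  by ring.
have := sqr_ge0 ((a - c) + (a - b)); lra.
Qed.

Section dual_pairing.
Context {R : realType} {n : nat}.
Local Notation mu := (@lebesgue_rV R n).
Variable Omega : set 'rV[R]_n.
Hypothesis oO : open Omega.
Variable M : R.
Hypotheses (M0 : 0 < M) (OM : Omega `<=` box M).
Local Notation ipO := (ip mu Omega).
Local Notation L2 := (sqint mu Omega).
Local Notation WG := (is_weak_gradient Omega).
Local Notation vL2 := (vsqint Omega).
Local Notation vip := (vip Omega).
Local Notation vnorm := (vnorm Omega).
Local Notation H01g := (H01g Omega).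
Local Notation test := (test_function Omega).
Implicit Types (u v phi psi : 'rV[R]_n -> R) (g h : 'rV[R]_n -> 'rV[R]_n).

Let mO : measurable Omega := open_measurable_rV oO.

Variable f : 'rV[R]_n -> R.
Hypothesis mf : measurable_fun Omega f.

(** Bounded, hence square-integrable on the bounded set Omega, while f is merely measurable here. *)
Definition trunc (k : nat) (x : 'rV[R]_n) : R := Num.min `|f x| k%:R.

Lemma trunc_ge0 k x : 0 <= trunc k x.
Proof. by rewrite le_min normr_ge0/=. Qed.

Lemma measurable_trunc k : measurable_fun Omega (trunc k).
Proof. by apply: measurable_minr => //; exact: measurableT_comp. Qed.

Lemma sqint_trunc k : L2 (trunc k).
Proof.
apply: (@sqint_bounded _ _ _ _ _ _ k%:R) => //.
- exact: finite_Omega OM.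
- exact: measurable_trunc.
- by move=> x _; rewrite ger0_norm ?trunc_ge0// ge_min lexx orbT.
Qed.

Lemma sqint_norm u : L2 u -> L2 (fun x => `|u x|).
Proof.
move=> Lu; apply: (sqint_dominated mO _ Lu).
  by apply: measurableT_comp => //; exact: sqint_measurable Lu.
by move=> x _; rewrite normr_id.
Qed.

(* Truncated pairing: a seminorm, continuous on L2, increasing to
   [\int |f u|]. *)
Definition tpair (k : nat) u : R := ipO (trunc k) (fun x => `|u x|).

Lemma tpair_ge0 k u : 0 <= tpair k u.
Proof. by apply: Rintegral_ge0 => x _; rewrite mulr_ge0// trunc_ge0. Qed.

Lemma tpair_integrable k u : L2 u -> mu.-integrable Omega (EFin \o (fun x => trunc k x * `|u x|)).
Proof. by move=> Lu; apply: sqint_mul => //; [exact: sqint_trunc|exact: sqint_norm]. Qed.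

Lemma tpair_lin k c u v : L2 u -> L2 v ->
  tpair k (fun x => u x + c * v x) <= tpair k u + `|c| * tpair k v.
Proof.
move=> Lu Lv; have Lcv := sqintZ mO c Lv; have Luv := sqintD mO Lu Lcv.
have i1 := tpair_integrable k Lu; have i2 := tpair_integrable k Lv.
rewrite /tpair /ip -RintegralZl// -RintegralD//; last first.
  by rewrite (_ : _ \o _ = (fun x => `|c|%:E * (trunc k x * `|v x|)%:E)%E)//; exact: integrableZl.
apply: le_Rintegral => //.
- exact: tpair_integrable.
- rewrite (_ : _ \o _ = (fun x => (trunc k x * `|u x|)%:E + `|c|%:E * (trunc k x * `|v x|)%:E)%E)//.
  by apply: integrableD => //; exact: integrableZl.
move=> x _; rewrite mulrCA -mulrDr ler_wpM2l ?trunc_ge0//.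
by rewrite -normrM ler_normD.
Qed.

Lemma tpairZ k c u : L2 u -> tpair k (fun x => c * u x) = `|c| * tpair k u.
Proof.
move=> Lu; have i1 := tpair_integrable k Lu.
by rewrite /tpair /ip -RintegralZl//; apply: eq_Rintegral => x _; rewrite normrM mulrCA.
Qed.

Definition tconst k : R := Num.sqrt (ipO (trunc k) (trunc k)).

Lemma tpair_le k u : L2 u -> tpair k u <= tconst k * Num.sqrt (ipO u u).
Proof.
move=> Lu; rewrite -[leLHS]ger0_norm ?tpair_ge0// -sqrtr_sqr /tconst -sqrtrM ?ip_ge0//.
apply: ler_wsqrtr; apply: le_trans (ip_CS mO (sqint_trunc k) (sqint_norm Lu)) _.
rewrite ler_wpM2l ?ip_ge0// le_eqVlt; apply/orP; left; apply/eqP.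
by apply: eq_Rintegral => x _; rewrite -normrM ger0_norm// -expr2 sqr_ge0.
Qed.

Lemma tpair_sup u : L2 u ->
  (fun k => (tpair k u)%:E) @ \oo --> (\int[mu]_(x in Omega) `|(f x * u x)%:E|)%E.
Proof.
move=> Lu.
have -> : (fun k => (tpair k u)%:E) =
    (fun k => \int[mu]_(x in Omega) (trunc k x * `|u x|)%:E)%E.
  by apply/funext => k; rewrite EFin_Rintegral//; exact: tpair_integrable.
have -> : (\int[mu]_(x in Omega) `|(f x * u x)%:E| =
    \int[mu]_(x in Omega) limn (fun k => (trunc k x * `|u x|)%:E))%E.
  apply: eq_integral => x _; symmetry; apply: cvg_lim => //.
  apply: cvg_EFin; first exact: nearW.
  apply: cvg_near_cst; near=> k; rewrite /= normrM /trunc min_l//.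
  by apply: ltW; near: k; exact: nbhs_infty_gtr.
apply: cvg_monotone_convergence => //.
- move=> k; apply/measurable_EFinP; apply: measurable_funM; first exact: measurable_trunc.
  by apply: sqint_measurable; exact: sqint_norm.
- by move=> k x _; rewrite lee_fin mulr_ge0// trunc_ge0.
- move=> x _ k l kl; rewrite lee_fin ler_wpM2r// /trunc.
  by rewrite le_min !ge_min lexx/= (_ : k%:R <= l%:R) ?orbT// ler_nat.
Unshelve. all: by end_near. Qed.

Section bounded_pairing.
Variable C : R.
Hypothesis C0 : 0 <= C.
Hypothesis tpairC : forall phi k, test phi -> tpair k phi <= C * vnorm (gradient phi).

(** For fixed k the pairing is continuous in L2, so the bound extends by density. The L2 constant
    [tconst k] depends on k but only multiplies an error that is made small; [C] survives, uniform
    in k. *)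
Lemma tpair_H01 u g k : H01g u g -> tpair k u <= C * vnorm g.
Proof.
move=> [Lu wg happ]; apply/ler_addgt0Pr => e e0.
have K0 : 0 < C + tconst k + 1 by rewrite ltr_wpDl// addr_ge0// sqrtr_ge0.
have Lg := weak_gradient_vsqint oO wg.
(* Approximating [u] costs [C d] through the gradient and [tconst k * d] through the function; the
   [+ 1] keeps the denominator positive. *)
set d := e / (C + tconst k + 1); have d0 : 0 < d by rewrite divr_gt0.
have [phi tp hp] := happ (d ^+ 2) (exprn_gt0 2 d0).
have Lp := test_sqint oO OM tp; have Lgp := vsqint_gradient oO M0 OM tp.
have Lup : L2 (fun x => u x - phi x) by exact: sqintB.
have Lgg := vsqintB oO Lg Lgp.
have a0 := ip_ge0 mu Omega (fun x => u x - phi x).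
have b0 := vip_ge0 Omega (fun x => g x - gradient phi x).
have h1 : Num.sqrt (ipO (fun x => u x - phi x) (fun x => u x - phi x)) <= d.
  rewrite -(ger0_norm (ltW d0)) -sqrtr_sqr; apply: ler_wsqrtr.
  by apply: le_trans (ltW hp); rewrite lerDl.
have h2 : vnorm (fun x => g x - gradient phi x) <= d.
  rewrite -(ger0_norm (ltW d0)) -sqrtr_sqr; apply: ler_wsqrtr.
  by apply: le_trans (ltW hp); rewrite lerDr.
have t1 : tpair k u <= tpair k phi + tpair k (fun x => u x - phi x).
  have := tpair_lin k 1 Lp Lup; rewrite normr1 mul1r; apply: le_trans.
  rewrite le_eqVlt; apply/orP; left; apply/eqP; congr tpair.
  by apply/funext => x; rewrite mul1r subrKC.
have t2 : vnorm (gradient phi) <= vnorm g + vnorm (fun x => g x - gradient phi x).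
  have := vnormB_le oO Lg Lgg; apply: le_trans.
  rewrite le_eqVlt; apply/orP; left; apply/eqP; congr vnorm.
  by apply/funext => x; rewrite subKr.
have t3 := tpairC k tp; have t4 := tpair_le k Lup.
have t5 : C * vnorm (gradient phi) <= C * (vnorm g + d).
  by rewrite ler_wpM2l// (le_trans t2)// lerD2l.
have t6 : tconst k * Num.sqrt (ipO (fun x => u x - phi x) (fun x => u x - phi x)) <= tconst k * d.
  by rewrite ler_wpM2l// sqrtr_ge0.
have e1 : (C + tconst k + 1) * d = e by rewrite /d mulrC divfK// gt_eqF.
apply: (le_trans t1); apply: (le_trans (lerD (le_trans t3 t5) (le_trans t4 t6))).
rewrite mulrDr -addrA lerD2l -mulrDl -e1 ler_wpM2r ?(ltW d0)//.
by rewrite lerDl.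
Qed.

Lemma pairing_abs_le u g : H01g u g ->
  (\int[mu]_(x in Omega) `|(f x * u x)%:E| <= (C * vnorm g)%:E)%E.
Proof.
move=> hu; have [Lu _ _] := hu; have cv := tpair_sup Lu.
rewrite -(cvg_lim (@ereal_hausdorff R) cv); apply: lime_le; first by apply/cvg_ex; eexists; exact: cv.
by apply: nearW => k; rewrite lee_fin tpair_H01.
Qed.

Lemma pairing_integrable u g : H01g u g -> mu.-integrable Omega (EFin \o (fun x => f x * u x)).
Proof.
move=> hu; have [Lu _ _] := hu; apply/integrableP; split.
  by apply/measurable_EFinP; apply: measurable_funM => //; exact: sqint_measurable Lu.
by apply: le_lt_trans (pairing_abs_le hu) _; rewrite ltry.
Qed.

Definition pairing u : R := \int[mu]_(x in Omega) (f x * u x).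

Lemma pairing_le u g : H01g u g -> `|pairing u| <= C * vnorm g.
Proof.
move=> hu; have iu := pairing_integrable hu.
rewrite -lee_fin (EFin_normr_Rintegral mO iu).
apply: le_trans (le_abse_integral _ mO _) _; first by case/integrableP : iu.
exact: pairing_abs_le.
Qed.

Lemma pairing_lin c u v g h : H01g u g -> H01g v h ->
  pairing (fun x => u x + c * v x) = pairing u + c * pairing v.
Proof.
move=> hu hv; have iu := pairing_integrable hu; have iv := pairing_integrable hv.
rewrite /pairing -RintegralZl// -RintegralD//; last first.
  by rewrite (_ : _ \o _ = (fun x => c%:E * (f x * v x)%:E)%E)//; exact: integrableZl.
by apply: eq_Rintegral => x _; ring.
Qed.

Variable Cp : R.
Hypothesis Cp0 : 0 <= Cp.
Hypothesis poinc : forall phi, test phi -> ipO phi phi <= Cp * vip (gradient phi) (gradient phi).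

(** The functional is minimized over test functions only; the limit lies in H_0^1 by
    [H01g_complete], and its equation is extended from test functions to H_0^1 by density. *)
Lemma riesz_solution : exists w g, H01g w g /\ forall v h, H01g v h -> vip g h = pairing v.
Proof.
have Ht phi : test phi -> H01g phi (gradient phi) by exact: (H01g_test oO M0 OM).
have Lgt phi : test phi -> vL2 (gradient phi) by exact: (vsqint_gradient oO M0 OM).
have [phi [tp cp ep]] : exists phi : nat -> 'rV[R]_n -> R, [/\ forall m, test (phi m),
  forall m k, (m <= k)%N ->
    vip (gradient (fun x => phi m x - phi k x)) (gradient (fun x => phi m x - phi k x)) <= 4 / 4 ^+ m &
  forall m psi, test psi -> (vip (gradient (phi m)) (gradient psi) - pairing psi) ^+ 2 <=
     vip (gradient psi) (gradient psi) / 4 ^+ m].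
  apply: (@riesz_sequence _ _ test (fun u v => vip (gradient u) (gradient v)) pairing _ _ _ _ _ _ (C ^+ 2)).
  - exact: test0.
  - by move=> c u v tu tv; exact: test_lin.
  - move=> c u v w tu tv tw.
    rewrite -(vip_lin oO c (Lgt _ tu) (Lgt _ tv) (Lgt _ tw)); apply: eq_Rintegral => x _.
    by rewrite gradient_lin; [|by case: tu|by case: tv].
  - by move=> u v; exact: vipC.
  - by move=> u tu; exact: vip_ge0.
  - by move=> c u v tu tv; exact: pairing_lin (Ht _ tu) (Ht _ tv).
  - move=> u tu; rewrite -(sqr_vnorm Omega) -exprMn -real_normK ?num_real//.
    rewrite lerXn2r ?nnegrE//; first by rewrite mulr_ge0// vnorm_ge0.
    exact: pairing_le (Ht _ tu).
have [w [g [K [hw wK]]]] : exists u g K, H01g u g /\ forall m,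
    ipO (fun x => phi m x - u x) (fun x => phi m x - u x) +
    vip (fun x => gradient (phi m) x - g x) (fun x => gradient (phi m) x - g x) <= K / 4 ^+ m.
  apply: (H01g_complete oO M0 OM Cp0 poinc (c := 4) tp) => m k mk.
  by rewrite -(gradientB (tp m) (tp k)); exact: cp.
have [Lw wg _] := hw; have Lg := weak_gradient_vsqint oO wg.
exists w, g; split=> //.
(* [phi m] solves the equation up to [2^-m] times the energy norm of [psi], and its gradient is
   within a multiple of [2^-m] of [g]. *)
have tst psi : test psi -> vip g (gradient psi) = pairing psi.
  move=> tq; apply/eqP; rewrite -subr_eq0; apply/eqP.
  set A := vip (gradient psi) (gradient psi).
  apply: (@geometric_eq0 _ _ (2 * (K * A) + 2 * A)) => m.
  have e1 := ep m psi tq.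
  have Lm := vsqintB oO (Lgt _ (tp m)) Lg.
  have e2 := vip_CS oO Lm (Lgt _ tq).
  have A0 : 0 <= A by exact: vip_ge0.
  have e3 : vip (fun x => gradient (phi m) x - g x) (fun x => gradient (phi m) x - g x) <= K / 4 ^+ m.
    by apply: le_trans (wK m); rewrite lerDr ip_ge0.
  have e4 : vip (fun x => gradient (phi m) x - g x) (gradient psi) =
      vip (gradient (phi m)) (gradient psi) - vip g (gradient psi).
    by rewrite funB_scaleN1r (vip_lin oO (-1) (Lgt _ (tp m)) Lg (Lgt _ tq)) mulN1r.
  rewrite e4 -/A in e2.
  have e5 := le_trans e2 (ler_wpM2r A0 e3).
  exact: sqr_dist_le e1 e5.
(* Both sides are continuous for the energy norm, with constants [vnorm g] and [C]; [d] below splits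
   the error [e] accordingly. *)
move=> v h hv; have [Lv wh happ] := hv; have Lh := weak_gradient_vsqint oO wh.
apply/eqP; rewrite -subr_eq0 -normr_le0; apply/ler_addgt0Pr => e e0; rewrite add0r.
have K0 : 0 < vnorm g + C + 1 by rewrite ltr_wpDl// addr_ge0// vnorm_ge0.
set d := e / (vnorm g + C + 1); have d0 : 0 < d by rewrite divr_gt0.
have [psi tq hq] := happ (d ^+ 2) (exprn_gt0 2 d0).
have h2 : vnorm (fun x => h x - gradient psi x) <= d.
  rewrite -(ger0_norm (ltW d0)) -sqrtr_sqr; apply: ler_wsqrtr.
  by apply: le_trans (ltW hq); rewrite lerDr ip_ge0.
have Lq := Lgt _ tq; have Lhq := vsqintB oO Lh Lq.
have hvq : H01g (fun x => v x - psi x) (fun x => h x - gradient psi x).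
  by rewrite funB_mulN1r funB_scaleN1r; exact: (H01g_lin oO M0 OM (-1) hv (Ht _ tq)).
have -> : vip g h - pairing v = vip g (fun x => h x - gradient psi x) - pairing (fun x => v x - psi x).
  have -> : vip g (fun x => h x - gradient psi x) = vip g h - vip g (gradient psi).
    rewrite vipC funB_scaleN1r (vip_lin oO (-1) Lh Lq Lg) mulN1r; congr (_ - _); exact: vipC.
  rewrite (funB_mulN1r v) (pairing_lin (-1) hv (Ht _ tq)) (tst _ tq); ring.
apply: le_trans (ler_normB _ _) _.
have b1 := vip_le_vnorm oO Lg Lhq; have b2 := pairing_le hvq.
have e1 : (vnorm g + C + 1) * d = e by rewrite /d mulrC divfK// gt_eqF.
have b3 : vnorm g * vnorm (fun x => h x - gradient psi x) <= vnorm g * d by rewrite ler_wpM2l// vnorm_ge0.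
have b4 : C * vnorm (fun x => h x - gradient psi x) <= C * d by rewrite ler_wpM2l.
apply: le_trans (lerD (le_trans b1 b3) (le_trans b2 b4)) _.
by rewrite -e1 -mulrDl ler_wpM2r ?(ltW d0)// lerDl.
Qed.

End bounded_pairing.
End dual_pairing.

Lemma halving_le (R : realFieldType) (x y z : R) : y <= x / 2 -> x / 2 + (z - x) <= z - y.
Proof. lra. Qed.

Lemma perturbation_le (R : realFieldType) (m a b c d u e : R) :
  m + 1 <= a -> a <= b + c -> c <= 1 -> b <= u + d -> d <= e -> m <= u + e.
Proof. lra. Qed.

(** * The gliding hump argument *)

Section uniform_boundedness.
Context {R : realType} {n : nat}.
Local Notation mu := (@lebesgue_rV R n).
Variable Omega : set 'rV[R]_n.
Hypothesis oO : open Omega.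
Variable M : R.
Hypotheses (M0 : 0 < M) (OM : Omega `<=` box M).
Local Notation ipO := (ip mu Omega).
Local Notation L2 := (sqint mu Omega).
Local Notation vL2 := (vsqint Omega).
Local Notation vip := (vip Omega).
Local Notation vnorm := (vnorm Omega).
Local Notation H01g := (H01g Omega).
Local Notation test := (test_function Omega).

Let mO : measurable Omega := open_measurable_rV oO.

Variable f : 'rV[R]_n -> R.
Hypothesis mf : measurable_fun Omega f.
Local Notation tpair := (tpair Omega f).
Local Notation tconst := (tconst Omega f).

Lemma tpair_le_integral k u : L2 u ->
  ((tpair k u)%:E <= \int[mu]_(x in Omega) `|(f x * u x)%:E|)%E.
Proof.
move=> Lu; have it := tpair_integrable oO OM mf k Lu.
rewrite EFin_Rintegral//; apply: ge0_le_integral => //.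
- by move=> x _; rewrite lee_fin mulr_ge0// trunc_ge0.
- by case/integrableP : it.
- apply: measurableT_comp => //; apply/measurable_EFinP; apply: measurable_funM => //.
  exact: sqint_measurable Lu.
- by move=> x _; rewrite /= lee_fin normrM ler_wpM2r// /trunc ge_min lexx.
Qed.

Lemma vnormZ c (g : 'rV[R]_n -> 'rV[R]_n) : vL2 g -> vnorm (fun x => c *: g x) = `|c| * vnorm g.
Proof.
move=> Lg; rewrite /vnorm (_ : vip _ _ = c ^+ 2 * vip g g).
  by rewrite sqrtrM ?sqr_ge0// sqrtr_sqr.
rewrite /vip -RintegralZl//; last exact: dot_integrable.
apply: eq_Rintegral => x _; rewrite /dot mulr_sumr; apply: eq_bigr => i _.
by rewrite !mxE; ring.
Qed.

Variable Cp : R.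
Hypothesis Cp0 : 0 <= Cp.
Hypothesis poinc : forall phi, test phi -> ipO phi phi <= Cp * vip (gradient phi) (gradient phi).
Hypothesis pairing_finite : forall u g, H01g u g ->
  (\int[mu]_(x in Omega) `|(f x * u x)%:E| < +oo)%E.

(* By the parallelogram-type inequality [tpair k (s + t phi) + tpair k (s - t phi) >=
   2 t tpair k phi], a small perturbation of [s] can make the pairing large. *)
Let hump s (d a : R) :
  (forall C, 0 <= C -> exists phi k, test phi /\ C * vnorm (gradient phi) < tpair k phi) ->
  test s -> 0 < d -> 0 < a -> exists s' k, [/\ test s',
    vnorm (fun x => gradient s' x - gradient s x) <= d & a <= tpair k s'].
Proof.
move=> hN ts d0 a0.
have [phi [k [tp hphi]]] := hN (a / d) (divr_ge0 (ltW a0) (ltW d0)).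
have Lp := test_sqint oO OM tp; have Ls := test_sqint oO OM ts.
have Lgp := vsqint_gradient oO M0 OM tp.
set t := tpair k phi in hphi.
have t0 : 0 < t by apply: le_lt_trans hphi; rewrite mulr_ge0 ?vnorm_ge0// divr_ge0 ?ltW.
(* With this scaling the pairing of [r phi] is exactly [a], while the choice [C = a / d] above keeps
   its gradient norm below [d]. *)
pose r := a / t; have r0 : 0 < r by rewrite divr_gt0.
have rv : r * vnorm (gradient phi) <= d.
  have := hphi; rewrite mulrAC ltr_pdivrMr// => h.
  by rewrite /r mulrAC ler_pdivrMr// [d * t]mulrC ltW.
have small c : `|c| = r ->
    vnorm (fun x => gradient (fun y => s y + c * phi y) x - gradient s x) <= d.
  move=> cr; rewrite (_ : (fun x => _) = (fun x => c *: gradient phi x)).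
    by rewrite vnormZ// cr.
  apply/funext => x; rewrite gradient_lin; [|by case: ts|by case: tp].
  by rewrite addrAC subrr add0r.
have L1 : L2 (fun x => s x + r * phi x) by apply: sqintD => //; exact: sqintZ.
have L3 : L2 (fun x => s x + - r * phi x) by apply: sqintD => //; exact: sqintZ.
have big : 2 * a <= tpair k (fun x => s x + r * phi x) + tpair k (fun x => s x + - r * phi x).
  have := tpair_lin oO OM mf k (-1) L1 L3; rewrite normrN1 mul1r; apply: le_trans.
  rewrite (_ : (fun x => _) = (fun x => 2 * r * phi x)); last by apply/funext => x; ring.
  rewrite (tpairZ oO OM mf)// ger0_norm; last by rewrite mulr_ge0// ltW.
  by rewrite -mulrA /r divfK// gt_eqF.
have [h|h] := leP a (tpair k (fun x => s x + r * phi x)).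
  exists (fun x => s x + r * phi x), k; split => //; first exact: test_lin.
  by apply: small; rewrite gtr0_norm.
exists (fun x => s x + - r * phi x), k; split; first exact: test_lin.
  by apply: small; rewrite normrN gtr0_norm.
by move: big h; lra.
Qed.

(** Otherwise perturbations build a limit u in H_0^1 whose m-th truncated pairing is at least m for
    every m; yet all of them are bounded by the integral of [|f u|], which is finite. *)
Lemma uniform_boundedness : exists2 C, 0 <= C &
  forall phi k, test phi -> tpair k phi <= C * vnorm (gradient phi).
Proof.
apply: contrapT => hN0.
have hN C : 0 <= C -> exists phi k, test phi /\ C * vnorm (gradient phi) < tpair k phi.
  move=> C0; apply: contrapT => h; apply: hN0; exists C => // phi k tp.
  rewrite leNgt; apply/negP => lt; apply: h; by exists phi, k.
(* A state is a test function, a budget d for the total gradient norm of all later perturbations,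
   and a truncation level. A step spends at most half of the budget, makes the pairing at least m +
   1, and shrinks the budget until, by Poincare, later perturbations alter that pairing by at most
   1. *)
pose spec (x : nat * (('rV[R]_n -> R) * R)) (y : (('rV[R]_n -> R) * R) * nat) :=
  test x.2.1 -> 0 < x.2.2 -> [/\ test y.1.1, 0 < y.1.2, y.1.2 <= x.2.2 / 2,
    vnorm (fun z => gradient y.1.1 z - gradient x.2.1 z) <= x.2.2 / 2 &
    x.1.+1%:R <= tpair y.2 y.1.1 /\ tconst y.2 * Num.sqrt Cp * y.1.2 <= 1].
have /choice[F hF] : forall x, exists y, spec x y.
  (* If [s] is not a test function or [d <= 0], [spec] holds vacuously and any value serves. *)
  move=> [m [s d]]; have [/= ts|] := pselect (test s); last first.
    by move=> ts; exists ((s, d), 0) => /=.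
  have [d0|d0] := ltP 0 d; last by exists ((s, d), 0) => /= _; rewrite ltNge d0.
  have d20 : 0 < d / 2 by rewrite divr_gt0.
  have [s' [k [ts' vs' hs']]] := hump hN ts d20 (ltr0Sn R m).
  have tc0 : 0 < tconst k * Num.sqrt Cp + 1 by rewrite ltr_wpDl// mulr_ge0// sqrtr_ge0.
  exists ((s', Num.min (d / 2) (tconst k * Num.sqrt Cp + 1)^-1), k) => /= _ _; split => //.
  - by rewrite lt_min d20 invr_gt0.
  - by rewrite ge_min lexx.
  split=> //; apply: (@le_trans _ _ (tconst k * Num.sqrt Cp * (tconst k * Num.sqrt Cp + 1)^-1)).
    by rewrite ler_wpM2l ?mulr_ge0 ?sqrtr_ge0// ge_min lexx orbT.
  by rewrite ler_pdivrMr// mul1r lerDl.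
pose st := fix st m := if m is m'.+1 then F (m', (st m').1) else ((fun=> 0 : R, 1 : R), 0%N).
pose phi m := (st m).1.1; pose d m := (st m).1.2; pose k m := (st m).2.
have inv m : test (phi m) /\ 0 < d m.
  elim: m => [|m [tm dm]]; first by split; [exact: test0|].
  by have [] := hF (m, (st m).1) tm dm.
have tp m : test (phi m) by case: (inv m).
have d0 m : 0 < d m by case: (inv m).
have stepP m : [/\ d m.+1 <= d m / 2,
    vnorm (fun z => gradient (phi m.+1) z - gradient (phi m) z) <= d m / 2 &
    m.+1%:R <= tpair (k m.+1) (phi m.+1) /\ tconst (k m.+1) * Num.sqrt Cp * d m.+1 <= 1].
  by have [] := hF (m, (st m).1) (tp m) (d0 m).
have Lgp m : vL2 (gradient (phi m)) := vsqint_gradient oO M0 OM (tp m).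
have Lp m : L2 (phi m) := test_sqint oO OM (tp m).
(* Telescoping: a step moves by at most [d m / 2 <= d m - d (m+1)]. Together with [d m <= 2^-m] this
   gives the rate [4^-m] for the squared norms. *)
have dist m j : vnorm (fun z => gradient (phi (m + j)%N) z - gradient (phi m) z) <= d m - d (m + j)%N.
  elim: j => [|j IH].
    rewrite addn0 subrr (_ : (fun z => _) = (fun z => 0 *: gradient (phi m) z)).
      by rewrite vnormZ// normr0 mul0r.
    by apply/funext => z; rewrite subrr scale0r.
  rewrite addnS; have [h1 h2 _] := stepP (m + j)%N.
  have := vnorm_lin_le oO 1 (vsqintB oO (Lgp (m + j).+1) (Lgp (m + j)%N)) (vsqintB oO (Lgp (m + j)%N) (Lgp m)).
  rewrite (_ : (fun x => _) = (fun z => gradient (phi (m + j).+1) z - gradient (phi m) z)); last first.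
    by apply/funext => z; rewrite scale1r addrA subrK.
  rewrite normr1 mul1r => /le_trans; apply.
  apply: le_trans (lerD h2 IH) _; exact: halving_le.
have dm m : d m <= (2 ^+ m)^-1.
  elim: m => [|m IH]; first by rewrite expr0 invr1.
  have [h1 _ _] := stepP m; apply: le_trans h1 _.
  by rewrite exprS invfM mulrC ler_wpM2l// invr_ge0.
have [u [g [K [hu uK]]]] : exists u g K, H01g u g /\ forall m,
    ipO (fun x => phi m x - u x) (fun x => phi m x - u x) +
    vip (fun x => gradient (phi m) x - g x) (fun x => gradient (phi m) x - g x) <= K / 4 ^+ m.
  apply: (H01g_complete oO M0 OM Cp0 poinc (c := 1) tp) => m j mj.
  rewrite -sqr_vnorm vnormBC//; rewrite -(subnKC mj).
  have h := dist m (j - m)%N.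
  apply: (@le_trans _ _ ((2 ^+ m)^-1 ^+ 2)).
    rewrite lerXn2r ?nnegrE ?vnorm_ge0 ?invr_ge0 ?exprn_ge0//.
    by apply: le_trans (dm m); apply: le_trans h _; rewrite gerBl ltW.
  by rewrite mul1r exprVn -exprM mulnC exprM (_ : 2 ^+ 2 = 4 :> R)//; ring.
have [Lu _ _] := hu.
(* The pairing of [phi (m+1)] is at least m + 1. Passing to a far [phi q] costs at most 1 by the
   budget, and from [phi q] to [u] an arbitrarily small [e]. *)
have lower m : m%:R <= tpair (k m.+1) u.
  set l := k m.+1; apply/ler_addgt0Pr => e e0.
  have [j hj] : exists j, tconst l * Num.sqrt K / 2 ^+ (m.+1 + j) < e.
    have cv : (fun j => tconst l * Num.sqrt K / 2 ^+ j) @ \oo --> (0 : R).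
      rewrite (_ : (fun j => _) = geometric (tconst l * Num.sqrt K) (2^-1)).
        by apply: cvg_geometric; rewrite ger0_norm; lra.
      by apply/funext => j /=; rewrite exprVn.
    have /cvgr_lt/(_ e e0)[j _ hj] := cv; exists j; apply: hj; exact: leq_addl.
  set q := (m.+1 + j)%N in hj.
  have Lqu : L2 (fun x => phi q x - u x) by exact: sqintB.
  have Lqm : L2 (fun x => phi q x - phi m.+1 x) by exact: sqintB.
  have [_ _ [s1 s2]] := stepP m.
  have t1 : tpair l (phi q) <= tpair l u + tpair l (fun x => phi q x - u x).
    have := tpair_lin oO OM mf l 1 Lu Lqu; rewrite normr1 mul1r; apply: le_trans.
    rewrite le_eqVlt; apply/orP; left; apply/eqP; congr tpair.
    by apply/funext => x; rewrite mul1r subrKC.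
  have t2 : tpair l (phi m.+1) <= tpair l (phi q) + tpair l (fun x => phi q x - phi m.+1 x).
    have := tpair_lin oO OM mf l (-1) (Lp q) Lqm; rewrite normrN1 mul1r; apply: le_trans.
    rewrite le_eqVlt; apply/orP; left; apply/eqP; congr tpair.
    by apply/funext => x; ring.
  have t3 : tpair l (fun x => phi q x - phi m.+1 x) <= 1.
    apply: le_trans (tpair_le oO OM mf l Lqm) _; apply: le_trans s2.
    rewrite -mulrA ler_wpM2l ?sqrtr_ge0//.
    apply: (@le_trans _ _ (Num.sqrt (Cp * vip (fun z => gradient (phi q) z - gradient (phi m.+1) z)
        (fun z => gradient (phi q) z - gradient (phi m.+1) z)))).
      apply: ler_wsqrtr; rewrite -(gradientB (tp q) (tp m.+1)); apply: poinc; exact: testB.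
    rewrite sqrtrM// ler_wpM2l ?sqrtr_ge0//; apply: le_trans (dist m.+1 j) _.
    by rewrite gerBl ltW.
  have t4 : tpair l (fun x => phi q x - u x) <= e.
    apply: le_trans (tpair_le oO OM mf l Lqu) _; apply: le_trans (ltW hj).
    rewrite -mulrA ler_wpM2l ?sqrtr_ge0//.
    have p2 : (0 : R) < 2 ^+ q by rewrite exprn_gt0.
    have b1 : ipO (fun x => phi q x - u x) (fun x => phi q x - u x) <= K / 4 ^+ q.
      by apply: le_trans (uK q); rewrite lerDl vip_ge0.
    apply: le_trans (ler_wsqrtr b1) _.
    have -> : 4 ^+ q = (2 ^+ q) ^+ 2 :> R by rewrite -exprM mulnC exprM (_ : 2 ^+ 2 = 4 :> R)//; ring.
    have K0 : 0 <= K.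
      by have := uK 0; rewrite expr0 divr1; apply: le_trans; rewrite addr_ge0 ?ip_ge0 ?vip_ge0.
    have -> : ((2 ^+ q) ^+ 2)^-1 = ((2 ^+ q)^-1) ^+ 2 :> R by rewrite exprVn.
    by rewrite sqrtrM// sqrtr_sqr ger0_norm// invr_ge0 ltW.
  have e1 : m.+1%:R = m%:R + 1 :> R by rewrite natr1.
  rewrite e1 in s1; exact: perturbation_le s1 t2 t3 t1 t4.
have fin := pairing_finite hu.
have I0 : (0 <= \int[mu]_(x in Omega) `|(f x * u x)%:E|)%E by exact: integral_ge0.
move: fin I0 (fun m => tpair_le_integral (k m.+1) Lu).
case: (\int[mu]_(x in Omega) `|(f x * u x)%:E|)%E => // A _ A0 hA.
have := lower (Num.truncn A).+1; have := hA (Num.truncn A).+1; rewrite lee_fin => h1 h2.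
by have := le_trans h2 h1; rewrite leNgt truncnS_gt.
Qed.

End uniform_boundedness.

Section embedding.
Context {R : realType} {n : nat}.
Local Notation mu := (@lebesgue_rV R n).
Variable Omega : set 'rV[R]_n.
Hypothesis oO : open Omega.
Variable M : R.
Hypotheses (M0 : 0 < M) (OM : Omega `<=` box M).
Let mO : measurable Omega := open_measurable_rV oO.

Lemma vip_gradient phi : test_function Omega phi ->
  vip Omega (gradient phi) (gradient phi) = dirichlet_sum phi.
Proof.
move=> tp; have Lg := vsqint_gradient oO M0 OM tp.
rewrite vipE//; apply: eq_bigr => i _.
rewrite -(@Rintegral_out _ _ Omega (fun x => partial i phi x ^+ 2)); last first.
  by move=> x Ox; rewrite (test_partial_out tp)// expr0n.
by apply: eq_Rintegral => x _; rewrite !mxE expr2.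
Qed.

Lemma Lp_measurable (p : \bar R) f : Lp p Omega f -> measurable_fun Omega f.
Proof.
rewrite /Lp inE => /andP[/[!inE]/= mf _].
by apply/(measurable_restrictT f mO).
Qed.

Lemma Lp1_integrable f : Lp 1%E Omega f -> mu.-integrable Omega (EFin \o f).
Proof.
move=> /Lfun1_integrable => h; apply/(integrable_mkcond _ mO).
by rewrite restrict_EFin.
Qed.

(** [|f| <= |f|^q + 1], and constants are integrable on Omega. *)
Lemma Lp_integrable (q : R) f : 1 <= q -> Lp q%:E Omega f -> mu.-integrable Omega (EFin \o f).
Proof.
move=> q1 hf; have mf := Lp_measurable hf.
have := Lfun_integrable q1 hf => /(integrableS _ mO (@subsetT _ _)) h.
have h1 : mu.-integrable Omega (EFin \o (fun=> 1)).
  exact: (sqint_integrable oO OM (sqint_cst oO OM 1)).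
apply: (@le_integrable _ _ _ _ _ mO _ (fun x => (`|(f \_ Omega) x| `^ q)%:E + 1%:E)%E).
- exact/measurable_EFinP.
- move=> x Ox; rewrite /= lee_fin patchE mem_set//.
  rewrite [leRHS]ger0_norm ?addr_ge0 ?powR_ge0//.
  have [f1|f1] := leP `|f x| 1; first by rewrite (le_trans f1)// lerDr powR_ge0.
  rewrite (@le_trans _ _ (`|f x| `^ q)) ?lerDl//.
  by rewrite -[leLHS]powRr1// ler_powR// ltW.
- by apply: integrableD => //; exact: h.
Qed.

End embedding.

(** * Bounds on the truncated pairings in dimensions 1 and at least 3 *)

Section test_bounds.
Context {R : realType}.

Lemma test_poincare n (Omega : set 'rV[R]_n.+1) M : open Omega -> 0 < M -> Omega `<=` box M ->
  forall phi, test_function Omega phi -> ip (lebesgue_rV n.+1) Omega phi phi <=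
    (2 * (M + 1)) ^+ 2 * vip Omega (gradient phi) (gradient phi).
Proof.
move=> oO M0 OM phi tp; rewrite (vip_gradient oO M0 OM)//.
have := poincare M0 (test_continuous tp) (@test_derivable _ _ _ _ tp)
  (@test_partial_continuous _ _ _ _ tp) (test_supported OM tp).
apply: le_trans; rewrite -(@Rintegral_out _ _ Omega (fun x => phi x ^+ 2)); last first.
  by move=> x Ox; rewrite (test_out tp)// expr0n.
by rewrite le_eqVlt; apply/orP; left; apply/eqP; apply: eq_Rintegral => x _; rewrite expr2.
Qed.

Lemma tpair_bound_dim1 (Omega : set 'rV[R]_1) M f : open Omega -> 0 < M -> Omega `<=` box M ->
  (lebesgue_rV 1).-integrable Omega (EFin \o f) ->
  exists2 C, 0 <= C & forall phi k, test_function Omega phi ->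
    tpair Omega f k phi <= C * vnorm Omega (gradient phi).
Proof.
move=> oO M0 OM fi; have mO := open_measurable_rV oO.
have mf : measurable_fun Omega f by case/integrableP : fi => /measurable_EFinP.
have ifn : (lebesgue_rV 1).-integrable Omega (EFin \o (fun x => `|f x|)).
  exact: integrable_abse fi.
set I := \int[lebesgue_rV 1]_(x in Omega) `|f x|.
have I0 : 0 <= I by exact: Rintegral_ge0.
exists (I * Num.sqrt (2 * (M + 1))); first by rewrite mulr_ge0// sqrtr_ge0.
move=> phi k tp; have Lp := test_sqint oO OM tp.
set S := Num.sqrt (2 * (M + 1)) * vnorm Omega (gradient phi).
have S0 : 0 <= S by rewrite mulr_ge0 ?sqrtr_ge0// vnorm_ge0.
have bnd x : `|phi x| <= S.
  have L0 : 0 <= 2 * (M + 1) by rewrite mulr_ge0// addr_ge0// ltW.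
  rewrite /S /vnorm -sqrtrM// -sqrtr_sqr; apply: ler_wsqrtr.
  rewrite (vip_gradient oO M0 OM)// /dirichlet_sum big_ord1.
  rewrite -lee_fin [leRHS]EFinM EFin_Rintegral//; last first.
    apply: (@supported_integrable _ _ M).
      by apply: continuous_sqr; exact: (@test_partial_continuous _ _ _ _ tp).
    by move=> y; rewrite expf_eq0/=; exact: (test_partial_supported OM tp).
  rewrite (@integral_rV1 _ (fun y => partial ord0 phi y ^+ 2) x)//.
  - exact: (sqr_le_line M0 (@test_derivable _ _ _ _ tp)
      (@test_partial_continuous _ _ _ _ tp) (test_supported OM tp)).
  - by apply: continuous_sqr; exact: (@test_partial_continuous _ _ _ _ tp).
  - by move=> y; exact: sqr_ge0.
rewrite -mulrA -/S mulrC -RintegralZl//.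
apply: le_Rintegral => //.
- exact: (tpair_integrable oO OM mf k Lp).
- by rewrite (_ : _ \o _ = (fun x => S%:E * `|f x|%:E)%E)//; exact: integrableZl.
move=> x _; rewrite mulrC; apply: ler_pM => //; first exact: trunc_ge0.
by rewrite /trunc ge_min lexx.
Qed.

Lemma tpair_bound_dim3 n (Omega : set 'rV[R]_n.+3) M f : open Omega -> 0 < M -> Omega `<=` box M ->
  let s := 2 * n.+3%:R / n.+1%:R : R in
  Lp (s / (s - 1))%:E Omega f ->
  exists2 C, 0 <= C & forall phi k, test_function Omega phi ->
    tpair Omega f k phi <= C * vnorm Omega (gradient phi).
Proof.
move=> oO M0 OM s hf; have mO := open_measurable_rV oO.
have mf := Lp_measurable oO hf.
have n1 : (0 : R) < n.+1%:R by [].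
have n3 : n.+3%:R = n.+1%:R + 2 :> R by rewrite -natr1 -natr1 -addrA.
have s1 : 1 < s by rewrite /s ltr_pdivlMr// mul1r n3; move: (n.+1%:R : R) n1 => z; lra.
have s0 : 0 < s by exact: lt_trans s1.
have s10 : 0 < s - 1 by rewrite subr_gt0.
set q := s / (s - 1) in hf.
have q0 : 0 < q by rewrite divr_gt0.
have qs : q^-1 + s^-1 = 1 by rewrite /q; field; rewrite !gt_eqF.
move: (hf); rewrite /Lp inE => /andP[/[!inE]/= mf' hfin].
set A := fine ('N[lebesgue_rV n.+3]_q%:E[EFin \o (f \_ Omega)])%E.
have A0 : 0 <= A by rewrite fine_ge0// Lnorm_ge0.
have AE : A%:E = ('N[lebesgue_rV n.+3]_q%:E[EFin \o (f \_ Omega)])%E.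
  by rewrite fineK// ge0_fin_numE ?Lnorm_ge0.
set K := n.+3%:R * (2 * n.+2%:R / n.+1%:R) : R.
have K0 : 0 <= K by rewrite /K mulr_ge0// divr_ge0// mulr_ge0.
exists (A * K); first exact: mulr_ge0.
move=> phi k tp; have Lp_ := test_sqint oO OM tp.
have cp := test_continuous tp; have sp := test_supported OM tp.
have mphi : measurable_fun setT phi by exact: continuous_measurable_rV.
have := sobolev M0 cp (@test_derivable _ _ _ _ tp) (@test_partial_continuous _ _ _ _ tp) sp.
rewrite /= -/s -/K -(vip_gradient oO M0 OM tp) -/(vnorm Omega (gradient phi)) => sob.
have := hoelder (lebesgue_rV n.+3) mf' mphi q0 s0 qs; rewrite -AE Lnorm1 => hol.
rewrite -lee_fin; apply: le_trans (tpair_le_integral oO OM mf k Lp_) _.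
have -> : (\int[lebesgue_rV n.+3]_(x in Omega) `|(f x * phi x)%:E| =
    \int[lebesgue_rV n.+3]_x `|(EFin \o (f \_ Omega \* phi)%R) x|)%E.
  rewrite integral_mkcond; apply: eq_integral => x _ /=; rewrite !patchE.
  by case: ifP => // _; rewrite mul0r normr0.
apply: le_trans hol _; rewrite -mulrA [leRHS]EFinM; apply: lee_wpmul2l; first by rewrite lee_fin.
apply: le_trans (_ : (((\int[lebesgue_rV n.+3]_x `|phi x| `^ s) `^ s^-1)%R)%:E <= _)%E; last by rewrite lee_fin.
rewrite unlock -poweR_EFin EFin_Rintegral//; last first.
  by apply: (@supported_integrable _ _ M); [exact: continuous_norm_powR|exact: supported_norm_powR].
Qed.

End test_bounds.

(** * Multiples of the solution of the linear problem *)

Section cubic.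
Context {R : realType}.

Lemma cubic_continuous (a c : R) : continuous (fun t : R => (a - c * t ^+ 2) * t).
Proof.
move=> t; apply: cvgM; last exact: cvg_id.
apply: cvgB; first exact: cvg_cst.
by apply: cvgM; [exact: cvg_cst|exact: exprn_continuous].
Qed.

(** The strict inequalities at the endpoints put the root in the open interval; this is what makes
    roots nonzero and pairwise distinct. *)
Lemma cubic_ivt (a c m x y : R) : x <= y ->
  (let p t := (a - c * t ^+ 2) * t in p x < m < p y \/ p y < m < p x) ->
  exists2 t, x < t < y & (a - c * t ^+ 2) * t = m.
Proof.
move=> xy; set p := (fun t : R => _) => /= h.
have hm : Num.min (p x) (p y) <= m <= Num.max (p x) (p y).
  by rewrite ge_min le_max; case: h => /andP[/ltW -> /ltW ->]; rewrite ?orbT.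
have [t] := IVT xy (continuous_subspaceT (@cubic_continuous a c)) hm.
rewrite in_itv/= => /andP[xt ty] pt; exists t => //.
rewrite !lt_neqAle xt ty !andbT; apply/andP; split; apply/eqP => E;
  have {}pt : p t = m := pt; move: h.
- by rewrite E pt ltxx andbF => -[].
- by rewrite -E pt ltxx andbF => -[].
Qed.

Lemma cubic_root_neg (a c m : R) : 0 < a -> 0 < c -> 0 < m ->
  exists2 t, t < 0 & (a - c * t ^+ 2) * t = m.
Proof.
(* Since [c T = c + a + m] and [T > 1], the value of the cubic at [- T] is [T (c T^2 - a) > m],
   against 0 at the origin. *)
move=> a0 c0 m0; pose T := 1 + (a + m) / c.
have T1 : 1 < T by rewrite ltrDl divr_gt0// addr_gt0.
have cT : c * T = c + a + m by rewrite /T mulrDr mulr1 mulrCA divff ?mulr1 ?addrA// gt_eqF.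
have [||t /andP[_ t0] pt] := @cubic_ivt a c m (- T) 0; last by exists t.
  by rewrite oppr_le0 (le_trans ler01)// ltW.
right => /=; rewrite mulr0 m0/=.
have -> : (a - c * (- T) ^+ 2) * - T = T * (c * T * T - a) by ring.
rewrite cT; clearbody T; nra.
Qed.

(** The cubic is 0 at 0, [s a / 2] at s, and [- 2 s a] at [2 s], so it takes the value m once on
    each side of s within these intervals. *)
Lemma cubic_roots_pos (a c s m : R) : 0 < a -> 0 < c -> 0 < s -> c * s ^+ 2 = a / 2 ->
  0 < m -> m < s * a / 2 ->
  exists t1 t2, [/\ 0 < t1, t1 < t2, (a - c * t1 ^+ 2) * t1 = m & (a - c * t2 ^+ 2) * t2 = m].
Proof.
move=> a0 c0 s0 cs m0 ms.
have ps : (a - c * s ^+ 2) * s = s * a / 2 by rewrite cs; field.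
have [||t1 /andP[t10 t1s] pt1] := @cubic_ivt a c m 0 s; first exact: ltW.
  by left => /=; rewrite mulr0 m0 ps.
have [||t2 /andP[st2 _] pt2] := @cubic_ivt a c m s (2 * s).
- by lra.
- right => /=; rewrite ps ms andbT.
  rewrite (_ : _ * _ = (a - 4 * (c * s ^+ 2)) * (2 * s)); last by ring.
  rewrite cs; nra.
by exists t1, t2; split=> //; exact: lt_trans st2.
Qed.

End cubic.

Section positive_measure.
Context {R : realType} {n : nat}.

Lemma open_measure_gt0 (U : set 'rV[R]_n) : open U -> U !=set0 -> (0 < lebesgue_rV n U)%E.
Proof.
move=> oU [x Ux].
have /nbhs_ballP[r /= r0 hr] : nbhs x U by exact: open_nbhs_nbhs.
pose A (i : 'I_n) : set R := `](x ord0 i - r), (x ord0 i + r)[%classic.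
have AU : [set y : 'rV[R]_n | forall i, A i (y ord0 i)] `<=` U.
  move=> y Ay; apply: hr; apply/ball_rVP => // i.
  by have := Ay i; rewrite /A/= in_itv/= distrC ltr_distl.
have mA i : measurable (A i : set (measurableTypeR R)) by exact: measurable_itv.
apply: (@lt_le_trans _ _ (lebesgue_rV n [set y : 'rV[R]_n | forall i, A i (y ord0 i)])); last first.
  apply: le_measure => //; rewrite inE; last exact: open_measurable_rV.
  rewrite (_ : [set y : 'rV[R]_n | _] = \bigcap_(i in [set: 'I_n]) (rV_coord i @^-1` A i)).
    apply: fin_bigcap_measurable; first exact: finite_finset.
    by move=> i _; rewrite -[X in measurable X]setTI; exact: measurable_rV_coord.
  by apply/seteqP; split=> y h i => [_|]; exact: h.
rewrite (lebesgue_rV_box (A := A))//.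
rewrite (eq_bigr (fun=> (2 * r)%:E)); last first.
  move=> i _; rewrite lebesgue_measure_itv/= lte_fin ifT; last by lra.
  by rewrite -EFinB; congr EFin; ring.
by rewrite prodEFin lte_fin prodr_gt0// => i _; rewrite mulr_gt0.
Qed.

End positive_measure.

Section tpair_bound.
Context {R : realType}.

Lemma tpair_bound n (Omega : set 'rV[R]_n.+1) M f : open Omega -> 0 < M -> Omega `<=` box M ->
  Lp (hoelder_conjugate (sobolev_exponent R n.+1)) Omega f ->
  (n.+1 = 2%N -> forall v, H01 Omega v ->
     (@lebesgue_rV R n.+1).-integrable Omega (fun x => (f x * v x)%:E)) ->
  (lebesgue_rV n.+1).-integrable Omega (EFin \o f) /\
  exists2 C, 0 <= C & forall phi k, test_function Omega phi ->
    tpair Omega f k phi <= C * vnorm Omega (gradient phi).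
Proof.
move=> oO M0 OM.
case: n Omega oO OM f => [|[|n]] Omega oO OM f.
- rewrite /sobolev_exponent/= hoelder_conjugatey => /(Lp1_integrable oO) fi _.
  by split => //; exact: (tpair_bound_dim1 oO M0 OM).
- rewrite /sobolev_exponent/= hoelder_conjugatey => /(Lp1_integrable oO) fi fp.
  split => //.
  have mf : measurable_fun Omega f by case/integrableP : fi => /measurable_EFinP.
  apply: (uniform_boundedness oO M0 OM mf _ (test_poincare oO M0 OM)).
    exact: sqr_ge0.
  move=> u g ug; have hu : H01 Omega u by apply/(H01P oO M0 OM); exists g.
  by have /integrableP[] := fp erefl _ hu.
- rewrite /sobolev_exponent/=.
  have n1 : (0 : R) < n.+1%:R by [].
  have n3 : n.+3%:R = n.+1%:R + 2 :> R by rewrite -natr1 -natr1 -addrA.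
  (* With dimension [n.+3], [N - 2] is [n.+1], which gives the critical exponent the form used in
     [sobolev]. *)
  rewrite [X in X - 2]n3 addrK; set s := 2 * n.+3%:R / n.+1%:R.
  have s1 : 1 < s by rewrite /s ltr_pdivlMr// mul1r n3; move: (n.+1%:R : R) n1 => z; lra.
  have -> : hoelder_conjugate s%:E = (s / (s - 1))%:E.
    rewrite /hoelder_conjugate/= eqe gt_eqF ?(lt_trans ltr01)//.
    by rewrite -EFinB inver subr_eq0 gt_eqF.
  move=> hf _; split; last exact: (tpair_bound_dim3 oO M0 OM).
  apply: (Lp_integrable oO OM _ hf); rewrite ler_pdivlMr ?subr_gt0// mul1r.
  by rewrite gerBl.
Qed.

End tpair_bound.

(** * Multiples of the linear solution as solutions of the Kirchhoff problem *)

Section multiples.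
Context {R : realType} {n : nat}.
Local Notation mu := (@lebesgue_rV R n).
Variable Omega : set 'rV[R]_n.
Hypothesis oO : open Omega.
Variable M : R.
Hypotheses (M0 : 0 < M) (OM : Omega `<=` box M).
Let mO : measurable Omega := open_measurable_rV oO.
Variables (f : 'rV[R]_n -> R) (C : R).
Hypotheses (fi : mu.-integrable Omega (EFin \o f)) (C0 : 0 <= C).
Hypothesis tpairC : forall phi k, test_function Omega phi ->
  tpair Omega f k phi <= C * vnorm Omega (gradient phi).
Variables (w : 'rV[R]_n -> R) (g : 'rV[R]_n -> 'rV[R]_n).
Hypotheses (wg : H01g Omega w g).
Hypothesis gP : forall v h, H01g Omega v h -> vip Omega g h = pairing Omega f v.

Let mf : measurable_fun Omega f.
Proof. by case/integrableP : fi => /measurable_EFinP. Qed.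

Let Lg : vsqint Omega g.
Proof. by case: wg => _ wgw _; exact: (weak_gradient_vsqint oO wgw). Qed.

Lemma H01gZ t : H01g Omega (fun x => t * w x) (fun x => t *: g x).
Proof.
have := H01g_lin oO M0 OM t (H01g_test oO M0 OM (test0 Omega)) wg.
rewrite (_ : (fun x => 0 + t * w x) = (fun x => t * w x)); last first.
  by apply/funext => x; rewrite add0r.
rewrite (_ : (fun x => _ + t *: g x) = (fun x => t *: g x))//.
apply/funext => x; rewrite (_ : gradient _ x = 0) ?add0r//.
apply/rowP => i; rewrite !mxE /partial.
exact: derive_cst.
Qed.

Lemma vipZ t h : vsqint Omega h -> vip Omega (fun x => t *: g x) h = t * vip Omega g h.
Proof.
move=> Lh; rewrite /vip -RintegralZl//; last exact: dot_integrable.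
apply: eq_Rintegral => x _; rewrite /dot mulr_sumr; apply: eq_bigr => i _.
by rewrite mxE mulrA.
Qed.

Lemma weak_solutionZ (a b m t : R) : (a - b * vip Omega g g * t ^+ 2) * t = m ->
  weak_solution Omega a b m f (fun x => t * w x).
Proof.
move=> tm; have tw := H01gZ t; split; first by apply/(H01P oO M0 OM); exists (fun x => t *: g x).
move=> v /(H01P oO M0 OM)[h vh].
have [_ wgt _] := tw; have [_ wgv _] := vh.
have Lh := weak_gradient_vsqint oO wgv; have Lt := weak_gradient_vsqint oO wgt.
rewrite (dirichletE oO OM wgt wgt) (dirichletE oO OM wgt wgv) (vipZ _ Lh) (vipZ _ Lt).
rewrite (vipC Omega g (fun x => t *: g x)) (vipZ _ Lg) (gP vh).
have iv := pairing_integrable oO M0 OM mf C0 tpairC vh.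
(* The right-hand side is an extended real; integrability of [f v] makes it finite and reduces the
   equation to one in [R]. *)
rewrite -[X in (_ * X)%E]fineK; last exact: integrable_fin_num.
rewrite -EFinM -/(Rintegral _ _ _) -/(pairing Omega f v) -tm; congr EFin.
by ring.
Qed.

Hypothesis f0 : {ae mu, forall x, Omega x -> 0 < f x}.
Hypothesis O0 : Omega !=set0.

(** With zero energy, Cauchy-Schwarz makes the integral of [f phi] vanish for all test functions, so
    [f = 0] almost everywhere; but f is positive on a nonempty open set, which has positive
    measure. *)
Lemma energy_gt0 : 0 < vip Omega g g.
Proof.
rewrite lt_neqAle vip_ge0 andbT eq_sym; apply/eqP => D0.
have : f = (fun=> 0) %[ae mu in Omega].
  apply: (fundamental_lemma oO fi) => phi tp.
  have Lp := vsqint_gradient oO M0 OM tp.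
  rewrite -/(pairing Omega f phi) -(gP (H01g_test oO M0 OM tp)).
  apply/eqP; rewrite -sqrf_eq0; apply/eqP/le_anti.
  by rewrite sqr_ge0 andbT; have := vip_CS oO Lg Lp; rewrite D0 mul0r.
move=> fe; have : mu.-negligible Omega.
  have : {ae mu, forall x, ~ Omega x}.
    by apply: filterS2 f0 fe => x fx fx0 Ox; have := fx Ox; rewrite fx0// ltxx.
  by move=> h; apply: negligibleS h => x Ox; apply.
move=> /(measure_negligible mO) mu0; have := open_measure_gt0 oO O0.
by rewrite mu0 ltxx.
Qed.

(** If two multiples agreed, w would vanish almost everywhere, and so would the integral of [f w],
    which is the energy. *)
Lemma multiples_neq t s : t != s ->
  ~ ((fun x => t * w x) = (fun x => s * w x) %[ae mu in Omega]).
Proof.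
move=> ts h; have := energy_gt0; rewrite (gP wg).
have iw := pairing_integrable oO M0 OM mf C0 tpairC wg.
rewrite (_ : pairing Omega f w = 0) ?ltxx//.
rewrite /pairing /Rintegral (ae_eq_integral (fun=> 0%E))// ?integral0//.
  by case/integrableP : iw.
apply: filterS h => x hx Ox; have /eqP := hx Ox.
by rewrite -subr_eq0 -mulrBl mulf_eq0 subr_eq0 (negbTE ts)/= => /eqP ->; rewrite mulr0.
Qed.

Lemma nontrivial_weak_solutionZ (a b m t : R) : t != 0 -> (a - b * vip Omega g g * t ^+ 2) * t = m ->
  nontrivial_weak_solution Omega a b m f (fun x => t * w x).
Proof.
move=> t0 tm; split; first exact: weak_solutionZ.
move=> h; apply: (multiples_neq t0); apply: filterS h => x hx Ox.
by rewrite hx// mul0r.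
Qed.

End multiples.

(* For N = 2, f in L^1(Omega) does not make f v integrable for all v in
   H_0^1(Omega), so the right-hand side of the weak formulation need not be
   defined; that it is defined is the hypothesis f_pairing. For N <> 2 this
   follows from f_Lp and the Sobolev embedding, and is not assumed. *)
Theorem theorem1p1 (R : realType) (N : nat) (N_ge1 : (1 <= N)%N)
  (Omega : set 'rV[R]_N)
  (Omega_domain : bounded_domain Omega)
  (Omega_smooth : smooth_boundary Omega)
  (a b : R) (a_gt0 : 0 < a) (b_gt0 : 0 < b)
  (f : 'rV[R]_N -> R)
  (f_Lp : Lp (hoelder_conjugate (sobolev_exponent R N)) Omega f)
  (f_gt0 : {ae @lebesgue_rV R N, forall x, Omega x -> 0 < f x})
  (f_pairing : N = 2%N -> forall v, H01 Omega v ->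
     (@lebesgue_rV R N).-integrable Omega (fun x => (f x * v x)%:E)) :
  exists mu_star : R, 0 < mu_star /\
    (forall mu : R, 0 < mu -> mu < mu_star ->
      exists u1 u2 u3 : 'rV[R]_N -> R,
        [/\ nontrivial_weak_solution Omega a b mu f u1,
            nontrivial_weak_solution Omega a b mu f u2 &
            nontrivial_weak_solution Omega a b mu f u3] /\
        [/\ ~ (u1 = u2 %[ae @lebesgue_rV R N in Omega]),
            ~ (u1 = u3 %[ae @lebesgue_rV R N in Omega]) &
            ~ (u2 = u3 %[ae @lebesgue_rV R N in Omega])]) /\
    (forall mu : R, mu_star <= mu ->
      exists u : 'rV[R]_N -> R, nontrivial_weak_solution Omega a b mu f u).
Proof.
have [ne oO _ bO] := Omega_domain.
have [M M0 OM] := bounded_set_box bO.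
clear Omega_domain Omega_smooth bO.
case: N N_ge1 Omega ne oO OM f f_Lp f_gt0 f_pairing => //.
move=> n _ Omega ne oO OM f f_Lp f_gt0 f_pairing.
have [fi [C C0 tpairC]] := tpair_bound oO M0 OM f_Lp f_pairing.
have mf : measurable_fun Omega f by case/integrableP : fi => /measurable_EFinP.
have [w [g [wg gP]]] := riesz_solution oO M0 OM mf C0 tpairC (sqr_ge0 _) (test_poincare oO M0 OM).
have c0 : 0 < b * vip Omega g g.
  by rewrite mulr_gt0// (energy_gt0 oO M0 OM fi wg gP f_gt0 ne).
set c := b * vip Omega g g in c0.
have solution m t : t != 0 -> (a - c * t ^+ 2) * t = m ->
    nontrivial_weak_solution Omega a b m f (fun x => t * w x).
  exact: (nontrivial_weak_solutionZ oO M0 OM fi C0 tpairC wg gP f_gt0 ne).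
have neq t s : t != s ->
    ~ ((fun x => t * w x) = (fun x => s * w x) %[ae lebesgue_rV n.+1 in Omega]).
  exact: (multiples_neq oO M0 OM fi C0 tpairC wg gP f_gt0 ne).
clearbody c.
(* At s half of [a t] is lost, so [s * a / 2] is a positive value of the cubic. *)
pose s := Num.sqrt (a / (2 * c)).
have s0 : 0 < s by rewrite sqrtr_gt0 divr_gt0// mulr_gt0.
have cs : c * s ^+ 2 = a / 2.
  rewrite sqr_sqrtr ?divr_ge0 ?ltW// ?mulr_gt0//.
  by field; rewrite gt_eqF.
have m0 : 0 < s * a / 2 by rewrite divr_gt0// mulr_gt0.
exists (s * a / 2); split=> //; split=> m; last first.
  move=> /(lt_le_trans m0)/(cubic_root_neg a_gt0 c0)[t t0 tm].
  by exists (fun x => t * w x); apply: solution => //; rewrite lt_eqF.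
move=> m_gt0 ms.
have [t3 t30 tm3] := cubic_root_neg a_gt0 c0 m_gt0.
have [t1 [t2 [t10 t12 tm1 tm2]]] := cubic_roots_pos a_gt0 c0 s0 cs m_gt0 ms.
exists (fun x => t1 * w x), (fun x => t2 * w x), (fun x => t3 * w x).
have t20 := lt_trans t10 t12.
split; first by split; apply: solution; rewrite // ?(gt_eqF t10) ?(gt_eqF t20) ?(lt_eqF t30).
by split; apply: neq; [rewrite lt_eqF|rewrite gt_eqF ?(lt_trans t30)..].
Qed.
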